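(* Let $G=\langle a,t\mid r\rangle$ where $r$ is a cyclically reduced word in the free group $F(a,t)$ of length at most 12, $r$ has exponent sum $0$ in $t$, and $r$ is not a power of $a$. Then $G$ is not large if and only if either (i) up to cyclic permutation of $r$ or of $r^{-1}$ and replacing either generator by its inverse, $r$ is one of the following 13 words: 1. $t a^2 t^{-1} a t a t^{-1} a$; 2. $t a^2 t^{-1} a t a^{-1} t^{-1} a^{-1}$; 3. $t a^2 t^{-1} a^{-1} t a t^{-1} a^{-1}$; 4. $t a^2 t^{-1} a^2 t a^2 t^{-1} a$; 5. $t a^2 t^{-1} a^2 t a t^{-1} a^2$; 6. $t a^2 t^{-1} a^2 t a^{-1} t^{-1} a^{-2}$; 7. $t a^2 t^{-1} a^2 t a^{-2} t^{-1} a^{-1}$; 8. $t a^2 t^{-1} a t a^{-2} t^{-1} a^{-2}$; 9. $t a^2 t^{-1} a^{-1} t a^2 t^{-1} a^{-2}$; 10. $t a^2 t^{-1} a^{-2} t a t^{-1} a^{-2}$; 11. $t a^3 t^{-1} a t a^2 t^{-1} a$; 12. $t a^3 t^{-1} a t a^{-2} t^{-1} a^{-1}$; 13. $t a^3 t^{-1} a^{-1} t a^2 t^{-1} a^{-1}$; or (ii) the presentation is of the form $\langle a,t\mid ta^pt^{-1}=a^q\rangle$ with $p,q$ coprime integers.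
   Context: A group is large if it has a finite index subgroup admitting a surjective homomorphism onto a non-abelian free group. Word length is length in the free group on $a,t$. (A presentation with relator having exponent sum 0 in one generator is said to be in Magnus form with respect to that generator.) *)

(* Defs.v *)
From Stdlib Require Import List ZArith Relations.
Import ListNotations.
Open Scope Z_scope.

(** Letters over a generating type X: (x, true) = x, (x, false) = x^-1. *)
Definition letter (X : Type) : Type := (X * bool)%type.
Definition word (X : Type) : Type := list (letter X).

Definition inv_letter {X : Type} (l : letter X) : letter X := (fst l, negb (snd l)).
Definition winv {X : Type} (w : word X) : word X := rev (map inv_letter w).

Inductive pstep {X : Type} (R : list (word X)) : word X -> word X -> Prop :=
| pstep_free : forall (u v : word X) (l : letter X),
    pstep R (u ++ v) (u ++ l :: inv_letter l :: v)
| pstep_rel : forall (u v r : word X),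
    In r R -> pstep R (u ++ v) (u ++ r ++ v).

(** Equality of the elements represented by two words in the group
    < X | R > (congruence generated by the moves); with R = [] this is
    equality in the free group F(X). *)
Definition peq {X : Type} (R : list (word X)) : word X -> word X -> Prop :=
  clos_refl_sym_trans (word X) (pstep R).

(** The group G = < X | R > is large: it has a finite index subgroup H
    (given by its set of representing words, closed under peq) admitting a
    surjective homomorphism onto a non-abelian free group F(Y), |Y| >= 2.
    Multiplication is concatenation, inversion is winv, identity is []. *)
Definition large {X : Type} (R : list (word X)) : Prop :=
  exists H : word X -> Prop,
    (forall u v, peq R u v -> H u -> H v) /\
    H [] /\
    (forall u v, H u -> H v -> H (u ++ v)) /\
    (forall u, H u -> H (winv u)) /\
    (exists cs : list (word X), forall g : word X,
        exists c, In c cs /\ H (winv c ++ g)) /\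
    exists (Y : Type) (y1 y2 : Y), y1 <> y2 /\
    exists phi : word X -> word Y,
      (forall u v, H u -> H v -> peq R u v -> peq [] (phi u) (phi v)) /\
      (forall u v, H u -> H v -> peq [] (phi (u ++ v)) (phi u ++ phi v)) /\
      (forall z : word Y, exists u, H u /\ peq [] (phi u) z).

Inductive gen : Type := ga | gt.

Definition reduced {X : Type} (w : word X) : Prop :=
  forall (u v : word X) (l : letter X), w <> u ++ l :: inv_letter l :: v.

Definition cyclically_reduced {X : Type} (w : word X) : Prop :=
  reduced w /\
  forall (l l' : letter X) (m : word X), w = l :: m ++ [l'] -> l' <> inv_letter l.

Definition t_expsum (w : word gen) : Z :=
  fold_right (fun l s => match l with
                         | (gt, true) => s + 1
                         | (gt, false) => s - 1
                         | (ga, _) => s end) 0 w.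

Definition gpow (x : gen) (n : Z) : word gen :=
  if 0 <=? n then repeat (x, true) (Z.to_nat n)
  else repeat (x, false) (Z.to_nat (- n)).

Definition syl (s : list (gen * Z)) : word gen :=
  flat_map (fun p => gpow (fst p) (snd p)) s.

Definition is_power_of_a (r : word gen) : Prop :=
  exists n : Z, peq [] r (gpow ga n).

Definition rot {X : Type} (k : nat) (w : word X) : word X :=
  skipn k w ++ firstn k w.

Definition subst_inv (ea et : bool) (w : word gen) : word gen :=
  map (fun l => match l with
                | (ga, b) => (ga, xorb ea b)
                | (gt, b) => (gt, xorb et b) end) w.

Definition equiv_rel (r w : word gen) : Prop :=
  exists (s : word gen) (k : nat) (ea et : bool),
    (s = r \/ s = winv r) /\ rot k s = subst_inv ea et w.

Definition w13 : list (word gen) :=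
  [ syl [(gt,1);(ga,2);(gt,-1);(ga,1);(gt,1);(ga,1);(gt,-1);(ga,1)];
    syl [(gt,1);(ga,2);(gt,-1);(ga,1);(gt,1);(ga,-1);(gt,-1);(ga,-1)];
    syl [(gt,1);(ga,2);(gt,-1);(ga,-1);(gt,1);(ga,1);(gt,-1);(ga,-1)];
    syl [(gt,1);(ga,2);(gt,-1);(ga,2);(gt,1);(ga,2);(gt,-1);(ga,1)];
    syl [(gt,1);(ga,2);(gt,-1);(ga,2);(gt,1);(ga,1);(gt,-1);(ga,2)];
    syl [(gt,1);(ga,2);(gt,-1);(ga,2);(gt,1);(ga,-1);(gt,-1);(ga,-2)];
    syl [(gt,1);(ga,2);(gt,-1);(ga,2);(gt,1);(ga,-2);(gt,-1);(ga,-1)];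
    syl [(gt,1);(ga,2);(gt,-1);(ga,1);(gt,1);(ga,-2);(gt,-1);(ga,-2)];
    syl [(gt,1);(ga,2);(gt,-1);(ga,-1);(gt,1);(ga,2);(gt,-1);(ga,-2)];
    syl [(gt,1);(ga,2);(gt,-1);(ga,-2);(gt,1);(ga,1);(gt,-1);(ga,-2)];
    syl [(gt,1);(ga,3);(gt,-1);(ga,1);(gt,1);(ga,2);(gt,-1);(ga,1)];
    syl [(gt,1);(ga,3);(gt,-1);(ga,1);(gt,1);(ga,-2);(gt,-1);(ga,-1)];
    syl [(gt,1);(ga,3);(gt,-1);(ga,-1);(gt,1);(ga,2);(gt,-1);(ga,-1)] ].

Definition bs_rel (p q : Z) : word gen := syl [(gt,1);(ga,p);(gt,-1);(ga,-q)].

(* Main.v *)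
Require Import Defs.
From Stdlib Require Import Ascii String Bool List ZArith Lia Relations Setoid Morphisms
  Classical ClassicalEpsilon Znumtheory Zpow_facts.
Import ListNotations.
Open Scope Z_scope.

(** Largeness. If a finite-index subgroup of a finitely presented group maps onto the
    lamplighter group Z/p wr Z, then the group is large: the lamplighter group is a limit
    of virtually free groups, and the map lifts to one of these because only finitely
    many relators, each of bounded length, have to be respected. Concretely, only the
    position modulo a large m and the lamp at the site 0 are kept, and the passage from
    site 0 to site 1 is recorded in a free group by a generator which depends on that lamp.
    Up to equivalence there are 1201 relators to consider; for 1160 of them the map from a
    finite-index subgroup to a lamplighter group is given explicitly.

    Non-largeness. In the remaining cases write b for t a t^-1. Either the group is a
    Baumslag-Solitar group t c^p t^-1 = c^q with p, q coprime, and then the order of c in a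
    finite quotient is coprime to p and q, so that c generates a normal subgroup there; or
    the relator says that a power of one of a, b conjugates y^i to y^j, where y is the
    other one and |i - j| = 1, and then a, b, being conjugate, have the same order n in a
    finite quotient, so n divides u^n - 1 with u = j/i modulo n, which forces n = 1. Hence
    all finite quotients are metabelian, whereas a finite-index subgroup of a large group
    maps onto the symmetric group of degree 4. *)

(** * Words *)

(** The lamplighter quotients come from homology. Let a finite-index subgroup map onto Z with kernel
    K. If the Alexander polynomial of this map vanishes modulo p, the first homology of K over Z/p
    has positive rank as a module over the principal ideal domain of Laurent polynomials in s over
    Z/p, hence maps onto that ring; the ring extended by the shift s is the lamplighter group. Such
    a quotient amounts to finite data, namely permutations of the cosets with lamplighter words on
    the edges, so that largeness of a given relator becomes a computation. For the converse, the
    obstacle is that largeness concerns an unknown subgroup while the relators only control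
    quotients of the whole group. The core of the preimage of a point stabilizer bridges this. The
    symmetric group of degree 4 is a good target because it is generated by two elements and has
    order 24, the least order of a non-metabelian group. Signs and rotation bring every relator to
    the form t a ..., which leaves at most 3^10 reduced words of length 12 to inspect. *)

Lemma inv_letter_involutive {X} (l : letter X) : inv_letter (inv_letter l) = l.
Proof. destruct l as [x []]; reflexivity. Qed.

Lemma winv_app {X} (u v : word X) : winv (u ++ v) = winv v ++ winv u.
Proof. unfold winv. now rewrite map_app, rev_app_distr. Qed.

Lemma winv_cons {X} (l : letter X) (w : word X) : winv (l :: w) = winv w ++ [inv_letter l].
Proof. reflexivity. Qed.

Lemma winv_involutive {X} (w : word X) : winv (winv w) = w.
Proof.
  induction w as [|l w IH]; [reflexivity|].
  rewrite winv_cons, winv_app, IH; simpl. now rewrite inv_letter_involutive.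
Qed.

Lemma pstep_context {X} (R : list (word X)) (x y u v : word X) :
  pstep R u v -> pstep R (x ++ u ++ y) (x ++ v ++ y).
Proof.
  intros [u' v' l | u' v' r Hr].
  - replace (x ++ (u' ++ v') ++ y) with ((x ++ u') ++ v' ++ y) by now rewrite <- !app_assoc.
    replace (x ++ (u' ++ l :: inv_letter l :: v') ++ y)
      with ((x ++ u') ++ l :: inv_letter l :: v' ++ y) by now rewrite <- !app_assoc.
    constructor.
  - replace (x ++ (u' ++ v') ++ y) with ((x ++ u') ++ v' ++ y) by now rewrite <- !app_assoc.
    replace (x ++ (u' ++ r ++ v') ++ y) with ((x ++ u') ++ r ++ v' ++ y)
      by now rewrite <- !app_assoc.
    now constructor.
Qed.

#[global] Instance peq_equivalence {X} (R : list (word X)) : Equivalence (peq R).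
Proof.
  split; [intro; apply rst_refl | intros ? ? ?; now apply rst_sym
         | intros ? ? ? ? ?; eapply rst_trans; eassumption].
Qed.

Lemma peq_context {X} (R : list (word X)) (x y u v : word X) :
  peq R u v -> peq R (x ++ u ++ y) (x ++ v ++ y).
Proof.
  induction 1.
  - apply rst_step. now apply pstep_context.
  - reflexivity.
  - now symmetry.
  - etransitivity; eassumption.
Qed.

#[global] Instance app_peq {X} (R : list (word X)) :
  Proper (peq R ==> peq R ==> peq R) (@app (letter X)).
Proof.
  intros u u' Hu v v' Hv.
  transitivity (u' ++ v).
  - exact (peq_context R [] v u u' Hu).
  - pose proof (peq_context R u' [] v v' Hv) as H. rewrite !app_nil_r in H. exact H.
Qed.

Lemma peq_cancel {X} (R : list (word X)) (l : letter X) : peq R [l; inv_letter l] [].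
Proof. symmetry. apply rst_step. exact (pstep_free R [] [] l). Qed.

Lemma peq_relator {X} (R : list (word X)) (r : word X) : In r R -> peq R r [].
Proof.
  intro H. symmetry. apply rst_step.
  pose proof (pstep_rel R [] [] r H) as S. simpl in S. now rewrite app_nil_r in S.
Qed.

Lemma peq_winv_r {X} (R : list (word X)) (w : word X) : peq R (w ++ winv w) [].
Proof.
  induction w as [|l w IH]; [reflexivity|].
  rewrite winv_cons.
  change ((l :: w) ++ winv w ++ [inv_letter l]) with ([l] ++ w ++ winv w ++ [inv_letter l]).
  rewrite (app_assoc w), IH. apply peq_cancel.
Qed.

Lemma peq_winv_l {X} (R : list (word X)) (w : word X) : peq R (winv w ++ w) [].
Proof. rewrite <- (winv_involutive w) at 2. apply peq_winv_r. Qed.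

#[global] Instance winv_peq {X} (R : list (word X)) :
  Proper (peq R ==> peq R) (@winv X).
Proof.
  intros u v H.
  rewrite <- (app_nil_r (winv u)), <- (peq_winv_r R v), <- H at 1.
  rewrite app_assoc, peq_winv_l. reflexivity.
Qed.

(** [peq R] is the least congruence for concatenation that contains the cancellations and the
    relators, so an invariant of words descends to the group once it has been checked on these. *)
Lemma peq_ind_group {X} (R : list (word X)) (E : word X -> word X -> Prop) :
  Equivalence E -> Proper (E ==> E ==> E) (@app (letter X)) ->
  (forall l, E [l; inv_letter l] []) -> (forall r, In r R -> E r []) ->
  forall u v, peq R u v -> E u v.
Proof.
  intros HE HP Hl Hr u v H. induction H as [u v H | | |].
  - destruct H as [u v l | u v r H].
    + change (l :: inv_letter l :: v) with ([l; inv_letter l] ++ v).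
      rewrite (Hl l). reflexivity.
    + rewrite (Hr r H). reflexivity.
  - reflexivity.
  - now symmetry.
  - etransitivity; eassumption.
Qed.

(** * A criterion for largeness *)

Section LabelledAction.

Variables (X S : Type) (R : list (word X)).
Variable act : letter X -> S -> S.
Variable lab : letter X -> S -> word bool.

Fixpoint run (w : word X) (s : S) : S :=
  match w with [] => s | l :: w => run w (act l s) end.

Fixpoint labels (w : word X) (s : S) : word bool :=
  match w with [] => [] | l :: w => lab l s ++ labels w (act l s) end.

Lemma run_app u v s : run (u ++ v) s = run v (run u s).
Proof. revert s; induction u; simpl; auto. Qed.

Lemma labels_app u v s : labels (u ++ v) s = labels u s ++ labels v (run u s).
Proof.
  revert s; induction u as [|l u IH]; intro s; simpl; [reflexivity|].
  now rewrite IH, app_assoc.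
Qed.

Variable states : list S.
Hypothesis act_states : forall l s, In s states -> In (act l s) states.
Hypothesis act_inv : forall l s, In s states -> act (inv_letter l) (act l s) = s.
Hypothesis lab_inv : forall l s, In s states ->
  peq [] (lab l s ++ lab (inv_letter l) (act l s)) [].
Hypothesis act_rel : forall r s, In r R -> In s states -> run r s = s.
Hypothesis lab_rel : forall r s, In r R -> In s states -> peq [] (labels r s) [].

Lemma run_states w s : In s states -> In (run w s) states.
Proof. revert s; induction w; simpl; auto. Qed.

(** Restricted to [states], since [act] is only known to be invertible there. *)
Definition same_labelled_action (u v : word X) : Prop :=
  forall s, In s states -> run u s = run v s /\ peq [] (labels u s) (labels v s).

Lemma peq_same_labelled_action u v : peq R u v -> same_labelled_action u v.
Proof.
  apply peq_ind_group.
  - split.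
    + intros w s _; split; reflexivity.
    + intros w w' H s Hs; destruct (H s Hs); split; now symmetry.
    + intros w w' w'' H H' s Hs; destruct (H s Hs), (H' s Hs).
      split; etransitivity; eassumption.
  - intros w w' H z z' H' s Hs.
    rewrite !run_app, !labels_app.
    destruct (H s Hs) as [E P]. rewrite <- E, P.
    destruct (H' (run w s) (run_states w s Hs)) as [E' P'].
    split; [exact E' | now rewrite P'].
  - intros l s Hs; simpl. split; [now apply act_inv|].
    rewrite app_nil_r. now apply lab_inv.
  - intros r Hr s Hs; simpl. split; [now apply act_rel | now apply lab_rel].
Qed.

Lemma run_winv w s : In s states -> run (winv w) (run w s) = s.
Proof.
  intro Hs. rewrite <- run_app.
  exact (proj1 (peq_same_labelled_action _ [] (peq_winv_r R w) s Hs)).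
Qed.

Lemma labels_winv w s : In s states ->
  peq [] (labels (winv w) (run w s)) (winv (labels w s)).
Proof.
  intro Hs.
  pose proof (proj2 (peq_same_labelled_action _ [] (peq_winv_r R w) s Hs)) as H.
  rewrite labels_app in H; simpl in H.
  rewrite <- (app_nil_r (winv (labels w s))), <- H, app_assoc, peq_winv_l.
  reflexivity.
Qed.

Variable s0 : S.
Hypothesis s0_state : In s0 states.

(** Whether a state can be reached from [s0] is settled classically; an unreachable state
    contributes no representative. *)
Lemma transversal_of_states (l : list S) : exists cs : list (word X),
  forall s g, In s l -> run g s0 = s -> exists c, In c cs /\ run c s0 = s.
Proof.
  induction l as [|s l [cs IH]]; [now exists [] |].
  destruct (classic (exists c, run c s0 = s)) as [[c Hc]|N].
  - exists (c :: cs). intros s' g [<-|H] E; [exists c; simpl; auto|].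
    destruct (IH s' g H E) as [c' [? ?]]; exists c'; simpl; auto.
  - exists cs. intros s' g [<-|H] E; [|eauto].
    exfalso; apply N; now exists g.
Qed.

(** The subgroup is the stabilizer of [s0], of finite index because [states] is finite. Reading
    labels along loops at [s0] is a homomorphism on it, and [w1], [w2] are sent to a basis of the
    free group. *)
Lemma large_of_labelled_action (w1 w2 : word X) :
  run w1 s0 = s0 -> peq [] (labels w1 s0) [(true, true)] ->
  run w2 s0 = s0 -> peq [] (labels w2 s0) [(false, true)] ->
  large R.
Proof.
  intros R1 L1 R2 L2.
  assert (W : forall w, run w s0 = s0 -> run (winv w) s0 = s0).
  { intros w H. rewrite <- H at 1. now apply run_winv. }
  exists (fun w => run w s0 = s0). repeat split.
  - intros u v H E. rewrite <- E at 2. symmetry.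
    now apply peq_same_labelled_action.
  - intros u v E E'. now rewrite run_app, E, E'.
  - exact W.
  - destruct (transversal_of_states states) as [cs H].
    (* Words act on the right, so the left coset of [g] is determined by the state to which the
       inverse of [g] leads. *)
    exists (map (fun c => winv c) cs). intro g.
    destruct (H (run (winv g) s0) (winv g)) as [c [Hc E]].
    + now apply run_states.
    + reflexivity.
    + exists (winv c). split; [now apply in_map|].
      rewrite winv_involutive, run_app, E.
      rewrite <- (winv_involutive g) at 1. now apply run_winv.
  - exists bool, true, false. split; [discriminate|].
    exists (fun w => labels w s0). repeat split.
    + intros u v _ _ H. now apply peq_same_labelled_action.
    + intros u v E _. rewrite labels_app, E. reflexivity.
    + intro z. induction z as [|[b e] z [u [Ru Lu]]].
      { exists []. split; reflexivity. }
      assert (exists w, run w s0 = s0 /\ peq [] (labels w s0) [(b, e)]) as [w [Rw Lw]].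
      { assert (G : exists w, run w s0 = s0 /\ peq [] (labels w s0) [(b, true)])
          by (destruct b; eauto).
        destruct e; [exact G|]. destruct G as [w [Rw Lw]].
        exists (winv w). split; [now apply W|].
        rewrite <- Rw at 1. rewrite labels_winv, Lw by assumption. reflexivity. }
      exists (w ++ u). rewrite run_app, labels_app, Rw, Lw, Lu. split; [exact Ru|reflexivity].
Qed.

End LabelledAction.

(** * The lamplighter group *)

Inductive lgen : Type := lx | ls.

Definition sgn (b : bool) : Z := if b then 1 else -1.

Fixpoint displacement (w : word lgen) : Z :=
  match w with
  | [] => 0
  | (lx, _) :: w => displacement w
  | (ls, b) :: w => sgn b + displacement w
  end.

(** The site [k] is counted from where the reading of [w] begins, hence the shift by [sgn b] after a
    step. Lamps are integers here; they are reduced modulo [p] only when compared. *)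
Fixpoint lamp (w : word lgen) (k : Z) : Z :=
  match w with
  | [] => 0
  | (lx, b) :: w => (if k =? 0 then sgn b else 0) + lamp w k
  | (ls, b) :: w => lamp w (k - sgn b)
  end.

Section Lamplighter.

Variables m p : Z.
Hypothesis m_gt1 : 1 < m.
Hypothesis p_gt1 : 1 < p.

(* Only the position modulo m and the lamp at the site 0 are remembered; walking
   from 0 to 1 emits a free generator that depends on whether that lamp is lit. *)
Definition lact (l : letter lgen) (q : Z * Z) : Z * Z :=
  match l with
  | (lx, b) => if fst q =? 0 then (fst q, (snd q + sgn b) mod p) else q
  | (ls, b) => ((fst q + sgn b) mod m, snd q)
  end.

Definition emit (v : Z) : word bool := [(v =? 0, true)].

(** Both non-trivial cases concern the one edge between the positions 0 and 1. Crossing it leaves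
    the lamp unchanged, so the two directions carry inverse labels. *)
Definition llab (l : letter lgen) (q : Z * Z) : word bool :=
  match l with
  | (lx, _) => []
  | (ls, true) => if fst q =? 0 then emit (snd q) else []
  | (ls, false) => if fst q =? 1 then winv (emit (snd q)) else []
  end.

Notation lrun := (run lgen (Z * Z) lact).
Notation llabels := (labels lgen (Z * Z) lact llab).

Definition lstates : list (Z * Z) :=
  list_prod (map Z.of_nat (seq 0 (Z.to_nat m))) (map Z.of_nat (seq 0 (Z.to_nat p))).

Lemma in_zrange n x : 0 <= n ->
  In x (map Z.of_nat (seq 0 (Z.to_nat n))) <-> 0 <= x < n.
Proof.
  intro Hn. rewrite in_map_iff. split.
  - intros [k [<- H]]. apply in_seq in H. lia.
  - intro H. exists (Z.to_nat x). split; [lia|]. apply in_seq. lia.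
Qed.

Lemma in_lstates q : In q lstates <-> 0 <= fst q < m /\ 0 <= snd q < p.
Proof.
  destruct q as [x v]. unfold lstates.
  rewrite in_prod_iff, !in_zrange by lia. reflexivity.
Qed.

Lemma lact_lstates l q : In q lstates -> In (lact l q) lstates.
Proof.
  rewrite !in_lstates. destruct l as [[] b]; simpl.
  - destruct (fst q =? 0); simpl; [|tauto].
    intros [? ?]. split; [lia|]. apply Z.mod_pos_bound; lia.
  - intros [? ?]. split; [|assumption]. apply Z.mod_pos_bound; lia.
Qed.

Lemma mod_add_sgn_cancel n x b : 1 < n -> 0 <= x < n ->
  ((x + sgn b) mod n + sgn (negb b)) mod n = x.
Proof.
  intros Hn Hx. rewrite Zplus_mod_idemp_l.
  replace (x + sgn b + sgn (negb b)) with x by (destruct b; simpl; lia).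
  now apply Z.mod_small.
Qed.

Lemma lact_inv l q : In q lstates -> lact (inv_letter l) (lact l q) = q.
Proof.
  rewrite in_lstates. destruct q as [x v], l as [[] b]; simpl; intros [? ?].
  - destruct (x =? 0) eqn:E; simpl; rewrite E; [|reflexivity].
    now rewrite mod_add_sgn_cancel.
  - now rewrite mod_add_sgn_cancel.
Qed.

Lemma llab_inv l q : In q lstates ->
  peq [] (llab l q ++ llab (inv_letter l) (lact l q)) [].
Proof.
  rewrite in_lstates. destruct q as [x v], l as [[] b]; simpl; intros [? ?]; [reflexivity|].
  destruct b; simpl.
  - destruct (Z.eq_dec x (m - 1)) as [->|N].
    + replace (m - 1 + 1) with m by lia. rewrite Z_mod_same_full.
      replace (m - 1 =? 0) with false by lia. reflexivity.
    + rewrite Z.mod_small by lia.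
      replace (x + 1 =? 1) with (x =? 0) by lia.
      destruct (x =? 0); [apply peq_cancel | reflexivity].
  - destruct (Z.eq_dec x 0) as [->|N].
    + replace ((0 + -1) mod m) with (m - 1) by (apply (Z.mod_unique _ _ (-1)); lia).
      replace (m - 1 =? 0) with false by lia. reflexivity.
    + rewrite Z.mod_small by lia.
      replace (x + -1 =? 0) with (x =? 1) by lia.
      destruct (x =? 1); [apply (peq_cancel [] (_, false)) | reflexivity].
Qed.

(* A walk that stays within distance < m of the multiple z of m can only meet
   the site 0 at z; so what it emits is the variation of the potential below. *)
Definition potential (z x v : Z) : word bool := if x <=? z then [] else emit v.

Lemma lrun_in_window (w : word lgen) (z x v : Z) :
  z mod m = 0 -> Z.abs (x - z) + Z.of_nat (length w) < m -> 0 <= v < p ->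
  let v' := (v + lamp w (z - x)) mod p in
  lrun w (x mod m, v) = ((x + displacement w) mod m, v') /\
  peq [] (potential z x v ++ llabels w (x mod m, v)) (potential z (x + displacement w) v').
Proof.
  intro Hz. revert x v.
  assert (Z0 : forall y, Z.abs (y - z) < m -> (y mod m =? 0) = (y =? z)).
  { intros y Hy. destruct (Z.eqb_spec y z) as [->|N]; [now rewrite Hz|].
    apply Z.eqb_neq. intro E. apply N.
    assert (D : (m | y - z)).
    { apply Z.mod_divide; [lia|]. rewrite Zminus_mod, E, Hz. reflexivity. }
    destruct D as [k D]. rewrite D, Z.abs_mul, (Z.abs_eq m) in Hy by lia.
    assert (Z.abs k < 1) by (apply (Z.mul_lt_mono_pos_r m); lia).
    assert (k = 0) as -> by lia. lia. }
  induction w as [|[[] b] w IH]; intros x v Hw Hv; simpl in Hw |- *.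
  - rewrite !Z.add_0_r, (Z.mod_small v) by lia. split; [reflexivity|now rewrite app_nil_r].
  - rewrite Z0 by lia.
    assert (Hb : 0 <= (v + sgn b) mod p < p) by (apply Z.mod_pos_bound; lia).
    replace (z - x =? 0) with (x =? z) by lia.
    (* The lamp changes only while the walk stands at [z], where the potential is empty whatever the
       lamp shows. *)
    destruct (Z.eqb_spec x z) as [->|N].
    + destruct (IH z ((v + sgn b) mod p)) as [E P]; [lia|assumption|].
      rewrite Zplus_mod_idemp_l, <- Z.add_assoc in E, P.
      split; [exact E|].
      unfold potential in P |- *. rewrite Z.leb_refl in P |- *. exact P.
    + exact (IH x v ltac:(lia) Hv).
  - destruct (IH (x + sgn b) v) as [E P]; [destruct b; simpl; lia|assumption|].
    replace (z - (x + sgn b)) with (z - x - sgn b) in E, P by lia.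
    rewrite Z.add_assoc. rewrite <- Zplus_mod_idemp_l in E at 1, P at 1.
    split; [exact E|].
    etransitivity; [|exact P]. rewrite app_assoc. apply app_peq; [|reflexivity].
    unfold potential. destruct b; simpl sgn.
    + rewrite Z0 by lia. destruct (Z.eqb_spec x z) as [->|N].
      * rewrite Z.leb_refl. replace (z + 1 <=? z) with false by lia. reflexivity.
      * rewrite app_nil_r. replace (x + 1 <=? z) with (x <=? z) by lia. reflexivity.
    (* A backward step emits exactly when it leaves [z + 1]; the test at position 1 is turned into
       the test [Z0] at the site before it. *)
    + assert (E1 : (x mod m =? 1) = (x - 1 =? z)).
      { rewrite <- Z0 by lia. rewrite Zminus_mod.
        pose proof (Z.mod_pos_bound x m ltac:(lia)).
        rewrite (Z.mod_small 1) by lia.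
        destruct (Z.eq_dec (x mod m) 0) as [->|N].
        - symmetry. apply Z.eqb_neq.
          rewrite <- (Z.mod_unique (0 - 1) m (-1) (m - 1)) by lia. lia.
        - rewrite (Z.mod_small (x mod m - 1)) by lia. lia. }
      rewrite E1. destruct (Z.eqb_spec (x - 1) z) as [E2|N].
      * replace (x <=? z) with false by lia. replace (x + -1 <=? z) with true by lia.
        apply peq_winv_r.
      * rewrite app_nil_r. replace (x + -1 <=? z) with (x <=? z) by lia. reflexivity.
Qed.

(** One of the multiples 0 and [m] lies within [m / 2] of the start, and a word of length below
    [m / 2] stays in the window around it: it cannot tell the circle from the line. It ends at the
    same site with the same lamp, so the potential does not vary. *)
Lemma lrun_trivial (w : word lgen) (q : Z * Z) :
  displacement w = 0 -> (forall k, lamp w k mod p = 0) -> 2 * Z.of_nat (length w) < m ->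
  In q lstates -> lrun w q = q /\ peq [] (llabels w q) [].
Proof.
  intros Hs Hl Hm Hq. apply in_lstates in Hq. destruct q as [x v]; simpl in Hq.
  assert (exists z, z mod m = 0 /\ Z.abs (x - z) + Z.of_nat (length w) < m) as [z [Hz Hx]].
  { destruct (Z.le_gt_cases (2 * x) m).
    - exists 0. split; [apply Zmod_0_l | lia].
    - exists m. split; [apply Z_mod_same_full | lia]. }
  destruct (lrun_in_window w z x v Hz Hx ltac:(lia)) as [E P].
  rewrite Hs, Z.add_0_r, Zplus_mod, Hl, Z.add_0_r, Zmod_mod in E, P.
  rewrite !(Z.mod_small v), !(Z.mod_small x) in E, P by lia. split; [exact E|].
  rewrite <- (app_nil_l (llabels _ _)), <- (peq_winv_l [] (potential z x v)).
  rewrite <- app_assoc, P. reflexivity.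
Qed.

End Lamplighter.

(** * Maps from a finite-index subgroup to the lamplighter group, encoded on a coset graph *)

Section CocycleCriterion.

Variables (X : Type) (R : list (word X)) (d : nat) (p : Z).
Variable cact : letter X -> nat -> nat.
Variable clab : letter X -> nat -> word lgen.

Fixpoint crun (w : word X) (i : nat) : nat :=
  match w with [] => i | l :: w => crun w (cact l i) end.

(** A crossed homomorphism over the action on [d] points. On the stabilizer of a point it is
    multiplicative, so it encodes a map defined on a finite-index subgroup in terms of words in the
    generators of the whole group. *)
Fixpoint cocycle (w : word X) (i : nat) : word lgen :=
  match w with [] => [] | l :: w => clab l i ++ cocycle w (cact l i) end.

Hypothesis p_gt1 : 1 < p.
Hypothesis d_pos : (0 < d)%nat.
Hypothesis cact_lt : forall l i, (i < d)%nat -> (cact l i < d)%nat.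
Hypothesis cact_inv : forall l i, (i < d)%nat -> cact (inv_letter l) (cact l i) = i.
Hypothesis clab_inv : forall l i, (i < d)%nat ->
  clab (inv_letter l) (cact l i) = winv (clab l i).
Hypothesis crun_rel : forall r i, In r R -> (i < d)%nat -> crun r i = i.
Hypothesis cocycle_rel : forall r i, In r R -> (i < d)%nat ->
  displacement (cocycle r i) = 0 /\ forall k, lamp (cocycle r i) k mod p = 0.

Section Modulus.
Variable m : Z.
Hypothesis m_gt1 : 1 < m.

Definition sact (l : letter X) (s : nat * (Z * Z)) : nat * (Z * Z) :=
  (cact l (fst s), run lgen (Z * Z) (lact m p) (clab l (fst s)) (snd s)).

Definition slab (l : letter X) (s : nat * (Z * Z)) : word bool :=
  labels lgen (Z * Z) (lact m p) llab (clab l (fst s)) (snd s).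

Lemma srun_cocycle w i q :
  run X _ sact w (i, q) = (crun w i, run lgen (Z * Z) (lact m p) (cocycle w i) q) /\
  labels X _ sact slab w (i, q) = labels lgen (Z * Z) (lact m p) llab (cocycle w i) q.
Proof.
  revert i q; induction w as [|l w IH]; intros i q; simpl; [split; reflexivity|].
  rewrite run_app, labels_app.
  destruct (IH (cact l i) (run lgen (Z * Z) (lact m p) (clab l i) q)) as [E E'].
  unfold sact at 2, slab at 1; unfold sact at 3; simpl. rewrite E, E'. split; reflexivity.
Qed.

Definition sstates : list (nat * (Z * Z)) := list_prod (seq 0 d) (lstates m p).

Lemma in_sstates i q : In (i, q) sstates <-> (i < d)%nat /\ In q (lstates m p).
Proof. unfold sstates. rewrite in_prod_iff, in_seq. intuition lia. Qed.

End Modulus.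

(** [h] acts as the pure shift and [u] changes the lamp at the origin. The loops [h^m] and
    [u h^m u^-1] go once round the circle with different lamps at the site 0, hence emit the two
    free generators; the relators give words of length below [m / 2], which emit nothing. *)
Lemma large_of_cocycle (h u : word X) :
  crun h 0%nat = 0%nat -> displacement (cocycle h 0%nat) = 1 ->
  (forall k, lamp (cocycle h 0%nat) k mod p = 0) ->
  crun u 0%nat = 0%nat -> displacement (cocycle u 0%nat) = 0 ->
  lamp (cocycle u 0%nat) 0 mod p <> 0 ->
  large R.
Proof.
  intros Rh Sh Lh Ru Su Lu.
  assert (exists m, 1 < m /\
    2 * Z.of_nat (length (cocycle h 0%nat)) < m /\
    2 * Z.of_nat (length (cocycle u 0%nat)) < m /\
    forall r i, In r R -> (i < d)%nat -> 2 * Z.of_nat (length (cocycle r i)) < m)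
    as (m & Hm & Hhm & Hum & Hrm).
  { assert (exists n, forall r i, In r R -> (i < d)%nat -> (length (cocycle r i) <= n)%nat)
      as [n Hn].
    { exists (list_max (map (fun x => length (cocycle (fst x) (snd x)))
                          (list_prod R (seq 0 d)))).
      intros r i Hr Hi.
      refine (proj1 (Forall_forall _ _) (proj1 (list_max_le _ _) (Nat.le_refl _)) _ _).
      apply in_map_iff. exists (r, i). split; [reflexivity|].
      apply in_prod; [assumption|]. apply in_seq; lia. }
    exists (2 * Z.of_nat (n + length (cocycle h 0%nat) + length (cocycle u 0%nat)) + 2).
    repeat split; try lia.
    intros r i Hr Hi. specialize (Hn r i Hr Hi). lia. }
  pose proof (fun W q => run_winv lgen _ [] (lact m p) llab (lstates m p)
    (lact_lstates m p Hm p_gt1) (lact_inv m p Hm p_gt1) (llab_inv m p Hm p_gt1)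
    ltac:(intros ? ? []) ltac:(intros ? ? []) W q) as LW.
  pose proof (fun W q => labels_winv lgen _ [] (lact m p) llab (lstates m p)
    (lact_lstates m p Hm p_gt1) (lact_inv m p Hm p_gt1) (llab_inv m p Hm p_gt1)
    ltac:(intros ? ? []) ltac:(intros ? ? []) W q) as LLW.
  pose proof (run_states lgen _ (lact m p) (lstates m p) (lact_lstates m p Hm p_gt1)) as LS.
  assert (A1 : forall l s, In s (sstates m) -> In (sact m l s) (sstates m)).
  { intros l [i q] H. apply in_sstates in H. destruct H.
    apply in_sstates. simpl. split; [now apply cact_lt | now apply LS]. }
  assert (A2 : forall l s, In s (sstates m) -> sact m (inv_letter l) (sact m l s) = s).
  { intros l [i q] H. apply in_sstates in H. destruct H. unfold sact; simpl.
    rewrite cact_inv, clab_inv, LW by assumption. reflexivity. }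
  assert (A3 : forall l s, In s (sstates m) ->
    peq [] (slab m l s ++ slab m (inv_letter l) (sact m l s)) []).
  { intros l [i q] H. apply in_sstates in H. destruct H. unfold slab, sact; simpl.
    rewrite clab_inv, LLW by assumption. apply peq_winv_r. }
  assert (A4 : forall r s, In r R -> In s (sstates m) ->
    run X _ (sact m) r s = s /\ peq [] (labels X _ (sact m) (slab m) r s) []).
  { intros r [i q] Hr H. apply in_sstates in H. destruct H as [Hi Hq].
    destruct (srun_cocycle m r i q) as [-> ->].
    destruct (cocycle_rel r i Hr Hi) as [C1 C2].
    destruct (lrun_trivial m p Hm p_gt1 _ q C1 C2 (Hrm r i Hr Hi) Hq) as [-> P].
    split; [now rewrite crun_rel | exact P]. }
  assert (R0 : forall v, 0 <= v < p -> In (0%nat, (0, v)) (sstates m)).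
  { intros v Hv. apply in_sstates. split; [exact d_pos|]. apply in_lstates; simpl; lia. }
  (* h^n walks n steps to the right without touching the lamps *)
  assert (PH : forall n v, 0 <= v < p -> Z.of_nat n <= m ->
    let w := concat (repeat h n) in
    run X _ (sact m) w (0%nat, (0, v)) = (0%nat, (Z.of_nat n mod m, v)) /\
    peq [] (labels X _ (sact m) (slab m) w (0%nat, (0, v)))
      (if (0 <? n)%nat then emit v else [])).
  { intros n v Hv Hn; simpl. revert Hn.
    induction n as [|n IH]; intro Hn.
    { simpl. rewrite Zmod_0_l. split; reflexivity. }
    destruct (IH ltac:(lia)) as [E P]. clear IH.
    assert (Ew : concat (repeat h (S n)) = concat (repeat h n) ++ h).
    { clear. induction n as [|n IH]; simpl in *; [now rewrite app_nil_r|].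
      now rewrite IH at 1; rewrite app_assoc. }
    rewrite Ew, run_app, labels_app, E, P.
    destruct (srun_cocycle m h 0%nat (Z.of_nat n mod m, v)) as [-> ->].
    rewrite Rh.
    (* The next copy of [h] wanders near the position [n], so the window is centred at 0 or at [m],
       whichever is nearer. The potential changes only for [n = 0]: later copies stay on the same
       side of the centre at both ends. *)
    assert (exists z, z mod m = 0 /\ (z = 0 \/ z = m /\ Z.of_nat n > 0) /\
      Z.abs (Z.of_nat n - z) + Z.of_nat (length (cocycle h 0%nat)) < m) as (z & Hz & Hz' & Hx).
    { destruct (Z.le_gt_cases (2 * Z.of_nat n) m).
      - exists 0. rewrite Zmod_0_l. repeat split; lia.
      - exists m. rewrite Z_mod_same_full. repeat split; lia. }
    destruct (lrun_in_window m p Hm p_gt1 (cocycle h 0%nat) z (Z.of_nat n) v Hz Hx Hv)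
      as [E1 P1].
    rewrite Sh, (Zplus_mod v), Lh, Z.add_0_r, Zmod_mod, (Z.mod_small v) in E1, P1 by lia.
    rewrite E1. split; [f_equal; f_equal; f_equal; lia|].
    destruct n as [|n]; simpl (0 <? _)%nat; cbv iota.
    - destruct Hz' as [->|]; [exact P1 | lia].
    - unfold potential in P1. destruct Hz' as [->|[-> _]].
      + rewrite (proj2 (Z.leb_gt (Z.of_nat (S n)) 0) ltac:(lia)) in P1.
        rewrite (proj2 (Z.leb_gt (Z.of_nat (S n) + 1) 0) ltac:(lia)) in P1. exact P1.
      + rewrite (proj2 (Z.leb_le (Z.of_nat (S n)) m) ltac:(lia)) in P1.
        rewrite (proj2 (Z.leb_le (Z.of_nat (S n) + 1) m) ltac:(lia)) in P1.
        rewrite app_nil_l in P1. rewrite P1, app_nil_r. reflexivity. }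
  set (v1 := lamp (cocycle u 0%nat) 0 mod p) in Lu.
  assert (Hv1 : 0 <= v1 < p) by (apply Z.mod_pos_bound; lia).
  (* [u] starts and ends at 0, where the potential is empty, so its total label is trivial although
     the lamp has changed. *)
  assert (PU : run X _ (sact m) u (0%nat, (0, 0)) = (0%nat, (0, v1)) /\
    peq [] (labels X _ (sact m) (slab m) u (0%nat, (0, 0))) []).
  { destruct (srun_cocycle m u 0%nat (0, 0)) as [-> ->].
    destruct (lrun_in_window m p Hm p_gt1 (cocycle u 0%nat) 0 0 0 (Zmod_0_l m)
      ltac:(simpl; lia) ltac:(lia)) as [E P].
    rewrite Su, Zmod_0_l in E, P. rewrite E, Ru. split; [reflexivity|exact P]. }
  destruct PU as [RU LU].
  set (n := Z.to_nat m).
  assert (Hn : Z.of_nat n = m) by lia.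
  assert (Hn0 : (0 <? n)%nat = true) by (apply Nat.ltb_lt; lia).
  set (w := concat (repeat h n)).
  assert (PW : forall v, 0 <= v < p ->
    run X _ (sact m) w (0%nat, (0, v)) = (0%nat, (0, v)) /\
    peq [] (labels X _ (sact m) (slab m) w (0%nat, (0, v))) (emit v)).
  { intros v Hv. destruct (PH n v Hv ltac:(lia)) as [E P].
    rewrite Hn, Z_mod_same_full in E. rewrite Hn0 in P. split; assumption. }
  pose proof (run_winv X _ R (sact m) (slab m) (sstates m) A1 A2 A3
    (fun r s Hr Hs => proj1 (A4 r s Hr Hs)) (fun r s Hr Hs => proj2 (A4 r s Hr Hs)) u
    _ (R0 0 ltac:(lia))) as RW.
  pose proof (labels_winv X _ R (sact m) (slab m) (sstates m) A1 A2 A3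
    (fun r s Hr Hs => proj1 (A4 r s Hr Hs)) (fun r s Hr Hs => proj2 (A4 r s Hr Hs)) u
    _ (R0 0 ltac:(lia))) as LWu.
  rewrite RU in RW, LWu. rewrite LU in LWu.
  apply (large_of_labelled_action X _ R (sact m) (slab m) (sstates m) A1 A2 A3
    (fun r s Hr Hs => proj1 (A4 r s Hr Hs)) (fun r s Hr Hs => proj2 (A4 r s Hr Hs))
    (0%nat, (0, 0)) (R0 0 ltac:(lia)) w (u ++ w ++ winv u)).
  - apply PW; lia.
  - apply PW; lia.
  - rewrite !run_app, RU, (proj1 (PW v1 Hv1)). exact RW.
  - rewrite !labels_app, RU, (proj1 (PW v1 Hv1)), LU, (proj2 (PW v1 Hv1)), LWu.
    unfold emit. apply Z.eqb_neq in Lu. rewrite Lu. reflexivity.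
Qed.

End CocycleCriterion.

(** * Certificates of largeness *)

Definition gen_eqb (x y : gen) : bool :=
  match x, y with ga, ga | gt, gt => true | _, _ => false end.

Definition lgen_eqb (x y : lgen) : bool :=
  match x, y with lx, lx | ls, ls => true | _, _ => false end.

Section LetterEq.
Variables (X : Type) (eqb : X -> X -> bool).
Hypothesis eqb_eq : forall x y, eqb x y = true -> x = y.

Definition letter_eqb (k l : letter X) : bool := eqb (fst k) (fst l) && Bool.eqb (snd k) (snd l).

Lemma letter_eqb_eq k l : letter_eqb k l = true -> k = l.
Proof.
  destruct k as [x b], l as [y c]; unfold letter_eqb; simpl. intro H.
  apply andb_prop in H as [H1 H2]. apply eqb_eq in H1. apply eqb_prop in H2. congruence.
Qed.

Fixpoint word_eqb (u v : word X) : bool :=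
  match u, v with
  | [], [] => true
  | k :: u, l :: v => letter_eqb k l && word_eqb u v
  | _, _ => false
  end.

Lemma word_eqb_eq u v : word_eqb u v = true -> u = v.
Proof.
  revert v; induction u as [|k u IH]; intros [|l v]; simpl; try discriminate; [reflexivity|].
  intro H. apply andb_prop in H as [H1 H2].
  apply letter_eqb_eq in H1. apply IH in H2. congruence.
Qed.
End LetterEq.

Lemma gen_eqb_eq x y : gen_eqb x y = true -> x = y.
Proof. destruct x, y; now try discriminate. Qed.

Lemma lgen_eqb_eq x y : lgen_eqb x y = true -> x = y.
Proof. destruct x, y; now try discriminate. Qed.

Fixpoint lamp_changes (w : word lgen) (x : Z) : list (Z * Z) :=
  match w with
  | [] => []
  | (lx, b) :: w => (x, sgn b) :: lamp_changes w x
  | (ls, b) :: w => lamp_changes w (x + sgn b)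
  end.

Fixpoint sum_at (l : list (Z * Z)) (k : Z) : Z :=
  match l with
  | [] => 0
  | (x, c) :: l => if k =? x then c + sum_at l k else sum_at l k
  end.

Lemma sum_at_lamp_changes w x k : sum_at (lamp_changes w x) k = lamp w (k - x).
Proof.
  revert x; induction w as [|[[] b] w IH]; intro x; simpl; [reflexivity| |].
  - rewrite IH. replace (k - x =? 0) with (k =? x) by lia. destruct (k =? x); lia.
  - rewrite IH. f_equal. lia.
Qed.

Lemma sum_at_notin l k : (forall e, In e l -> fst e <> k) -> sum_at l k = 0.
Proof.
  induction l as [|[x c] l IH]; simpl; intro H; [reflexivity|].
  assert (x <> k) by apply (H (x, c) (or_introl eq_refl)).
  replace (k =? x) with false by lia. auto.
Qed.

(** A site touched by no letter [lx] keeps the value 0, so testing the touched sites settles all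
    sites. *)
Definition lamps_off (p : Z) (w : word lgen) : bool :=
  let l := lamp_changes w 0 in forallb (fun e => sum_at l (fst e) mod p =? 0) l.

Lemma lamps_off_spec p w k : lamps_off p w = true -> lamp w k mod p = 0.
Proof.
  unfold lamps_off. intro H. rewrite forallb_forall in H.
  rewrite <- (Z.sub_0_r k), <- sum_at_lamp_changes.
  destruct (classic (exists e, In e (lamp_changes w 0) /\ fst e = k)) as [[e [He <-]]|N].
  - apply Z.eqb_eq. now apply H.
  - rewrite sum_at_notin; [apply Zmod_0_l|]. intros e He E. apply N; eauto.
Qed.

(* Coset i is joined by the generator x to the coset fst (nth i (edges x)); the
   edge carries the lamplighter word snd (nth i (edges x)). *)
Record cert : Type := Cert {
  modulus : Z;
  edges : gen -> list (nat * word lgen);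
  loop_shift : word gen;
  loop_lamp : word gen }.

(** Certificates list the edges of the positive generators only; an inverse generator is followed by
    looking for the edge that ends at [i], with [j] counting the edges passed. *)
Fixpoint find_source (i j : nat) (es : list (nat * word lgen)) : nat * word lgen :=
  match es with
  | [] => (j, [])
  | (k, w) :: es => if (i =? k)%nat then (j, w) else find_source i (S j) es
  end.

Definition cert_act (c : cert) (l : letter gen) (i : nat) : nat :=
  match l with
  | (x, true) => fst (nth i (edges c x) (0%nat, []))
  | (x, false) => fst (find_source i 0 (edges c x))
  end.

Definition cert_lab (c : cert) (l : letter gen) (i : nat) : word lgen :=
  match l with
  | (x, true) => snd (nth i (edges c x) (0%nat, []))
  | (x, false) => winv (snd (find_source i 0 (edges c x)))
  end.

Definition degree (c : cert) : nat := length (edges c ga).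

Definition letters : list (letter gen) := [(ga, true); (ga, false); (gt, true); (gt, false)].

Lemma in_letters l : In l letters.
Proof. destruct l as [[] []]; simpl; tauto. Qed.

Notation crun_of c := (crun gen (cert_act c)).
Notation cocycle_of c := (cocycle gen (cert_act c) (cert_lab c)).

Definition cert_wf (c : cert) : bool :=
  (1 <? modulus c) && (0 <? degree c)%nat &&
  forallb (fun l => forallb (fun i =>
    (cert_act c l i <? degree c)%nat &&
    (cert_act c (inv_letter l) (cert_act c l i) =? i)%nat &&
    word_eqb lgen lgen_eqb (cert_lab c (inv_letter l) (cert_act c l i))
      (winv (cert_lab c l i))) (seq 0 (degree c))) letters &&
  (let w := cocycle_of c (loop_shift c) 0%nat in
   (crun_of c (loop_shift c) 0 =? 0)%nat && (displacement w =? 1) && lamps_off (modulus c) w) &&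
  (let w := cocycle_of c (loop_lamp c) 0%nat in
   (crun_of c (loop_lamp c) 0 =? 0)%nat && (displacement w =? 0) &&
   negb (lamp w 0 mod modulus c =? 0)).

Definition cert_kills (c : cert) (r : word gen) : bool :=
  forallb (fun i =>
    (crun_of c r i =? i)%nat &&
    let w := cocycle_of c r i in (displacement w =? 0) && lamps_off (modulus c) w)
    (seq 0 (degree c)).

Lemma large_of_cert (c : cert) (r : word gen) :
  cert_wf c = true -> cert_kills c r = true -> large [r].
Proof.
  unfold cert_wf, cert_kills. rewrite !andb_true_iff, !forallb_forall.
  intros [[[[Hp Hd] Ha] [[H1 H2] H3]] [[U1 U2] U3]] Hr.
  assert (A : forall l i, (i < degree c)%nat ->
    (cert_act c l i < degree c)%nat /\ cert_act c (inv_letter l) (cert_act c l i) = i /\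
    cert_lab c (inv_letter l) (cert_act c l i) = winv (cert_lab c l i)).
  { intros l i Hi. specialize (Ha l (in_letters l)). rewrite forallb_forall in Ha.
    specialize (Ha i ltac:(apply in_seq; lia)). rewrite !andb_true_iff in Ha.
    destruct Ha as [[B1 B2] B3]. apply Nat.ltb_lt in B1. apply Nat.eqb_eq in B2.
    apply (word_eqb_eq _ _ lgen_eqb_eq) in B3. auto. }
  apply (large_of_cocycle gen [r] (degree c) (modulus c) (cert_act c) (cert_lab c)
           ltac:(lia) ltac:(now apply Nat.ltb_lt)
           (fun l i Hi => proj1 (A l i Hi))
           (fun l i Hi => proj1 (proj2 (A l i Hi)))
           (fun l i Hi => proj2 (proj2 (A l i Hi)))) with (loop_shift c) (loop_lamp c).
  - intros r' i [<-|[]] Hi. specialize (Hr i ltac:(apply in_seq; lia)).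
    rewrite !andb_true_iff in Hr. now apply Nat.eqb_eq.
  - intros r' i [<-|[]] Hi. specialize (Hr i ltac:(apply in_seq; lia)).
    rewrite !andb_true_iff in Hr. destruct Hr as [_ [S L]].
    split; [lia|]. intro k. now apply lamps_off_spec.
  - now apply Nat.eqb_eq.
  - lia.
  - intro k. now apply lamps_off_spec.
  - now apply Nat.eqb_eq.
  - lia.
  - intro E. rewrite E in U3. discriminate.
Qed.

(* Capital letters denote inverses and blanks separate tokens. The token of an edge is
   the number of its target followed by its lamplighter word in the lamp x and the shift s. *)
Fixpoint tokens (s : string) (cur : list ascii) : list (list ascii) :=
  match s with
  | EmptyString => [rev cur]
  | String c s => if (c =? " ")%char then rev cur :: tokens s [] else tokens s (c :: cur)
  end.

Definition parse_gword (t : list ascii) : word gen :=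
  map (fun c => ((if (c =? "a")%char || (c =? "A")%char then ga else gt),
                 (c =? "a")%char || (c =? "t")%char)) t.

Definition parse_gwords (s : string) : list (word gen) := map parse_gword (tokens s []).

Fixpoint parse_edge (t : list ascii) (n : nat) : nat * word lgen :=
  match t with
  | [] => (n, [])
  | c :: t =>
    if (c =? "x")%char then let (k, w) := parse_edge t n in (k, (lx, true) :: w)
    else if (c =? "X")%char then let (k, w) := parse_edge t n in (k, (lx, false) :: w)
    else if (c =? "s")%char then let (k, w) := parse_edge t n in (k, (ls, true) :: w)
    else if (c =? "S")%char then let (k, w) := parse_edge t n in (k, (ls, false) :: w)
    else parse_edge t (10 * n + (nat_of_ascii c - 48))
  end.

Definition parse_edges (s : string) : list (nat * word lgen) :=
  map (fun t => parse_edge t 0) (tokens s []).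

Definition entry (p : Z) (a t loops words : string) : cert * list (word gen) :=
  let ea := parse_edges a in let et := parse_edges t in
  let l := parse_gwords loops in
  (Cert p (fun x => match x with ga => ea | gt => et end) (nth 0 l []) (nth 1 l []),
   parse_gwords words).

(* Found by computer search among the subgroups of small index and their abelian covers
   for which the Alexander polynomial of some map onto Z vanishes modulo p. *)
Definition large_table : list (cert * list (word gen)) := [
  entry 2 "0x" "0s" "t a"
    "AAAAAAAATAAt AAAAAAAATaat AAAAAATAAAAt AAAAAATAAt AAAAAATTAAtt AAAAAATTaatt AAAAAATaaaat AAAAAATaat AAAAATAtATAt AAAAATAtATat AAAAATAtaTAt AAAAATAtaTat AAAAATatATat AAAAATataTat AAAATAAAAt AAAATAATAAtt AAAATAATaatt AAAATAAt AAAATAAttAAT AAAATAAttaaT AAAATATAAtAt AAAATATAAtat AAAATATaatAt AAAATATaatat AAAATAtAATAt AAAATAtAATat AAAATAtaaTAt AAAATAtaaTat AAAATTAAAAtt AAAATTAAtaat AAAATTAAtt AAAATTTAAttt AAAATTTaattt AAAATTaaaatt AAAATTaataat AAAATTaatt AAAATaTAAtat AAAATaTaatat AAAATaaaat AAAATaat AAAATaattaaT AAAATatAATat AAAATataaTat AAATAAAtATAt AAATAAAtATat AAATAAAtaTat AAATAAtATAAt AAATAAtATaat AAATAAtAtAAT AAATAAtAtaaT AAATAAtaTAAt AAATAAtaTaat AAATAAtatAAT AAATAAtataaT AAATAtAAATAt AAATAtAAATat AAATAtATAt AAATAtATaaat AAATAtATat AAATAtaTAt AAATAtaTaaat AAATAtaTat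 AAATAtaaaTAt AAATAtaaaTat AAATaaatATat AAATaatATaat AAATaatAtaaT AAATaataTaat AAATaatataaT AAATatAAATat AAATatATat AAATataTat AATAATAAtAAt AATAATAAtaat AATAATAAtt AATAATTAAttt AATAATTaattt AATAATaatAAt AATAATaataat AATAATaatt AATAAt AATAAtAATAAt AATAAtAATaat AATAAtaaTaat AATATAAtAt AATATAAtat AATATAtATAtt AATATAtATatt AATATAtaTAtt AATATAtaTatt AATATTAAttAt AATATTAAttat AATATTaattAt AATATTaattat AATATaatAt AATATaatat AATATatATAtt AATATatATatt AATATataTAtt AATATataTatt AATAtAATAt AATAtAATat AATAtaaTAt AATAtaaTat AATAttAATTAt AATAttAATTat AATAttaaTTAt AATAttaaTTat AATTAATaattt AATTAAtaat AATTAAtt AATTATaatAtt AATTAtATAtat AATTAtATatat AATTAtaTAtat AATTAtaTatat AATTAtaaTAtt AATTTAAtaatt AATTTAAttt AATTTTAAtttt AATTTTaatttt AATTTaattt AATTaTAAtatt AATTaatt AATTatAATatt AATTatATAtat AATTatATatat AATTataTAtat AATTataTatat AATaTAAtat AATaaTAAtaat AATaat AATaatAATaat AATatAATat ATAtATAt ATAtATat ATAtaTat ATTAttATTAtt ATTAttATTatt ATTAttaTTatt ATTattATTatt ATatATat";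
  entry 2 "2 0 1" "0x 2s 1S" "ATA t"
    "AAAAAAATTatt AAAAAATAAAt AAAAAATAttaT AAAAAATaaat AAAAATTAtt AAAAATTaatt AAAATAAATatt AAAATTataaat AAAATTatt AAATAAAt AAATAATTAttt AAATAAttAT AAATAAttaaT AAATATAAAtat AAATATTAAttt AAATATTAttAt AAATATTattt AAATATaaatat AAATAtAAAtaT AAATAtaaataT AAATAttATTAt AAATAttaT AAATTAAAtt AAATTTAAAttt AAATTTAttat AAATTTaaattt AAATTTaattat AAATTTattaat AAATTaaatt AAATaTTattat AAATaaat AAATaattaT AAATattaTTat AATAATTAtAtt AATATTAAtAtt AATATTatAtt AATATTataatt AATAttAAtATT AATAttatATT AATTATAttat AATTATaattat AATTATattaat AATTAtAttaT AATTAtaattaT AATTAtt AATTTTAtttt AATTTTattatt AATTaaTAttat AATTattttaTT ATATTaTatttt ATATTatatt ATAttaTTTatt ATTATTAtttt ATTATTattatt ATTTTatAttat ATTTTatttt ATTTattATatt ATTaTAttat ATTaTTAttatt ATTatt";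
  entry 2 "0x 2S 1s" "1 2 0" "TAT a"
    "AAAAATTTAttt AAAAATTTattt AAAATAtttATT AAAATAtttaTT AAAATTAtttaT AAAATTatttaT AAATAATTattt AAATTAATAttt AAATTAATattt AAATTTAtaatt AAATTTAttaat AAATTTAttt AAATTTataatt AAATTTattt AATAATAtttAT AATAATAtttaT AATAATatttaT AATATTTAtttt AATATTTatttt AATAtAAttATT AATAtAAttaTT AATAtaattATT AATAtaattaTT AATAttAAtaTT AATAttaatATT AATAttaataTT AATAtttATT AATAtttATaaT AATAtttaTT AATAtttaTaaT AATTAttAAtaT AATTAtttaT AATTTTAtttat AATTTTatttat AATTatAAttaT AATTattAAtaT AATTatttaT AATaaTAtttaT ATATTTAtAttt ATATTTAtattt ATATTTatAttt ATATTTatattt ATTTATatttat ATTTAttt ATTTaTAtttat ATTTattt";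
  entry 2 "1sx 0Sx" "1 0x" "at AA"
    "AAAAATTaaatt AAAATAAAttaT AAAATATTAttt AAAATAttAT AAAATAttaaaT AAAATTTattat AAAATattaT AAATATTAtatt AAATAttAtaTT AAATTTTAtttt AAATTaTattat AAATTatattaT AAATTatt AATATTAtAAtt AATATTAtaatt AATAttAtaaTT AATTAATattat AATTATTatttt AATTAttttATT AATTTTAttatt ATATTATatttt ATATTAtAtt ATAttATTTAtt ATTATTAttAtt ATTATattat ATTAtaTTattt ATTAtt";
  entry 2 "4 3 2 1 0" "2 4s 1 3x 0x" "tttA TA"
    "AAATATTAttat AAATATTattAt AAATATTattat AAAtATATTAtt AAAtATATTatt AAAtATaTTAtt AAAtATaTTatt AAAttAtATATT AAAttAtATaTT AAAttAtaTATT AAAttAtaTaTT AAATTAttAtaT AAATTAttataT AAAttatATaTT AAAttataTaTT AAATTattAtaT AAATTattataT AAATaTTAttat AAtAtATATTAt AAtAtATATTat AAtAtATaTTAt AAtAtATaTTat AAtAtaTATTAt AAtAtaTATTat AAtAtaTaTTAt AAtAtaTaTTat AATAttAtATaT AATAttAtaTaT AATAttatATaT AATAttataTaT AAtatATATTat AAtatATaTTat AAtataTATTat AAtataTaTTat ATATTAttAt ATATTAttat ATATTattAt ATATTattat AttAtaTATT AttatATaTT";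
  entry 2 "1 0x" "1 0s" "at AA"
    "AAAAAATAttAT aaaaaaTAttAT AAAAATAATAtt aaaaaTTatAAt aaaaTataataT aaaaTatAAtaT AAAATatAAtaT AAAATataataT aaaTaaTaaatt aaaTaaTAtt AAATTAAAtaat AAATTATAttat aaaTTatattAT AAATTataat AATAAtATTatt aaTaatATTatt aaTaTAttAtAT AATAtAttATaT AATAttAT aaTattATTAAt aaTTAttaTAAt aaTAttAT ATATTATAtttt";
  entry 2 "1 2 0" "0S 2x 1s" "T ata"
    "aaaaaTaTatAt AAAAATAtAtaT AAAATAATatAt aaaaTaatAtaT aaaaTaTAtAt aaaaTataatAT aaaaTatAtAT AAAATaTataat aaaaTAAtAtAT AATAATAtAt AATAATAtaat AATAATaatAt aaTaTatAt aaTaTATAtAtt AATAtAtaT AATAtaataT AATTatAtataT aaTATaTAttAt AATaTAtaat aTaTTatAtat aTaTAtAt ATaTATatAtat";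
  entry 2 "1 2 0 4xS 5sxS 3s" "3 4 5x 0x 2x 1" "atAt TT"
    "AAAAAAATTAtt AAAAATTAAtt AAAAATTatt AAAATAAATAtt AAAATTAtaaat AAAATTAtt AAATAAttAAT AAATAAttaT AAATATTAttt AAATATTaattt AAATAtAAAtAT AAATAtaaatAT AAATAttAT AAATAttaTTAt AAATAttaaT AAATTTAAttat AAATTTattat AAATaattaaT AAATatAAAtaT AAATattATTat AAATattaT AATAATTatatt AATATTAtatt AATATTaatatt AATAttAtaTT AATTaTAAttat AATTaTAttaat AATTaTattat AATTatattaT AATTatt ATTTTAttatt";
  entry 2 "1s 0xSx" "0s 1xS" "t AA"
    "aaaaaTatAtaT aaaaaTAtAtAT AAATAAATatAt aaaTaTAtAt AAATAtAtAT AAATAtAtaaaT AAATatAtaT AATATATAtAtt aaTaTattAtaT aaTaTATatAtt aaTTaTAtatAt AATTaTatatat AATaTattAtaT aTaTatAt";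
  entry 2 "1 0xsxS" "1s 0x" "tA AA"
    "aaaaaTaaTAtt AAAAATTataat aaaaTatAAtAT AAATAATAtt AAATAATaaatt aaaTTatAAt aaTaataTTatt AATAAtaTTatt aaTaTAttataT aaTattaTTAAt AATAttaT AATTAttATaat AATaTAttataT";
  entry 3 "0x" "0s" "t a"
    "AAAATAAtaTAt AAAATAtaTat AAAATaataTat AATAAtATAt AATAAtATaat AATAtATat AATaatATat ATAtATAtATAt ATatATatATat";
  entry 2 "1 0x" "1s 0S" "TA AA"
    "AAAAATTAAAtt AAAATAAAttAT AAAATATTattt AAAATAttaT AAAATTTAttat AAAATaaattaT AAATATTatAtt AAATAttatATT AAATTAtt AATATTatAAtt AATAttatAATT AATTATTAtttt";
  entry 2 "5s 2 4 0S 1 3" "2sxS 0 5xsx 4Sx 3x 1" "att aTT"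
    "aaaaaTaTAtAt AAAAATAtAtAT AAAAATatAtaT AAAATAATAtAt aaaaTaatAtAT aaaaTaTatAt aaaaTatAtaT aaaaTatAtAAT AAAATaTAtaat aaaaTAtAtAT AATAATAAtAt AATAATatAt AATAATataat aaTaTTAtAtat aaTaTAtAt AATAtAtAT AATAtAtaaT AATAtaatAT AATAtatAtATT AATaTAAtaat AATatAtaT aTaTATatAtt ATATaTatatAt";
  entry 2 "0S 1sx" "1 0x" "A TT"
    "AAATATaTAttt AAATATatttAT AATAATTattAt aaTaTattATat AATATTAttt AATATattATAt AATAtaTaTatt ATATATAttt ATATTTAtttAt ATAtaTTTattt";
  entry 2 "0x 2 1" "1 0s 2xS" "tt a"
    "ATATATAtAtAt ATATATAtAtat ATATATAtatat ATATATatAtAt ATATATatAtat ATATATatatAt ATATATatatat ATATaTAtAtat ATATaTAtatAt ATATaTAtatat ATATaTatAtat ATATatAtAtaT";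
  entry 2 "0s" "0x" "a t"
    "AATTaTatAtat AATTatatATat AATTatatAtaT ATTTaTAtattt ATTTatATattt ATTTatAtat ATaTAtat";
  entry 2 "0S 2s 1x" "1 2 0" "A tAt"
    "AAATATTAtAtt AAATAtATTAtt AATATAttAtAT AATAtATATAtt AATAtATAttAT AATAttaTataT aaTTatAtATAt ATATTattttaT ATATaTTatttt ATAtATataTat ATAtaTTatt";
  entry 2 "1 0" "1xs 0S" "TA TT"
    "AAATTTTatttt AATAttttATTT AATAttttaTTT AATTAttttaTT AATTTAttttaT AATTTattttaT ATTATTAttatt ATTATTattAtt ATTTTAtttt";
  entry 2 "1 0xsxS" "0s 1x" "t AA"
    "AAAAAtAtaTAT AAAAATaTatat AAAtAAAtATaT AAATATAtAt AAATATAtaaat AAATATaaatAt AAAtATaTat AAAtatATaT AtAtaTAT";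
  entry 2 "1 0x" "0s 1xS" "t AA"
    "aaaaaTatAtAT AAATAAATAtAt aaaTaTatAt AAATAtAtaT AAATaTAtaaat AATATATatAtt aaTTaTatatAt AATTaTAtatat";
  entry 2 "1 0xsxS" "1xsxsxS 0S" "TA AA"
    "AAATAATatAAt AAATAATataat AAATaaTataat AATATAATAttt AATATaaTAttt AATATaatttAT AATAtAAtAT AATTTatAAtat AATatAAtaT";
  entry 2 "0s" "0xS" "a ta"
    "AAATTatttaaT AATATTattaat AATTAtatataT AATTatAtaTat AATaTAttaTat aaTATAttaTAt";
  entry 2 "1 0x" "1xsx 0S" "TA AA"
    "AAATAATAtAAt AAATAATAtaat AAATaaTAtaat AATATAATattt AATATaaTattt AATATaatttaT AATAtAAtaT AATAtttAATaT";
  entry 2 "1 0x" "0s 1x" "t AA"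
    "AAAAATATAtAt AAATAAATatat AAATaTAAAtat AAATaTatat AAATatataT ATATAtAt";
  entry 2 "1 2 0x" "1s 2 0" "tA Ta"
    "aaaaaTaattAT AAAAATTAAtat aaaatataTT aaataaTaaTAt aaaTaatttaTT aaaTatAAtAAT aattATAT";
  entry 2 "2 0 1" "2x 1Sxs 0s" "at tA"
    "aaTaTTAttAt aataTaTTatt aataTaTTAAtt aattaatATaTT AAttAtaTaTT AATTAttAtaaT AATTattAtaT";
  entry 5 "0x" "0s" "t a"
    "AAAAATAAAAAt AAAAATaaaaat AAAATAtATat AAATAtAATat";
  entry 2 "1 0x" "0s 1" "t AA"
    "AAAAATaTAtat AAATATAAAtAt AAATATatAt AAATATataaat AAATAtatAT";
  entry 3 "1 0" "0s 1xs" "t taTA"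
    "ATAtATAtATat ATAtATAtaTat ATAtATatATat ATAtaTAtATat ATAtaTAtaTat";
  entry 2 "1 2 0" "1s 2Sx 0x" "tA Ta"
    "AAAATTTattt AAATAtttAATT AAATAtttaTT AAATTAtttaT AAATTaatttaT AATTTAttt";
  entry 2 "2x 0 1Sxs" "2sx 1x 0" "tA TA"
    "aaaaatataaTT aaaaaTattAAT AAAATTAtat aaaTaatAAtAT aaataTaaTAAt AATATatt";
  entry 2 "1 0xsxS 3 2" "2x 3s 1 0" "att AA"
    "AAAtAtATTTAt aaatatAtATTT AAATATatttaT aaaTTTAtatAt AATAtAtAtATT AAttaTaTaTat aTaTATattt";
  entry 2 "3x 2 1 0sxS" "2s 3 0 1xS" "tt AA"
    "AAATATTatatt AAAtATTATAtt aaattatATTAT AAAttaTATTat aatatATTaTAt aaTatAttaTAT atattaTATT";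
  entry 3 "1 3 0 2 5 6 7 4" "0s 1X 4X 5s 7s 2X 3s 6X" "t atA"
    "aaTaaTaatAt aaTaaTAAtAt aaTaTaatAAt AATATAAtt aaTaTaTaattt aaTaTaTAAttt aaTaTTaatAtt AATATaatt AATTAAtat aaTTTaatAtAt";
  entry 2 "3S 2 1 0sx" "1 3 0 2" "TTA AA"
    "AAATATATattt AAATATAtttaT AAATAtttATaT AAATTTAtAtat ATATaTattt ATATatttaT";
  entry 2 "3 0 1 2s 4x" "3x 1 4 0x 2" "aaaa tA"
    "AATATaTaattt AATATaTattat AATATataat AATATatttaaT AATAtaTaat AATAtaTattaT AATAtataTTat";
  entry 2 "2 0 1 4 5xs 3Sx" "3 0s 1xS 5 2 4x" "At att"
    "AAAATTTAttt AAATAAtttaTT AAATAtttATT AAATAtttaaTT AAATTAAtttaT AAATTAtttaaT AAATTatttaT AATTTattt";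
  entry 2 "2sx 3 0Sx 1" "1s 0 3x 2" "tt AA"
    "AAATAttataTT aaaTTatAttAT AAATTaTAttat aaTaTAttAtaT AATaTAttAtaT ATATTatAtt";
  entry 2 "1 2 0" "0s 2xs 1s" "t tATA"
    "AAAATAtATAt AAAATAtATaat AATAAtAATat AATAAtaTat AATataTat";
  entry 2 "0S 1xs" "1 0" "A taTa"
    "AATATATAtatt AATAtATATatt AATAtAtAtaTT ATAtATTTAttt";
  entry 2 "6s 2 3 1 4 0S 5" "2 3x 4 5 1 0Sx 6x" "ATAT Ta"
    "AATAATTAttAt aaTaTTattAt aataTaTTaatt aataTaTTAtt AAttAtATaTT AATTAttAtaT aattAtaTAATT AATTattAtaaT";
  entry 2 "3 0 1 4x 2x" "3s 1Sxs 4 2Sxs 0" "tA aat"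
    "aaataaataaTT aaaTaaTaatt AAATTAAtaaat AAAttAATaaT aaatttAATATT AATATTAAttt";
  entry 2 "1s 0 2Sx" "0x 2 1" "aa t"
    "AATATAttATAt ATATAtATAtAt ATATAtaTatat ATATataTatAt";
  entry 2 "1 4 0 5S 2 7xsxS 3sx 6x 8xsxS" "1x 3x 5 0 7 6 2 8 4" "AtAt tA"
    "AAAAATATAtt AAAAATAttAT aaaaTatataT aaaTaaaTAtt AAATTAAAtat AAATTatat AATATATattt AATTTAtatat ATATAtt";
  entry 5 "1 3 0 2" "0s 2Xs 1xxs 3xs" "t taTa"
    "AAATAAtAATat AAATAAtaaTat AAATaatAATat AAATaataaTat aaTataTAAt";
  entry 5 "1 3 0 2" "0s 1Xs 2xxs 3xs" "t taTA"
    "aaaTaataaTat aaaTaatAATat AAATAtAATaat AAATAtaaTaat aaTaataTAt";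
  entry 2 "1 2 0" "0s 1xs 2s" "t taTA"
    "AAAATAAtATat AAAATatATat AATAtAATaat AATAtaTAt";
  entry 2 "1 2 0" "0s 2x 1sxsxS" "t ata"
    "aataTAtataTT aaTatATattAT AATAtataTTAt ATATatATatt";
  entry 3 "5 2 6 3SSXss 0 4 1 7SSxss" "7sxs 6sx 5 2x 1 0s 3ss 4" "at taT"
    "AATAtATTAtt AATAtATTaatt AATAtaaTTAtt AAtATTattaT AAttAATatATT aattaTAtATT aaTTAttaTAt aTatATTatt";
  entry 2 "1 3 0 2S 4x" "0x 2x 4s 1 3x" "AAAA t"
    "AATAtattaaTT aaTattATATAt AATaTTAtatat AtAtaTATataT ATTATTatttat";
  entry 3 "0s" "0x" "a t"
    "ATTTTatAtatt ATTatATatt";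
  entry 3 "0x 2 5 6 3xsxS 1 4XsXS 7x" "1 4 0S 5XS 7SXss 3Xs 2xsXS 6Sxs" "TAT a"
    "aaTataTTaatt aaTataTTAtt aaTatAATTAtt aataTTattAT AAttATAtaTT AATTAttATat AAttaaTAtaTT";
  entry 2 "1 0x 6 8 7 9 4s 2S 5 3 11x 10" "2 4 3s 0 5 1Sx 9 8xs 10S 11 6 7" "ttt AA"
    "AAAAATTAtat AAAAATattaT aaaaTAtatAT AAATATAAAtt AAATATatt aaaTattAAAT AATATTatatt ATTAtat";
  entry 2 "2x 0 1Sxs" "1s 2xsx 0" "ta TA"
    "aaaaTattAAT AAAATTAtaat AATAATatt";
  entry 2 "1 2xsxS 0" "0s 2sxS 1x" "t aaa"
    "AAAATATAtaat aaaaTatatAAT AATAATatat";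
  entry 2 "1 2ssxS 0Sx" "0s 2xsx 1x" "t aaa"
    "AAAAtAAtATT AAAATAAttaT AAtATTaat";
  entry 2 "1x 0 4 5S 3s 2" "2 1x 3 0 5 4" "taat AA"
    "AAATTAtATAtt AAATTAttaTat ATATATTatttt ATAtATTatt";
  entry 2 "5s 0 4 7 1 2S 3x 9sx 6 8xSx" "8 5 4s 7S 3 9 1 2 0xsxS 6" "aTa TT"
    "aaaaTatatAT AAAATTataat AAAATataTat AAATATAAtat AATTTatAtat aaTATatttAT";
  entry 2 "1 0S 3xs 2" "1 3 0 2" "AA TaTa"
    "AATTAtAtATat AATTTattat ATTATattttaT";
  entry 3 "2 0 1 3XSxs" "2S 0X 3sx 1" "aT Ta"
    "aaTaaTATAttt AATTTatatat aaTATAtttAT";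
  entry 5 "0xsXS 3s 4S 5 1 2" "1 2 0 5xSX 3sX 4x" "tAAt a"
    "AAAAAATATAtt AAAATTatat AAATTTAAttt AAATTTAtatat";
  entry 2 "0s 1x" "1s 0xSx" "a TT"
    "aaTaTAttATAt AATAtaTTatat";
  entry 2 "0x 2S 1xssxS 3sxS" "1 3 0 2" "TAT a"
    "AtAtttATTTaT ATATTTatttAt AtttAtaTATTT";
  entry 2 "0xsxS 3 5 7 1 8 2 4 6" "1 5 0S 6xsx 4x 3xS 2x 8s 7x" "TaTT a"
    "aaaTaaTAtat AAATATataat aaaTataataT aaaTatAAtaT AATAtatAT";
  entry 2 "2 3 4 0 1" "0x 1 3S 2s 4" "ATA t"
    "AAAAAATTatt AAAAATAttaT AAATTAAtt";
  entry 2 "1S 0 4x 3 2sx" "0x 4 3 1 2" "AA t"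
    "atataTatATAT atatttATTaTT ATTATTatAttt";
  entry 2 "4 0S 3sx 1 2x" "1 4 0 3x 2" "AT aat"
    "aataTaTattaT AATTTAtatt AtAtattATTTT";
  entry 2 "4 0 3xSx 1 2s" "4S 2 1 3x 0x" "aT TA"
    "AAATATaatt AATATaTAttat AATTATAtaatt";
  entry 3 "5S 4s 6 2x 0 3 1X" "2 3XsXS 5 6sXS 4x 0sx 1" "ttA TA"
    "AAAAATATatt AATAATTAttat aaTaTATatatt AATTAtat";
  entry 2 "1 4s 0 2S 3" "1x 2x 3sx 0 4x" "AAt tA"
    "AAAAAATATatt aaaaaattATAT ATATatt";
  entry 2 "0S 2S 5 1 7 4Sx 3s 9s 8s 6Sxs" "1 4 0 7 2 9 8 6 3 5" "A ttAAta"
    "AAttaTATATat AATatATAttaT ATATatAtATat ATTTaTAttatt AtatATatATaT";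
  entry 2 "1 2x 0" "0s 1x 2" "t aaa"
    "AAAATAATAtat AAAATAAtAtaT";
  entry 2 "1 2x 0x" "2 0s 1" "at ta"
    "AATAtttATaT AATTTatAtaat";
  entry 2 "1 2 0" "1s 2xs 0x" "tA Ta"
    "aatATATattAT ATATattATAt";
  entry 2 "2x 0 1Sxs" "2 0s 1s" "At tA"
    "AAATAAtataT AAAtATATaat";
  entry 2 "1s 2x 0Sx" "0s 1sx 2x" "t aaa"
    "AAAATaTAtat AATATatAt";
  entry 2 "2 0S 1Sxssx" "1xs 0 2xsx" "At ta"
    "AAATAAtAtaT AAAtATaTaat";
  entry 2 "10 5 3 1 9 2 8 4 6Sxs 11 0x 7" "4s 6s 8 0 3 10Sx 9Sx 1s 7Sxs 2Sx 11 5" "ttt AA"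
    "AAATAATatat aaaTATAtAAt aaaTAtaatAT aaaTAtAAtAT AATatataT";
  entry 2 "0S 2 1xS 4x 3s 5s" "1s 3sx 0 5 2x 4SS" "A aatAt"
    "AAATTAttATat AATTAtatATat AATatATattaT";
  entry 2 "0s 2xS 3Sxs 1s 4xSxs 5S" "3Sx 4 5s 0 2 1xSxs" "a att"
    "aaTAtataTTAt ATATattATat aTatATTTattt";
  entry 2 "2 3 0x 1" "3 0s 1 2" "att AA"
    "AAtATaTaTatt AATTAtAtAtaT";
  entry 2 "8S 3 5 6x 0x 1 2x 4x 9s 7" "1 4 6s 2S 8 5sx 7 3 0 9S" "TA Att"
    "aaaatataaTT aaaatatAAATT AAATTAtat ATTAtaTAtat";
  entry 2 "1 0x 3x 2" "2 3 0s 1x" "tt AA"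
    "AATATAttAtaT AATAtattaTaT";
  entry 2 "1 3 0x 2x" "2 0S 3s 1" "TA ta"
    "aaaTTTAtAtAt AAATaTatttaT";
  entry 2 "1 2xssxSS 0" "0xsxsxSS 2s 1xsx" "ata t"
    "AAAATATAtAt AATaTatat";
  entry 5 "0s" "0x" "a t"
    "ATTTTTattttt";
  entry 2 "1xsxS 0 3 2" "3 2 1x 0s" "tt AA"
    "AAtAtATTaTat AATAtAttaTaT";
  entry 3 "0s" "0xS" "a ta"
    "ATATatATatat";
  entry 2 "0S 2x 1Sxs 3Sxssx" "1 3 0 2" "A tat"
    "ATAtATTTattt ATTTAtaTAttt";
  entry 2 "1s 0xs 3xsxSS 2xS" "1 3 0 2" "aT tatA"
    "aatatAtATaTT AATTATAtatat";
  entry 2 "3S 0 1 4 2s" "3 1x 4 2 0" "tA Ata"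
    "AAAAAATTAtt AAATTaatt";
  entry 2 "0S 1x 2Sxs 3xssxS" "1 3 0S 2Sxssx" "A taT"
    "AATATAttaTat aaTatATTatAt";
  entry 2 "1 4 0 2x 3x" "3 2s 4 1 0" "ata AAT"
    "AAATTATAttt AATTTatatt";
  entry 2 "1 3 0sxS 4sxS 2" "0s 3x 4x 2 1" "t atAA"
    "AAATATAAtAt AAAtatAATaT";
  entry 2 "3 0 1 4 2" "4s 1x 3sxS 0x 2sxS" "tAA TA"
    "AAATAATAAtAt aaatAtaaTAAT";
  entry 2 "2 3 1 4 0 5" "5 1 2x 4 0s 3x" "At atA"
    "AAATAttATTat aaaTTatATAtt";
  entry 2 "1 2 0 5 3 4" "3x 4s 5S 0 2 1" "atat TT"
    "AATATaTAttt AATATatttAT";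
  entry 2 "1x 0 4 5S 3s 2" "2 1 3 0 4 5" "taat AA"
    "AAATAtaTTAtt AAATTAtaTAtt";
  entry 11 "1 3 0 4 2" "0S 3XXXXXS 4xS 2xxxS 1XS" "T aataT"
    "AAATAAtATAt AAAtAATataT";
  entry 11 "1 3 0 4 2" "0s 4xs 3XXXXXs 1Xs 2xxxs" "t aatAT"
    "AAAtATataaT AAATaatATat";
  entry 2 "1 2 0x 5 3x 4" "3 4s 5 2 0 1" "att aaa"
    "aaTaaTaTattt AATATATAttAt";
  entry 2 "0s 1" "1 0x" "a TT"
    "ATATTTatttat";
  entry 2 "0x 4x 5sx 2 3Sx 1" "3s 0 1 5 4s 2" "tatt a"
    "AAAAAATTAtat AAAATATatt";
  entry 2 "1 4x 0x 5x 2 3sxS" "2 3S 5 0 1 4s" "TTA ta"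
    "AATataTattaT aTTaTATatttt";
  entry 2 "1S 0" "0x 1s" "AA t"
    "AATTATatatat";
  entry 2 "1 0x 4xS 5Sx 3s 2xsx" "2 4 3 0 5 1" "atat AA"
    "AATAtAATTatt AATTAttAATat";
  entry 2 "2 5 4 0xS 3xs 1" "0s 3sx 1sx 5 4x 2" "t AAAA"
    "ATATAtAtATat AtATAtatATaT";
  entry 2 "2s 4 1 3 5S 0" "1SS 5ssx 0 2 3ssxss 4x" "at ATT"
    "aaaTattATTAt AAATTAtATatt";
  entry 2 "0S 2s 3xS 1Sxs 4xSxs 5xsx" "1 0x 4 5 3 2" "A TT"
    "aaTatatATTat ATATataTatt";
  entry 5 "1 3 0 4 2 5xxSXXs" "1S 2sX 0x 5 3Xs 4Sx" "aT Ta"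
    "AAATAAATaatt aaaTTAAtAAt";
  entry 3 "0S 1s" "1sX 0SX" "A TT"
    "ATATataTatat";
  entry 2 "2S 3 1 0xsxS 5xs 4" "2xS 4 0 1xsxS 5xsx 3" "TA tA"
    "AATAtaTTAAtt AATAttATATat";
  entry 5 "0S 1s" "1XXs 0SXX" "A TT"
    "ATTTTTAttttt";
  entry 3 "1 3 0 4x 6Xs 2S 5" "0xsxS 4 6sX 2X 3sxS 1 5X" "AAtA t"
    "AAAAATTatat AATATAtt";
  entry 2 "0S 1x 4 5x 2 3 6s 7" "1 3 0 4s 6 2 7S 5" "A taT"
    "AATAtAtataTT ATATATattt";
  entry 2 "0xsxS 2 5xSxss 1SxSxS 6 3sxsx 4" "1 4 0S 2x 3ss 6S 5" "TAT a"
    "ATATTTAttatt ATTTAtatt";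
  entry 3 "0s 2x 1" "1x 0 2s" "a TT"
    "ATATataTAtat";
  entry 2 "2s 0 1" "1x 2x 0" "at ta"
    "AAATTattaTat";
  entry 2 "3 1x 5xss 0S 4x 2Sx 7 6" "4 0 1 6Sxs 2 7Sxs 5 3" "AA taT"
    "aaTaTattaTAt AATAtATTAtat";
  entry 2 "0s 2S 4 1sx 3Sxs 6Sx 5xs 7xSx" "4x 7Sxs 5 6 0 3 2 1" "a TT"
    "aaTaTaTAtAtt AATTatataTat";
  entry 2 "1 2xsxS 0" "1s 2xS 0x" "tA Ta"
    "AAAATATaatt";
  entry 2 "1s 2xSx 0" "0s 1sx 2x" "t aaa"
    "AATAtAAtaaT";
  entry 2 "0s 2xs 5sx 1 6 3SS 4 7xSx" "5xs 4xss 7 0 3S 6SSxs 2xS 1" "a tata"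
    "AATATTattt aTaTTATatttt";
  entry 2 "2 0Sxs 1sxS" "0x 2xs 1xs" "ata t"
    "AATAATatAAt";
  entry 2 "8 1 0 7 4 2 3 9 5 6" "6s 3 4 5 1 7s 2 0 9x 8" "tta aTTA"
    "AATATaTAAttt AATTTaatAtat";
  entry 3 "5 0 1 7 6 2S 9s 3 4 8" "0X 3 6 4 1 5X 7xS 2sX 8x 9x" "AAAA t"
    "aaTaaTTAttAt AATTAATatatt";
  entry 2 "2 3sx 6xS 0 7s 9 1 8 5S 4" "0s 2 7 8 6 1 3 5 4 9xS" "t aatat"
    "AATATAtAt AATATTatatat";
  entry 2 "1 0x 3x 2" "2 3s 1 0" "att AA"
    "AATAtAtatATT";
  entry 2 "1 3x 0 2" "0s 3 1s 2" "t atAA"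
    "AATAttaTAtaT";
  entry 2 "1 4 0x 7sxS 5x 2 3S 9s 6 8x" "2 5 7 0 8s 9 1 3 4xSx 6" "TAtA ta"
    "aaaTataatAT AATTAATattt";
  entry 2 "6s 1x 4 3sxS 8 2 9xS 0 5 7sxS" "2 0 3 1 6 9 4 5 7x 8x" "atAT Tat"
    "AATAATTAtatt aaTaaTTAtatt";
  entry 2 "1 3 0 2x" "1s 2x 3s 0" "tA ata"
    "ATATatATatAt";
  entry 2 "1 2s 0xSx 3" "0s 3 2x 1" "t aaa"
    "ATATatATAtat";
  entry 2 "1xssxSS 2 0" "0s 2sxssxsxSS 1xsx" "t aaa"
    "AAAATTaatat";
  entry 3 "2s 3 0xSX 1" "3 0X 1x 2" "att AA"
    "AAATaTAtttaT";
  entry 2 "1 4 0 5sxS 6sx 9 2x 8 3xS 7" "1x 5 6 0x 8 3 9sxS 2 4 7sxS" "aaaaa tA"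
    "AAttAtATTaaT AATTAtAttaaT";
  entry 2 "2x 3 0sxS 1" "3 0s 1x 2" "att AA"
    "AATAtatatATT";
  entry 2 "0S 1x 2x 3s" "1 3sx 0Sx 2" "A taT"
    "AATTAtAtaTat";
  entry 3 "2X 3X 0X 1" "0s 2s 3s 1XsX" "t AA"
    "AAATATaaatt";
  entry 2 "1 3 0 2xsxS" "1s 2x 0s 3x" "tA ata"
    "AATAtATAttaT";
  entry 2 "1 3S 0x 2xs" "3 2xs 0 1sx" "tAA Ta"
    "ATATatAtATAt";
  entry 2 "2S 3xSxss 0 1" "0x 2 1s 3xs" "AA t"
    "AATAtATaTatt";
  entry 2 "3sx 2S 1 0x" "2x 3s 1ssxS 0" "aa Ta"
    "AATAtATTatat";
  entry 2 "1xs 0 3 2SSxs" "0s 2 1sx 3x" "t aaT"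
    "AATTatAtATat";
  entry 2 "1 0SxS 3xss 2" "0s 2 1x 3Sx" "t aTTA"
    "AATTTAttat";
  entry 2 "3sxS 2 1 0x" "2s 3 0 1xsxSSx" "tt AA"
    "AATaTattataT";
  entry 2 "0s 3 1x 4 2" "1 3 0 4 2" "a tAt"
    "ATATTTattatt";
  entry 2 "1 3 0 4 2" "0s 3 1x 4 2" "t aTa"
    "AAATATaataat";
  entry 2 "2 0 1 4 3" "4 3 1x 2 0s" "tt ata"
    "AATAtatAtaTT";
  entry 2 "0x 3 4 2 1" "1 2 0s 4 3s" "ttt a"
    "AATATTaatAtt";
  entry 2 "3 0 1 4 2" "3x 0s 1 4x 2" "At tA"
    "AATAATTAttt";
  entry 2 "1 2 0 4 3" "1x 4 3 0s 2" "Att tA"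
    "AATTAtAtataT";
  entry 2 "4 0 3 1 2" "4s 2x 1 3 0x" "tA TA"
    "AAATAATaatat";
  entry 3 "1s 0sXSSx 3X 2sxS" "2X 3 1sxS 0" "att AA"
    "AAATAtttaTaT";
  entry 2 "1 3 0 4 2" "1s 0 4 2x 3" "tA ATAA"
    "AAAATAATatt";
  entry 2 "1 4 0 2 3" "1s 3 4x 0 2" "tA AtAA"
    "AAATTaatat";
  entry 2 "0x 1S 2s 3Sxs" "2sss 0Sxs 3Sx 1SS" "taT a"
    "AATAtaTaTAtt";
  entry 2 "1 3 0 4 2" "0s 1 2 3x 4" "t aatAA"
    "AAAATATatAt";
  entry 2 "1 3x 0 4 2x" "0s 1x 4 3s 2" "t atA"
    "AAAATaTatat";
  entry 3 "2 3 4 0 1" "0x 1s 3s 2x 4s" "ata t"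
    "AAAATAtaTAt";
  entry 2 "2 3 1 4xS 0s" "4 3 2x 0 1" "ta atA"
    "AAATTTAAtatt";
  entry 2 "1 3 0 4x 2" "0x 3 4 2s 1s" "aata t"
    "AATAtAATTAtt";
  entry 3 "1 3 0 4 2" "0s 1x 3s 4x 2x" "t atA"
    "AAATAtaaTAt";
  entry 3 "2 3 4 0 1" "0x 2s 3s 1x 4s" "ata t"
    "AAATataaTat";
  entry 2 "1 3 0Sx 2 4x" "2s 3s 4 0 1" "att ta"
    "AATataTAttaT";
  entry 2 "2 3Sxsss 0S 1xS" "1 3xSxsss 0x 2Sxs" "AA TA"
    "AATATattATat";
  entry 2 "2s 4s 3 1 0" "3 2s 0 1x 4x" "at Ata"
    "AATatAtaTTat";
  entry 2 "1 3 0s 4S 2" "0S 4 3 1x 2s" "T aTAA"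
    "AAATATaatat";
  entry 2 "1sxSS 0S 3 2sxs" "0S 2sxsx 1SSx 3xs" "T aTTA"
    "AATaTAttATat";
  entry 2 "1 0S 4 2Sxs 3s" "2 4 1x 0 3" "AA aTT"
    "AATAtaTTaatt";
  entry 2 "3Sxs 0 1 6 8 2 7x 10Sxs 11 4x 5x 9" "2xs 3 0S 7 1 11 9 4xS 10xs 8Sx 6 5s" "Taa TT"
    "AAAATATAAAtt AAAATTaaatat";
  entry 2 "0x 3 4S 2 1Sxs" "1 4 0 2s 3s" "tatt a"
    "AATTTTatattt";
  entry 3 "2 1S 3s 0 4" "0x 3sxs 4 2x 1X" "aaa t"
    "ATATaTatAtt";
  entry 2 "3 0x 1 4 2Sxs" "4s 1S 3 0x 2" "tAA TA"
    "AATATTAtatat";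
  entry 2 "3 0 1 4x 2x" "3s 1sxS 4 2sxS 0" "tA aat"
    "AATAtataT";
  entry 2 "3 0 1sxS 4S 2sx" "3x 1x 4x 2 0" "TAA tA"
    "AATTAtATaatt";
  entry 2 "0xsxS 3 1S 4x 2sx" "1 4 0 3x 2s" "tAt a"
    "AATTATAttt";
  entry 2 "1 3 0Sxs 4Sxs 2" "0s 3x 4x 2 1" "t atAA"
    "AAATAtaataT";
  entry 2 "3 0 1x 4x 2" "4 1sx 2sxs 0s 3ss" "at aaT"
    "AATAtatATTAt";
  entry 3 "1 3 0 4sXS 2X" "0S 3x 4 2s 1sXS" "T atAA"
    "AAATATAtaat";
  entry 2 "0xsxS 3 4xS 2s 1x" "1 4 0 2sx 3" "taat a"
    "AATATATAttat";
  entry 2 "3 2xSxs 1 4x 0Sxs" "2x 3 0 4xs 1" "ata TT"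
    "AAAATTTAtatt";
  entry 2 "4 0 1S 2x 3sssxSS" "1x 3s 4 2xssx 0s" "at ta"
    "ATATAtaTatt";
  entry 2 "1 3 0 4s 2xssxSSS" "0s 1x 3sxs 4sx 2" "t atA"
    "ATATataTAtt";
  entry 2 "3x 0 1 4 2SSxss" "0s 3 1sxs 2sx 4sxS" "t aTa"
    "ATAtaTTAtat";
  entry 11 "1 3 0 4 2" "0s 2XXXXXs 1XXs 4xxs 3xs" "t taTa"
    "AAATAtATaat";
  entry 11 "3 0 1 4 2" "0s 1xxxxxs 2XXXs 3Xs 4xs" "t taTA"
    "AAATAAtaTAt";
  entry 11 "1 3 0 4 2" "0s 1XXXXXs 2XXs 3xxs 4xs" "t taTA"
    "AAATAAtATat";
  entry 2 "4 0 3 1 5x 2" "1s 4 5 3 2s 0" "ta aat"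
    "AATAtAtATTat";
  entry 11 "1 3 0 4 2" "0s 2xxxxxs 1Xs 4XXXs 3xs" "t taTa"
    "AAATaataTat";
  entry 3 "1 4SXs 0S 2XsX 3" "2 1X 4XsxS 0 3SXs" "AT atA"
    "AATTAtttaaT";
  entry 2 "4 0S 3xSxSxss 1Sxss 2" "3 0 1xs 2 4x" "At atA"
    "AATTTATAtttt";
  entry 2 "2 0 5 3 1 4" "5s 0x 3 1 2x 4x" "tAA Ta"
    "AATATTAtAtt";
  entry 2 "0x 3 5 4x 2 1" "4s 1s 3 2x 0 5x" "tt a"
    "AAATaTaatat";
  entry 2 "1 2 0 4 5 3" "3 4 5 0s 2x 1S" "tt ATTA"
    "ATATATattAt";
  entry 2 "1 0s 4 5s 2s 3x" "0x 2 3 1 4 5x" "aa t"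
    "AAATTataTatt";
  entry 2 "1 0x 3 4 5 2" "2 4xs 3 0S 5 1" "TAT AA"
    "AATAtaTAttAT";
  entry 2 "0x 3 4 1xS 2s 5" "1 2s 0 4 5s 3" "ttt a"
    "AATAtaTTAtt";
  entry 2 "3 0 1 4 2x 5x" "3s 1 0 5s 2 4" "tA TAAA"
    "AAAATATataat";
  entry 2 "2x 4 3 1 0x" "3 2sxs 4xssxS 1sssxS 0xs" "At aaT"
    "AATatataTTat";
  entry 3 "0S 3 1x 2 4s 5" "1 4 0 5sx 3S 2" "A tAt"
    "ATATAtaTAtt";
  entry 3 "0s 3sX 1 2S 4S 5" "3 0 4 5X 1 2" "a tAta"
    "ATAtATTAtat";
  entry 2 "1 2x 0 4S 5 3s" "3 4x 5S 2 0 1" "TAT aaa"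
    "AAATATATAttt";
  entry 2 "0S 2x 1 5S 4sx 3s" "3x 4 0 2 5x 1" "A ttt"
    "AATTaTAttat";
  entry 2 "1 3 0 5 2Sxs 4x" "1s 0x 3s 2x 5 4" "tA TA"
    "AAATAtaTTatt";
  entry 2 "4s 1x 2x 5 0xSx 3" "2 3 1 5xs 0 4S" "at AA"
    "ATTATTatttt";
  entry 2 "1 3 0 4x 2 5Sxs" "0x 4s 5s 2 3x 1" "ataa t"
    "AAATAATaatAt";
  entry 2 "0S 2 1Sx 4 3sx 5s" "1 3 0 2xs 5 4S" "A tAta"
    "AATTAtatAtaT";
  entry 2 "1 4 0 5 3 2" "1s 4xs 5s 0s 2xs 3s" "tA taTA"
    "AAATTatATatt";
  entry 5 "4SXs 0 2xx 1 5X 3" "0s 2 1 3sX 5 4" "t atAA"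
    "AAATATaatAt";
  entry 2 "2 4xssxSS 3Sx 1xs 0" "4S 3S 1ssxSS 0S 2xSx" "AT AATA"
    "ATATattaTat";
  entry 7 "5 0 3 1 2 4" "5s 3xx 4XXX 1sXX 2sx 0x" "tA TA"
    "AAATTATAAttt";
  entry 2 "1Sx 3 2x 5 0 4s" "2 0xss 1s 5xS 3x 4x" "at taT"
    "AAAATAATatat";
  entry 2 "1s 4xS 0S 2 3s 5x" "1 5xs 2xsx 0 3 4x" "aT Tata"
    "AAATAAttaaaT";
  entry 2 "4 3 6 5 2 0 1" "0x 1 2 3 5S 4s 6" "ATA t"
    "AAAATTAAAtt";
  entry 2 "3 1sxSS 4sxS 0 2x 5xs" "2 0S 1 4s 5 3" "TTT tAAT"
    "AATATaTattt";
  entry 2 "0x 1S 2xs 3xS 4s 5sxS" "4s 3xS 5 0S 2xs 1" "taT a"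
    "AATTTAtAtat";
  entry 2 "1 4 0 2 6x 3 5" "1x 3 5 0s 4 6 2" "att tA"
    "AATATAtaat";
  entry 2 "1 4s 0 3xsxS 5xS 2x" "3 0s 5ssxS 2 4x 1" "at AAtA"
    "AAATAATaatt";
  entry 5 "0X 2S 4 1 5s 3 6x" "1 4 0 3 6 2 5" "TAT a"
    "AAATTTaattt";
  entry 2 "2 4 1s 0S 3x 5x" "4 3sx 1xsxS 2 5xS 0SS" "AtA ATTA"
    "AAATaTaataat";
  entry 2 "2x 3 5 6 0 1 4" "6 3 0 4s 1 5 2sx" "ttA TA"
    "ATATAtaTAtat";
  entry 2 "3 0 1 6 5x 2 4" "3s 1x 5 4 0 6x 2" "tA Ata"
    "AAATaataataT";
  entry 2 "2x 4 1 0 6x 5 3" "6s 3 0 2 4x 1 5x" "taa TA"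
    "AAAATTATAttt";
  entry 2 "0s 5 4Sx 3S 2sx 1xsxS" "1 4 0 5 3xss 2ssxSS" "a tAAT"
    "AATTATattat";
  entry 2 "1 3 0 6 2S 4ss 5S" "0x 2S 5 4 1 6 3s" "ATA t"
    "AATTTTatttt";
  entry 2 "0S 3 4Sx 1xsxS 2Sxss 5s" "1 4s 0 2ssxS 5x 3" "A tAAT"
    "AATATATAttt";
  entry 2 "0x 2Sxs 5 1 6 3 4" "1 4 0 2s 5 6 3x" "tAtt a"
    "ATATTAttttaT";
  entry 2 "3 0 1 4S 6x 2 5s" "4 1x 6 2 3s 0 5s" "tAA Ata"
    "ATAtATTAtt";
  entry 2 "0x 5sx 3 1 2x 6S 4" "2s 1x 5 0 3 4 6x" "tat a"
    "ATAttATTTatt";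
  entry 2 "2xsxssxS 0S 1xS 4xsx 5x 3xS" "5s 3 4 0 1 2s" "Att aaa"
    "ATATATatAtt";
  entry 2 "3 0 1 6s 5S 2 4x" "3 1x 5 4s 0 6s 2" "att Ata"
    "ATTAtaTAtt";
  entry 2 "1 4 0 5x 6Sx 2 3xs" "1s 2 6 0 3 5 4s" "tA Taaa"
    "ATATAtATAtat";
  entry 2 "0x 1Sx 2S 3Sxs 4Sxss 5s" "2 3 1ss 5xs 0 4SSSSxs" "tAT a"
    "AATTAttaTat";
  entry 2 "1 3 0 6 5x 2S 4xs" "0s 4 6 1x 3 2xSx 5" "t aTAA"
    "AAATAAtAtAT";
  entry 2 "1 3 0S 6 5x 2x 4s" "1x 4 5 0 2 3 6xsxS" "ATTA tA"
    "AATATTAttAt";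
  entry 2 "4 0 3 1 6Sxs 2x 5" "2x 4s 6 3x 0x 1 5Sxs" "AtA TA"
    "AATAATAtat";
  entry 2 "2 4xSx 1 5 6sx 0 3Sxs" "0x 4 3s 6 2 1x 5" "ataa t"
    "AATTatAttaT";
  entry 2 "3 5s 4 2 1x 6xS 0" "4 5 1S 0s 3x 2 6xsxS" "at aTT"
    "AAAATAAttAT";
  entry 2 "2 3 5Sxs 4Sxs 6x 1 0x" "1 4s 6 2 3 5x 0" "ttaa Ta"
    "ATATatAttaT";
  entry 2 "1 4 0 5sx 6 2S 3x" "1s 2x 6sxS 0 3 5x 4x" "tA ata"
    "AAATAAtaatAT";
  entry 2 "3 0 1 6S 5 2sx 4x" "3s 1x 5 4xS 0 6sxS 2" "tA Ata"
    "AATAATAtAAt";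
  entry 2 "1 3x 5 2sx 4x 6 0S" "6 5 4 0ss 1 3s 2xS" "AT TaTT"
    "AATATTAtAtat";
  entry 3 "1 3s 0S 4SXs 6X 2 5SXs" "0X 4 6 2X 3 1 5x" "AAtA t"
    "AAATTTAtatt";
  entry 2 "1s 4 0x 5S 3 6x 2" "2 5xS 1xsx 0 4x 6 3s" "aaat ta"
    "AATATatttaT";
  entry 2 "6 3s 5 0 2S 1 4" "1 4ssxS 3ssxS 0x 6x 5x 2" "taa Ta"
    "AATaTTattat";
  entry 2 "3s 2xsxSSxSxs 4 5x 1s 0Sx" "4 0sxSSSx 5Sxs 2x 3 1" "aTT aaa"
    "AATATAtttaT";
  entry 3 "1 4 0 5 2XSxs 3XSxs 6" "3x 2s 6 0 5x 1 4Sxs" "ata TT"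
    "AAATTATattt";
  entry 3 "3 4 6 5 0XS 2x 1s" "2xsxS 6xS 1sx 4 0X 5x 3" "At att"
    "AAAATTAAAtat";
  entry 2 "3sxssx 0S 1 5 2xSxSS 4xsx" "2 1xSx 4xsss 0SSSx 3 5s" "AAT TA"
    "AATAtatATTat";
  entry 2 "5 0 4 6 1 2 7 3" "5x 4s 6 0 3 1s 2 7s" "ata tA"
    "AAAATaatAtaT";
  entry 2 "2 3x 4 5S 1xs 0 6x" "2sxs 3xS 1 5sx 4Sx 6s 0" "Att Tat"
    "AATAtattAATT";
  entry 2 "3 0 1 5 6 2 7 4" "3s 1x 5s 7 0 4 2 6s" "tA Ata"
    "AAAAATAAttAT";
  entry 2 "1 3 0 4 2 7 5 6" "0s 4x 5 1s 7 2 3 6s" "t AATA"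
    "AAATaatAAtaT";
  entry 2 "4 2 7 5 6 0 3 1" "0s 3 4 1 6x 2 5s 7s" "t atAA"
    "AAAATAAtAtAT";
  entry 2 "4 2 7 6 5 3 0 1" "5x 3 4 7 6s 2 0s 1s" "At aaT"
    "AAATAAtAAtAT";
  entry 2 "5x 3 2xSxs 1 6xS 4s 0" "3 4 6Sxs 2 5 1Sxs 0s" "At AAAA"
    "ATTATTAtattt";
  entry 2 "2 4x 0 6x 1 7 3S 5s" "3 4 5 1 2 6 0 7" "tAt tat"
    "ATTATatAtat";
  entry 2 "1 4 0 2 6 3x 5x 7" "3 2x 6s 0s 5 1 7 4" "tt ata"
    "AATAtttAATT";
  entry 2 "5 0 3 1 2xsx 6SxSxs 4" "5x 4 0s 3Sxs 6sxS 1S 2" "ATA tA"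
    "AATaaTAtaat";
  entry 2 "3 0 1 4 2 7 5 6" "4s 1x 3s 6 7 0 2 5s" "tAA Ata"
    "AAAAATaattaT";
  entry 2 "1 3 0 4xSx 6 2 5xsx" "0x 4sxsxSS 1s 6 2Sx 5sxS 3" "AtA t"
    "AAATAATAtAt";
  entry 2 "7x 0 4 6 1 5 2x 3" "6 5 4x 0 3 2 1S 7x" "ATT aat"
    "AATAtttaaTT";
  entry 2 "6S 3 5 1 7 2x 0 4sx" "3 0x 6x 2 1 5 7 4" "AA tat"
    "AATTAtattaT";
  entry 2 "1x 3 0 7 5sxS 6 2 4" "3 5 1 2s 0 7 4 6s" "tta aaT"
    "AATAATaTAttt";
  entry 2 "2 3sxs 0 4xSS 1Sxs 5x 6Sxs" "6sx 0 5 4 2x 1S 3" "TTTA taT"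
    "ATATATTAtttt";
  entry 2 "1 3 0S 5xss 2S 4x" "1xSx 0S 2SxssxsxSS 3xSxsssxSS 5xs 4xs" "TA Ata"
    "AATAttATaTat";
  entry 2 "1 5x 0 7 6S 3 2 4s" "3 4S 6 2 0 1s 7s 5" "TTA tAAA"
    "AATTTATatttt";
  entry 2 "2 4xSx 1 6xss 3 0Sx 5" "5s 4 1xssxS 2 6 0Sxs 3xSSx" "At ta"
    "AAATAAATAtt";
  entry 2 "6sxsxS 4xs 5xS 2 0S 1 3" "1 4 0SxS 5 3sx 2s 6Sxs" "ATT atA"
    "AAATaatAtaT";
  entry 2 "7 3 5 1 4 0 2 6" "7s 0 4x 5 1 3ss 2s 6s" "tA AAttt"
    "AATTAAtaTatt";
  entry 2 "1 4sxS 0 2S 5 6xs 3xsxS" "2x 4sx 5sxsxSS 0 3x 1 6S" "AAt ta"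
    "AAAATaattaT";
  entry 2 "0x 2S 5 1 7 3xsx 6x 4" "1 4 0 6 2xS 7 5 3sx" "TAT a"
    "AATAtATaTAtt";
  entry 2 "4xsx 3 2S 0xsxSS 1 5xsx" "2 3xSxssxS 1xsxss 5 0sxSS 4Sxssxs" "tAT TA"
    "AATTattAATat";
  entry 3 "1 3 0 5 2 7 4 6" "0s 1s 2Xs 3xs 4s 5Xs 6xs 7xs" "t tATa"
    "AAAATAAtATAt";
  entry 3 "1 3 0 5 2 7 4 6" "0s 2s 1xs 4Xs 3Xs 6s 5xs 7xs" "t taTa"
    "AAAATaatATat";
  entry 2 "4 1sxS 2x 5sxs 0 6SSxSSxss 3" "2 3 1 5sxss 0s 6S 4SxSS" "at taT"
    "ATATTTAttAtt";
  entry 2 "0s 2 4 1 3 6 5x 7Sx" "4x 7sxS 5s 6xsxS 0 3xSx 2 1" "a TT"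
    "AATAtaTATatt";
  entry 2 "3s 2 5 1 4 7S 6 8 0" "5 4 6 0 2 7 1 3 8x" "at Ata"
    "AAAATTaaatt";
  entry 2 "2 3Sx 4x 1 5 0x 7x 6s" "3 4 1xsxS 2s 7s 6ss 0 5" "ttA taTA"
    "AATaTattaTat";
  entry 2 "0xsxS 6 4xSxS 2sxsssxSS 5xsxS 3 1" "5S 3xssxSSS 4xs 6 1 0 2s" "TT a"
    "ATATTAtatat";
  entry 2 "0x 3Sxss 2S 1xS 5Sxs 4x 6s 7x" "2 4s 1 5Sx 7 0S 3xs 6" "tAT a"
    "ATTAtaTTAttt";
  entry 2 "1 2S 0 6 5sx 8 7x 3 4" "1 4 3 0 6 2 8 7x 5" "AAA Taaat"
    "AATTataTatt";
  entry 2 "6 3 0 1 7 2 5 8 4" "3 4 5s 2xs 6s 1 0s 7x 8x" "at atATT"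
    "AATTAtaTAtt";
  entry 2 "6 3 0 1 7 2 5 8 4" "3 4 0s 2xs 6s 1 5s 8x 7x" "At ataTT"
    "AATTAtATAtt";
  entry 5 "6 2 4 0s 1SX 7x 3 8x 5" "6x 0 5X 4 2X 1 7x 3 8" "aaa tA"
    "AATTATAtAtt";
  entry 2 "7x 3 5 0 1 2 6 8x 4" "5s 3x 6 7 4x 2s 1 8 0x" "ttAT aat"
    "AATTatATatt";
  entry 2 "6 3 8 7 0 2 4 5 1" "7s 4 6x 5s 1x 3Sxs 2s 0 8x" "tt ATTa"
    "ATATAtAtaTat";
  entry 2 "8 0 4 7x 1 3 2 5x 6" "2S 5 7 4S 1sxS 6S 8x 0 3" "TTT aTAA"
    "AATAttATataT";
  entry 2 "2xS 4sxS 0 6 1s 7 3ssxS 5xS" "0S 1x 5 4 2x 3ssxSS 6s 7sxS" "T aaT"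
    "AATTaTAtAtat";
  entry 2 "5x 3sxSSx 4xSS 6 1ss 2s 0x" "4xs 2xsxSS 6sxSSS 5sxsssxSS 3 1 0xS" "Ta TATT"
    "AAAAATTaatat";
  entry 2 "1 2 0 8 7 4x 3S 6xs 5" "3 5 7 8s 0 6sx 1 4x 2s" "tAtA TATA"
    "AATAtaTattAT";
  entry 3 "2S 0 1 7 3xS 6s 8s 4sXS 5" "0x 3 5 8sx 1 7x 2XS 4 6x" "AAA t"
    "ATTATattt";
  entry 3 "5 2X 8S 4x 6xS 7sxS 3 0xss 1" "0S 4 5 8 6 1 7X 3 2sx" "T aaatt"
    "ATATATattat";
  entry 2 "2 0x 1 6 7 3x 5 8 4" "1sx 4ss 3xs 6sx 2 0sx 7xss 5 8s" "ta aaa"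
    "AAAATTAAtat";
  entry 2 "0x 4 7 3 6x 2 9 1 5 8" "4 2 6 7 5 9 3 1x 0s 8" "ttAt a"
    "AAAATTTatatt";
  entry 2 "6 2 4 0 1 8 5 3 9 7" "1 3 5 7 4 8 2 6s 0x 9" "AAtA TAAA"
    "AATaTTAttat";
  entry 2 "0S 5Sx 3 1ssx 7sxsxSSSx 2xSx 6s 4sx" "2xS 4SSS 7s 0 3 6ss 1 5xs" "A tatA"
    "AAATTATaattt";
  entry 2 "4 0 1 3 5x 7 2xSx 8sx 6" "5 2Sxs 0s 1 7 6xss 3s 8sxs 4" "AAt aaT"
    "AATAtAtaTTat";
  entry 2 "2 0 1S 7s 8xs 4 3 6x 5S" "0S 3 5xS 4S 1S 6 2xS 7Sx 8x" "T AttATA"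
    "AATAttaTTAt";
  entry 7 "3 4xsXXXsxSS 6XSSxx 2XXsX 5xx 0xs 1" "0XXsxxxS 4 5SSxxx 6 3xxx 1 2xsxsXX" "aTaa t"
    "AAAATTATattt";
  entry 3 "1 0S 6 4s 3 2 8 5X 9 7x" "2 4 7 0 9 1 5X 8 3 6x" "AA aTATT"
    "AATAATATattt";
  entry 2 "2 4s 1 3 6 0SS 8 5 7s" "3ss 0x 1sx 2 6x 4x 8x 7sx 5xsxsx" "att aat"
    "AATAttaTATat";
  entry 3 "6SX 3s 2 1 4 8 9 0 7x 5" "3 4 0S 2 5S 1 9 8x 7 6" "TTT Ataa"
    "AATAtattaTT";
  entry 3 "2S 5s 0 6 8 1 4 3 9 7" "8 3 5 6X 1S 2 4X 0s 9x 7x" "AA ttAT"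
    "AATATATattAt";
  entry 2 "2S 4S 0 5Sxs 1 3sx 7xSSxsss 6" "2xS 3ss 4 5 1ssxS 7Sxss 0SxSSxs 6Sx" "AA tA"
    "AATATTAttaat";
  entry 2 "0S 3 2S 6s 1 4Sx 9x 5 7s 8s" "1 5 0 7 9 2 8 6 3 4" "A tAATTa"
    "AATaTATAttat";
  entry 2 "3 4 8 5x 6 9 2 0 1 7x" "0s 5 6s 8 4Sx 3S 9 2 1s 7S" "t aatAt"
    "AATaTAtat";
  entry 2 "7 2x 3 1 0x 6 4 9 5 8" "8 0 5x 3Sxs 1 7 2 4sx 6xs 9" "ata Att"
    "AATATTattAt";
  entry 2 "3 1x 5 7 0 8 2 4 6 9" "4 0 1 2ssx 3s 6 7S 9 5sx 8ss" "AtA Tat"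
    "AAATAtATTatt";
  entry 2 "0S 4 3xS 1xsxsxs 2xsssxSSSSxS 5xsxssxSS" "3ssxssxSSSSSx 1xsxSSx 2s 0S 5 4sssxsxsxSSS" "A AttA"
    "AATATattaTAt";
  entry 2 "1 4 0 6 5 2 8 3 9S 7s" "3 0s 1xS 6s 7 2xS 9 4x 5x 8x" "at Att"
    "AATAATAtt";
  entry 2 "1 3 0 5 6 2 9 4x 7 8x" "0s 4 3s 1Sx 2x 6 7S 8s 5 9Sx" "t AttA"
    "AATTAtaat";
  entry 3 "4 2 1 6 8X 0 9sx 3 5XS 7x" "2S 3s 0 1 7 8s 5 9 4 6S" "TT aTAA"
    "AATATTatAtat";
  entry 2 "2 3 1 4 0 8 5 9 7 6" "5x 4sx 2sx 6x 0S 1 8S 3 7xs 9S" "Ta ttAA"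
    "AAATAATAtat";
  entry 3 "4 5sssxS 3xSS 1xs 6s 2XSx 0xSX" "1sXsxsXsXSSS 5xsxss 6sxSSS 0S 3 4SSXSSX 2Xs" "TTA aaa"
    "AATATAtttaaT";
  entry 2 "1 5 0 6x 3 7x 9 2 4sx 8xS" "3 4xs 8 2 0S 9s 1Sx 6 5 7" "TaT att"
    "AATTTAtAtaat";
  entry 3 "2s 4xssXSSSxSX 1s 5sxSS 0 6s 3X" "6sXsXsssxS 5sX 3sxss 1xSxSxs 2 0XSS 4xSxSS" "aTa AAAA"
    "AATaTTatatat";
  entry 2 "1 3 0 5x 8 2 6x 4sx 9S 7" "0s 4 1s 6ss 2S 8x 5 3 9 7s" "t aaaaa"
    "AATTATattt";
  entry 2 "4s 0 1 7 5S 2 9 6 3 8" "4 3 6 0x 1Sxs 5S 9sx 2x 8sx 7S" "aT Att"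
    "AAATAAtatAT";
  entry 2 "2 4 1 7 6s 9 0S 5 3 8" "6 5 3 2x 0S 8sx 1Sxs 4x 9sx 7S" "AT aTTA"
    "AAATaatataT";
  entry 2 "1 4 0 5 6x 9xS 2 7x 3 8s" "3 0s 7ssx 9 2s 1S 8 4 5sx 6" "at aaaaa"
    "AATATATattat";
  entry 2 "9 1x 4 0 8 2 3 7Sxs 5 6" "8Sxs 3 7 4Sx 0x 9 2x 1 6s 5x" "TTa aTTA"
    "AATATTAtatAt";
  entry 2 "7s 2 3 1 0xSx 6x 8x 4sx 5Sx" "7 0 5s 3sxS 1S 8Sxs 2Sx 6ssxS 4sxS" "aT AAT"
    "AATTATatAtt";
  entry 2 "0S 2 4 1 8xs 6x 3 7s 9S 5" "5x 7SS 4Sx 0 9 2 8 1 3s 6ss" "A ttAAt"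
    "ATATatAtaTAt";
  entry 2 "6 2 1 8x 9 7Sxs 0S 5x 3Sxs 4s" "7s 4 0 2 8S 1 6xs 3 5 9Sx" "AA ata"
    "AATAtATattaT";
  entry 2 "1 3 0S 7 8ss 6x 2 4 5Sx" "0S 4sxs 2xsx 7SxS 6sxSS 1SxS 3 8sssxS 5s" "T tAta"
    "AATATTaattt";
  entry 3 "5s 3SXs 6SXS 0 7 2SxssXsxSS 1 4xs" "0s 4 3X 6 7sXSSX 2 1sXsXsxsXSS 5SXssXs" "t atAA"
    "ATATattaTAt";
  entry 2 "7 0 3x 1 6x 2 8 9 10 4 5" "2 4 6s 3 7 1 10 9 0 5 8" "ttat taaa"
    "AATTaTAtatt";
  entry 2 "2S 0 1 5sx 8 6sxSS 3 4s 7" "4 3 1sx 7x 0ss 2Sxs 6xsxsxSS 8ssxS 5ss" "AAA ata"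
    "AATattATTat";
  entry 2 "7s 3x 5 4sxS 2 1 8xS 9Sxs 0 6" "6s 5Sxs 0 4 8 1x 2 3 7xs 9x" "ttt aTa"
    "AATAttAtATT";
  entry 3 "2xsXs 4X 3sx 1SX 6ssXSS 7x 0SSS 5sssxSS" "4xs 3 1SSXs 0SSS 6 2S 5xssxSS 7x" "TaTA aat"
    "ATAtaTATatt";
  entry 3 "2s 3 1 0XsXS 5xSSSXs 7 4xSxs 6s" "1 4Sxss 2xS 5 0SXSX 6xSxsssx 3Sx 7SxsssxS" "aaT AAT"
    "AAATTattATat";
  entry 3 "7s 5 8 0 9 6 2XSXs 4xSxs 1 3S" "2 4X 7 1xsX 8 0Sx 9S 5 3 6s" "aTT att"
    "AAATATAtt";
  entry 3 "0S 2sXS 4SSxSx 6 1ss 3xS 5XsssXS 7sx" "4s 5SXs 0XSS 7Xss 3 1X 2sXssx 6XSxSXSS" "A aatAt"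
    "AATAtattATT";
  entry 2 "1 4 0 2x 9 7x 5 3 6x 10x 8" "1x 5s 6 0 4 2 10 8 3 7sx 9" "atta tA"
    "AATTaTatatt";
  entry 3 "8X 4X 10 7 6 2X 0 9 3 5 1" "0x 2 6 10 9sX 8 3x 5 4xS 7X 1" "AATA t"
    "AATTATaattt";
  entry 3 "2 0S 1 6sXS 4XsxsxSSS 3XSXsssx 5XS 7sx" "4s 3xsss 6sxs 1xSSS 2XSX 0xS 7xsX 5SS" "AAA aTT"
    "ATATTAtAtat";
  entry 2 "2 3 1 5 6xsx 0 9sx 4xSSx 7s 8Sx" "6s 4 1x 2sx 7sxs 3sx 0 9 5 8" "tt atAA"
    "ATATAtATatt";
  entry 2 "5 0 4 7sxsxSS 1 2 9 6x 3Sx 8sxsxS" "7s 5s 0x 4x 3s 2x 1 9 6 8ss" "AtA aat"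
    "ATATAtATAtt";
  entry 3 "0S 5 4 8 1 2 6s 9 7ssxS 3SX" "4 6x 7Xs 1xssxS 3 0XS 2S 5sXS 8 9s" "A aTaaT"
    "AATAttATTAt";
  entry 2 "3 0 5 2 8 1 4S 6xsx 9xsxS 7" "0s 6sxs 4xs 2s 5 3x 9 1 8xSxssxS 7x" "t AAtA"
    "ATATatATAtt";
  entry 3 "1 3XsXS 0 9 5X 8 4 2xsxSS 6x 7s" "3 5 8s 4sXS 0 7x 1 6sXS 9xS 2" "AtATA aaT"
    "AATTTTAtattt";
  entry 2 "4 3xs 9 7x 6 2xsxSS 8 0 10 1 5" "5x 4 6 2S 7s 1 10sxS 0S 3 9x 8s" "Ta tttA"
    "AATTTAtaatt";
  entry 2 "5 3 4Sxs 2 1 8 0Sx 7s 6s 9S" "0s 5 9xsxSS 6xs 7xsxSS 4xs 2 3 8SxsssxSS 1" "t AAAA"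
    "AATattaTTat";
  entry 11 "7 0 5 8 2 1 3 9 4 6" "0s 2xxxs 7Xs 9xxs 5xs 3XXs 1XXXXs 6xxxxs 8xxxxxs 4XXXXXs" "t AAtATA"
    "AAAATAtaTaat";
  entry 2 "0s 5Sxssxssss 4xSSxSSSx 2sssss 1 6SSxSSSSxSxs 7 3" "4 6 0SSxSS 1ssss 3s 7SSxSSSx 2xsxsssxs 5sssxsxsss" "a tAtA"
    "AATAttATAtaT";
  entry 2 "6sxss 4xssxsxs 5 3xS 7ssx 1xSSSS 2ssxS 0sxSSxSSSS" "6ssxss 0 7SxSxssss 5xSxss 3s 1sxsxSSSSSx 4xsx 2ss" "tA TaTA"
    "ATATAtATatAt";
  entry 2 "0S 2 5 3xSxs 8S 1 4sx 7s 6Sxs 11S 9Sxs 10xs" "11 0 7x 9 5 3 1x 10 2 8x 4 6" "A TTTT"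
    "ATATTAttt";
  entry 2 "2 5xS 7xs 3xS 0SxSSSS 6SSSxs 4xssx 1xssssss" "0s 6 1sxsxsxsssx 4xsxsxssx 7sxSSSSS 5xsx 2xsxSSxSSx 3xsss" "t AAtA"
    "AATAtATattAT";
  entry 2 "0S 3 6 4 1 8Sxs 7 2 10sxS 9s 5 11xSxs" "1 5s 0 8x 10 2x 9xs 11 7 3SSx 6xs 4S" "A atttt"
    "ATATATAtatt";
  entry 11 "2S 5 4 7 1 8 0xs 9 3X 6" "4 1sXX 6sx 5xsXXXXX 3sxx 0sxs 8xsXXXX 2xsxxxxx 7sXXXX 9xsXX" "tAA AAtaTA"
    "AAAATAAtaTat";
  entry 2 "3x 0 1 8 7 10xS 2S 5s 4 6xsx 11 12sxS 9x" "4 3 1x 5x 9 0 6x 2 11 12 8 7 10" "taat aTa"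
    "AAATATAAtt";
  entry 2 "8 4sxS 3 1 9 2x 7 0 5 12s 11x 6xS 10" "1xsxS 5 6 0 3 10 8s 2 9sxS 4x 11 7S 12x" "AAtA tAt"
    "AAATAATAAtat";
  entry 2 "8 4 3 1s 9Sxssss 0SSx 2 10SxSxSxs 5sxs 6xSSSS 7sxs" "8s 3xSxs 5sxs 0 10Sxssxs 1xsxSSSxSxs 6s 2sxSSSS 9sxsxs 7s 4xSSxSx" "tA aaa"
    "AAAAATATaatt";
  entry 2 "15 3xsxS 1 12 8 9 11 10x 4 5 6x 7 2 14xSx 13 0s" "6 1x 4 5 10 11sx 2 3S 14 15 8 9xS 12sxS 7 0x 13sx" "aa ATTAT"
    "ATATTattt";
  entry 2 "14 3sx 12ssxS 1SS 8 9Sx 11 10 4Sxs 5s 7 6 2 15 0S 13s" "6 12 4sxs 5Sxs 10 11SS 2 3 14S 15 8Sxs 9s 1 7Sxs 13 0" "AA aTAAtA"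
    "ATATATatatt";
  entry 2 "0xsxsxssxSSSS 1SxssxS 4 2Sxs 3xSxssxssxssxSSSSS 8Sxsss 10 6xs 9xsssxSSSSSx 5 7xs 11sxssssxSSSSSSxSx" "10ssxss 3 11 6ssxsssxSS 7ss 2sxs 5xSSxSx 8SxSxs 4 0 9SSxS 1" "ttt a"
    "ATATTatAtat";
  entry 2 "6sssxsxSS 2sss 8sxSSSSxss 9 0SSxSxSx 5xSxSxssssxSS 4xssxssxSS 3 1 7xSxsssxssxSSSS 10SxssxS 11SxSSxs" "2ssxsx 5 7SxSxs 0SSSxS 8SxS 6sxssxSSSSSxs 1S 4 3 10SSxs 11xss 9xs" "ataT aaa"
    "AATTAttataT";
  entry 2 "2 0 1 5 3 4 7 8 6 9 10 11 13 14 12 15 16 17 18x 19 20x 22 23 21" "6 7 8 9s 10s 11s 18 19 20 21 22 23 0 1 2 3 4 5x 15 16 17 12 13 14" "tttttttt ttaTT"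
    "AATTTAAtatt";
  entry 2 "16 3 5 7sss 9x 11 0Sx 14SSxSSxs 15s 2 12xss 8 18S 1 19 4Sx 17 10 6 20 13" "3 4s 6s 8 10 12ss 14 5S 0s 16x 7xss 17x 1SxS 2 9Sxss 18SSxs 13 19SSxs 20 15Sxssxss 11Sxss" "ttt attta"
    "AAATTTatatt";
  entry 2 "0S 2sxsxSS 21 5 3xSxs 4 7sxS 8sxsxsxSSS 6 11 9S 10xsx 14 12xsxS 13 16ssxsxSS 17S 15 18S 19sxS 20ssssxSSS 1 22sxS 23xs" "12 7 8S 9xSx 10S 11xSxSx 18 19 20 0 22 23Sx 21 1SxS 2S 3sss 4sxsxs 5sssxS 15s 16 17 6 13 14" "A taaaT"
    "AATTTAttaat";
  entry 2 "21 3 15 6 8 4xSx 10s 12 14 16 18s 19s 20 9 13S 1 5 24x 2 26 23s 22s 27Sxss 11SxS 0 17SxSx 7x 25" "22 4xss 5 7 8xs 9 11 13x 0x 17 1 16 6S 20 18 2 23x 21 25s 19xs 24 15 10Sx 27 26x 14SxS 3 12Sx" "aaT AAtA"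
    "AAATaTAtaat";
  entry 3 "8 3ss 5XSxssXssX 7 1 10 12XSXsssXs 6sxsxSSSx 0xsxsxsXSSS 14s 16 4 17XSSSxS 15SxSSSxSXs 9XSx 2 19SXSX 11 13sXsss 18XsXSSXSXs" "9 0S 6 8sXSSXSXSx 2 11SXSSXSx 13XSxssxsxsX 5s 4 15Sxs 14SXSxSSXs 16xSxssXsXs 18XSSSSSxs 17SSSSXSX 19 12ssxs 1SSXSxS 10xSXssssX 7s 3" "TATA AA"
    "AAATATAAtaat";
  entry 2 "5 3 1sssx 7S 9 10 11 13SSxSS 15Sx 12ssxs 17ss 19 21 22 2 24S 23SSxSS 6 25s 0 26x 8xs 14 20ssxsxsx 4xSS 27 18S 16x" "6 4SSS 0 8 2 5S 12 14xSxSS 16 17ssxsx 18 20 1s 23 13 11s 3s 7 24 21s 10S 26 19ssxsx 9 15 27xs 25x 22xSxSS" "aTA ttAtaT"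
    "AAATTAtaaat";
  entry 2 "0s 1S 3x 2sxS 4xSxssxS 5Sxs 6Sxs 7Sxs 9xsx 8xSx 11 10xsxS 13xsxSS 12s 14xS 15Sxss 16S 17xSxss 18xs 19Sx 21 20 23 22xSxs 24SxssxS 25 27xSxs 26 29 28xSxs" "10 11 12 13 14 15xs 16 17 18 19 22 23 24 25 27 26SSxs 28 29 20 21S 0 1sx 2 3 4 5s 6 7sx 8 9" "a tAAT"
    "ATTTATatttt";
  entry 3 "4Xs 5Sxs 6 7X 0S 1 2x 3 16 17xSXS 18 19Sx 21 20xSX 23 22XSXs 9 8 11xss 10sx 14Xs 15s 12S 13 29 28 30S 31 27 26ss 24S 25" "8 3Sxs 4xSXs 1X 2 9 10Sxs 11SXss 20 21xSX 22 23Sx 0 5 6xSXs 7 28 29 31 30 18 19 16 17S 12 13 14 15Xs 24S 25s 27x 26Xs" "TAtAT AA"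
    "ATATATAtAtt";
  entry 3 "0s 14sxSSx 2XsXS 3XsXS 4xsxSS 5sxsXS 7x 6sxS 8sxS 9x 11XsXsXS 10XS 13sxsXS 12xsxSS 1s 15sxSSx 17sXsxS 16XsxSSX 19sxS 18x 20sXSS 21xssXS 22sxsXS 23xsxSS 24x 25sxS 27sxS 26x 29x 28sxS" "27sXS 11 12 13 0 15 16 17 18 19 22 23 24 25 10 26X 28 29 20 21 14 1 2 3 4 5 6 7 8 9" "a tAAT"
    "ATATTTAtttt";
  entry 2 "0s 3xSS 21xssxSS 1xss 6xSx 7sssxsxSSS 5 4 9 8sxsxSS 10sxSS 11xs 14SSx 15sssssxS 12x 13sxSSS 17sxsxS 16xsxSS 18Sxs 19Sxs 20S 2 22SxSxs 23SxSxsssxsxS 26SSxssssx 27s 25xSxSSSxs 24sxS" "25ssxS 5SSSSx 6 7SSxs 12xssxs 13 14xsxss 15ss 21 1Sxssxsxs 2SS 3SSxSSxss 20 0S 22 23Sxs 8SS 9SS 10SSxss 11 24sxsxS 4xs 27xs 26xs 16 17 18S 19Sx" "a TAttaT"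
    "AATTattataT";
  entry 2 "20 3 5 7x 9 10 12 11 14 16 18x 1 19x 21 24S 23 26 25 2 30 32 33 34 35 29 37 4 0x 28 8x 6x 15 27sx 39xS 40 31 17s 36 22 13 38 41" "21x 4 6 8 5x 0 3x 13 15x 17x 19 2 22 23 16x 25 27 28 29 31x 7 30x 35 10x 36 11 1 33 14 37 26 20 38 9 18 34 40 12 24 41 39 32" "aaaa attaT"
    "ATATTTatttt";
  entry 2 "0s 3SSxSSSxss 1Sxsss 16SSSxs 7s 6SSxSSxss 5ss 4xSSxs 10sxsss 11SSSSSxSSxss 8xSxSx 9SxSSxssssss 13s 12xSx 14SSxsss 15Sx 2sss 17S 18SxSxsss 19SxSSxss 21 20 22SSSxsss 23SSSxsss 26SSSSxsss 27S 25SSSxsss 24ss" "8 5 6 7SxSxs 12 13SSxSx 14 15 16 1SSSxss 2 3 20 21 22s 23SSSxssssss 4 9 10 11 25SxSxsss 24sxsss 26Sxs 27SSSxSSSxsss 0SSxSSS 17Sxsssss 18 19" "a AtaaTA"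
    "ATATaTAttat";
  entry 2 "41 3 5 7 9 11 13 15s 14ss 17 19 21SS 10SS 23x 25x 27 4 29 31xS 24s 33sx 28s 6 30 35sxS 18 37S 39S 0s 32 36x 26 34 12 16 20 38 8 22 40 1 2" "0s 4 6 8 10 12 14 16ss 13ss 18s 20 22SS 9SS 24x 26x 28ss 3 30sxS 32xSx 23s 34sx 27S 5 29sxS 36sxS 17S 38S 40 41 31x 35x 25 33 11 15S 19 37 7 21 39S 2 1" "t aTATTTTTAA"
    "AATAttataTT";
  entry 2 "19 3 5 4s 6ss 9 0SSS 13 15S 17xsx 18 1 20 22 2S 25 26S 28 7 11 10 32xSx 12 33s 34 35 36 16xSxss 31 38 23 14xSxs 37 29S 30 40 21 27s 24 8s 41 39" "19s 4 6xsxss 7 8 10s 12SxSxs 14 16 0 3xSxS 2 21sxsx 23 24xSxss 17 27SxSxSxs 29xSx 30xSxs 31s 26 22 11 33 5 1 37x 25SSxSxS 15xSxS 18 28S 39 38 20SxSxs 36xsx 9s 41 13S 34s 35xS 32sxsxs 40sx" "tA aatta"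
    "ATATTatatAt";
  entry 2 "10 3 0 6 8ssx 1 12 14 7 17s 19sxS 21 23 24sxS 13xs 26 28Sx 16ss 30 31 32xSS 20sx 2S 34 33 9 37S 22sxS 39xsxS 35 36x 27sx 15sxs 4SSS 5 38 29SS 11 40 41SS 18ssx 25" "11 4 1 7 9 2 13sssxsxS 15s 16xsxsxS 18ssssxS 20xs 22 10ssxSS 25SSS 26sxsxS 27xSx 29sxSSS 0 28 3sxsxSS 33 24xs 6xSS 35 17xSS 36ss 38SxSS 39 30 32 37Sx 5S 19 23xSS 40 41 21sxsxsxSS 31S 12 8ssxsxSS 34 14sss" "AATT atAAT"
    "AAATTAAtat";
  entry 2 "28 5SxSSSxs 7 6 2xs 3SxSSxs 26 1Sxssssxsx 16 17sxSS 19ssss 18SSSSSS 20xsxsssxSSSSS 21ssxsxssxSS 23xssxssxss 22xssssxS 10 11ssxs 8 9 13 12SS 14SSxSS 15SxSSxSS 30SxsssxssxSS 31S 4 29 0s 27xsxSSxSSxss 24ssxsxSSSSSxs 25xssxSS" "14 3SSSSSSxs 26xssxsxsxSSSSS 1xsxssxss 8 9xsxs 10s 11xsxsssx 20s 21xSxSSSxss 22sssxsx 23 4S 5SxsssxsxS 6 7 28 29SSxsss 30xss 31sxSSxSxs 16 17 19SSxSxSxSxssss 18SxSSxSxSSxs 12 13SxSSx 2s 15SxSxSSxs 0sxsxsxSS 27xsxSSSxs 25Sxss 24SS" "aa Ta"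
    "AATAtttaTaT";
  entry 3 "30Xssxss 5SS 7 6XSXSxSxSSxSXss 3xSSxssssxss 2SSSXss 22 1SSxsssss 16SSXsssXs 17SSSXssssxsXsXSSS 19xSXsssxsss 18XSxSXssss 24sss 25SXSSxSxSSxsss 26SSXss 27SSxss 11xSSXSxSSXss 10 8SxSS 9SxSXSxSXs 28xssXss 29SSxSSxSXs 4 31SSxSSXSSXss 13Sxss 12 15xsxSSx 14 20SSSxSSxSXSXss 21XSSXsssxss 0SSXSSxs 23XSXssxsXsss" "28XsXsXsXsss 3SSXsssx 22sxSS 1S 8ss 9 10 11s 20 21xSSXssssss 0S 23sXsxsXs 4SS 5SSSSSxSXsss 6SSxs 7S 12SSxS 13SXSXssssxsxs 15SSSXSxs 14SXSS 30sXsX 31SSSxSxS 2SXss 29SSSSxs 17SSxSSXSxs 16SxSxssss 18sss 19ssxss 24SSXSSxsss 25SSxss 26SSSSxss 27" "aa tata"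
    "AATATAtttAT";
  entry 5 "13 3 5 7Xs 9 11 1 15SX 2 18 20x 22x 17 19 26xx 6 28Sxxs 30 32XX 10 0 21 8 37 35 14 31 27 41SXXs 43 42xs 46 48 12 45 52 53 29Xs 54 55 56 40 33Sx 57 58 24 25 60X 4 49 38 62SXs 34X 63Sxs 44 59 16 23Sx 50 47 39 61 36 51" "14 4 0 8 10 12 2 16 17 19 21 23 24 25 27 28s 29 31 33 34 35 36xxs 37XX 38Xs 39 15 3 40s 42 44 45 47 49 50s 51xxs 6 48 52 53 32XX 20 57 58SXXs 26 55 1 59 61xs 30 54s 7 11S 63s 9 60 18 13 46 62 22 5 43 56 41SXs" "tttta aaaaa"
    "AATAtaTTatt";
  entry 2 "6s 5sxsxSSSSSxS 4s 7xss 12ss 13 14SSxsss 15SxSSSSxSxss 2 1 0 3xSSxsssxssxS 20sxsxsxsxSSSSSSxSxs 21 22 23Sxssxssxs 32 33sssxssss 34Sxsssss 35SSxssssxsss 8S 9xSxsssxss 10SSx 11SSSSx 19xsxsxsxSSSSS 18xsxsxSSSx 16SSxs 17SSSxSSSx 27xSSxsssssxs 26SxSxSSSS 24SSxSS 25xSSxssss 39sssss 38SxSxSSSSxSxss 37SxSSSSxSSSxsss 36SSxSSxSSSxss 30xsxsxssssx 31xssxSS 28 29SxSxsssxs" "2S 3xSxsss 0 1SSSSxSxssss 8ssxssxSSSSS 9sssxssxsxSS 10xssxssxSSSSSx 11SxSSSxSxSxSxsss 17 16SSSSxs 19 18 24 25ssxsxsssxSS 27xsxsxss 26SS 4 5 6SSSSxs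 7Sxssssssxsss 36 37ss 39xSSSxssssxsxss 38SSxSxSSxSSSxss 29SSxsssssxss 28SSSSSxsss 31SSxsss 30xSSxss 12 13SSSSSSS 15SSSSSSxsss 14xSxssxsxsxSSS 21 20SSSxSxSxSS 23s 22xSSSxSSxs 34sssxsxss 35xssxsxsx 33sssxss 32xSxSSSSSxs" "TT ata"
    "AATTattaTat";
  entry 2 "5 6 7x 8s 9 11 12SSxs 13x 14x 10 0 1 2SS 3s 4s 25 26 27x 28 29 16 17 18xS 19 15 21 22S 23s 24 20s 43 44S 40 41s 42s 33 34x 30 31 32 37 38 39SSx 35s 36 51 52x 53 54 50 56 57 58 59 55x 47 48S 49 45 46s 66 67S 68 69 65 72 73x 74 70 71s 61x 62S 63 64s 60 87x 88x 89 85S 86 78 79s 75 76 77x 83 84x 80 81 82 101s 102 103x 104x 100S 91 92 93s 94 90 95 96Sx 97x 98 99 110xs 111x 112 113S 114S 115 116s 117 118S 119x 106s 107 108 109x 105" "15 16S 17 18S 19 20 21SSx 22 23 24x 29x 25S 26S 27 28 45 46 47x 48 49 50 51x 52 53S 54 55 56 57 58 59 0 1s 2 3 4 5 6ss 7 8 9 10 11 12 13 14 75 76 77 78s 79 80 81 82 83 84 85 86 87 88 89 30 31 32 33 34 35 36 37 38xs 39 40 41Sxs 42s 43 44 105 106 107x 108 109 110 111 112 113 114 115 116 117 118 119 60 61 62 63 64 65 66 67 68x 69x 70x 71 72 73 74 90 91 92 93 94 95 96 97 98 99 101xs 102 103 104 100" "taTAA AAtaT"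
    "ATTTTAtattt";
  entry 2 "6sss 3 5 7 9 11 13Sxssss 15SxSSSxsssssxsxsssxsssssssxsss 17 19SSSSSxssssss 21SSxsssssss 16xSSxsssssxsssxsxssxssxsxsxsxSSSS 8xSSxSxSxsssssssxsxssxsxssxsxsxSSSSSSSSS 25ssxsssssxsssss 27SSSSSxssssssssssssxsssss 0SSSSxSSxSxSSxSSxSSSSSSSS 30xSxSSSxssssssxsxss 24SxSxSxSxsssssxsxsssxsssssxSSSSSSSSSS 32SSSSSSSSSSxSSSxs 34xSSxSSxsssssssxsssssssssxss 35SxSSSxsssssssssxsxsxsssssss 36sxsxssxssxSSSSSSSxSxSxSSSSSxsssss 38 20SSSSSSxSSxSSxSSSSxSxSSxsss 18SSSSxSxsssssssxsssxsssxsssxss 39SSxSSxSSxSxSSxSSSSxSxSxSSxSxsss 41SSxSxSSSSxSSSxSxSSxSxssss 43SSSSxSSSSxSxSSxSSxssss 44 1s 42SSSSSSSxSSSSSSxSSSxss 46SxSxSSSSSxSSSSSSxSxsssss 4S 2S 48SSSSxSxSSSxSSSSxssss 49SSSSxSxSxSSSxssss 51SSS 53SSxsssssxsssssxsxsxsxssxSSSSSSSSSSSSS 54Sxsssxssxsxssxsssxsxsxsx 55xSSSxsssssxsxssxsxsxsxssxsxsxsxsxSSSSSSSSSSSS 56xSSxSxssssxssxsssssxsxsssss 58xsxssxsssxsxSSSSSSSSSxSSSSSxssss 59 28SSSSSSSSS 61SxssxsxsxsxssxsxssxsxsxsxssxSSSSSSSSSSSSSS 52SSSxSSSSSSxSxSxSSxSxSSxSSxsss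 57xssxsxsxsxsxssxSSSSSSSSSxSSSSSxSxss 62 12xsssxssxsxsxSSSSSSSSSSxSSSxSxSSxSxssss 47SSSSSSxSSSSSSSxss 33SSSSSSSxSxSSSSSSxSSxSSSxsss 63 50SxSxssssxsxsxsxssxssxssxsssss 26SSSxSxsssssssssssxsxsxssxssss 14SSSSxSSSxSSSSxsss 29SSSSxss 22SSSSSSSxSxSSxSxSxSSSSSxss 64SSSSxSxssssssxsssxsxsxsssxsxsxss 23SSSxssssxsssssxssxsxssss 45xSxSxSSxsssssxssxssxssxssssxsxsss 31SSSSSSSxSSxSSSSSSSxsssssssssssssssss 40SSSxssss 37SSSSxsssss 60SSSxssssxsssxsssxsxssss 65SSxSSSSxSSSSxSSxSSxSxSxsss 10" "25sxssssssxsssssxsssss 4ss 6 8ss 10 12s 14SxSSxssssssxsxsxsxssxssssxsxsxSSSSSSSS 16ssssxsssss 18xSSSxssssxsssxssxssxsxsxsxss 20SSSSSxsssss 22ssxsssxsssxsxSSSSSSSSSSSxSxSxSxsss 23SxSxSSxssssssxsxssssxssxsxssssxss 24ss 26xSSSSSxsssssssssssssssss 28SSSSxSSSSSxsss 27SSxSSxssssss 31sxssss 17xSxSSSxsssssxsxsxssxssssxsxsxSSSSSSSSSSS 33SSSSxSSxSxSSSxSSxSSxSxSxSSxSxssss 30SSxsssxssssssxssxsssss 19sssxssxssssxsxSSSSSSSSSSSxSxSxSSxssss 37sxssssxSSSSSSxSxSSSxSxSSSSxssss 39 21SSSSxSxSSSSxSSxSxSxssss 15SxSxsssssxsssxsxsxsssss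 40SSSxSSSxSSSxSSxSxSxSxSSSxssss 42SSxSSSxSSSSxSSSSSxSSSxSSxSxssss 5SSSSSSSSSSxSSSxSxSSSSxSxSSxsss 29 2 45SSSSxssss 36SSxSSSxSSSSSSxSSSxssss 47xsxssssxsxSSSSSSSxSSxSSSSxsss 43SSSSxsssssssssxsssxsxsxsxsxsxSSSSS 0SSSSSSxSxSSSSSxSxSSSxSxS 50SSSxsss 52sxssxsssxssxSSSSSSSSSxSxSxSxSSxSSxssss 54SSxsssssxssssxsssss 13SSxSxSxsssssxsxsssxsssxsxsssxssxSSSSSSSSSS 1 57 48 60xSxSSSxsssssssxsxsssxsxssssxss 3ssxsxsxSSSSSxSxSxSSxSSSSxSxss 53SSSSxsssss 9SSSSSSSSSSSSxSSSSSxssss 35xSSSxsssssssssssxss 56xSSSSxsssssssxsssxssxsxsssxsss 32SSSSxSSxssss 63xSSSSSSSxSxSSSSxSxSxssss 44SSxSxSSSSSxSSSxSxSSSSxSSxss 59xSxSSxSSxsssssssxsxsxsxssxsxssxsxSSSSSSSSSSS 7 46sssss 11xsxSSSSSSxSSSSSxSSxSxSSSxsss 61 41SSSSxSSSSSx 34SSSxSxssssssssxsssxsxsxsxsxsxss 65S 62SSSSxsss 38SSSSSSSSSSSSxSSSSxSSxssss 51SSSSxsssss 55 58xSSxSxSxSxssssssxsssssxssxsxSSSSSSSS 49SSSSxSxss 64SSxSSxssssssxssxsxssssssss" "aaaT ataTa"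
    "AATAATTattt"].

(** One evaluation by the virtual machine, carried out when the kernel checks the cast. *)
Lemma large_table_ok :
  forallb (fun e => cert_wf (fst e) && forallb (cert_kills (fst e)) (snd e)) large_table = true.
Proof. vm_cast_no_check (eq_refl true). Qed.

(** * Integral powers of words *)

Definition pw {X} (w : word X) (z : Z) : word X :=
  if 0 <=? z then concat (repeat w (Z.to_nat z))
  else concat (repeat (winv w) (Z.to_nat (- z))).

Lemma concat_repeat_comm {X} (w : word X) n : concat (repeat w n) ++ w = w ++ concat (repeat w n).
Proof. induction n as [|n IH]; simpl; [now rewrite app_nil_r|]. now rewrite <- app_assoc, IH. Qed.

Lemma pw_0 {X} (w : word X) : pw w 0 = [].
Proof. reflexivity. Qed.

Lemma pw_1 {X} (w : word X) : pw w 1 = w.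
Proof. apply app_nil_r. Qed.

Lemma pw_succ {X} (R : list (word X)) w z : peq R (pw w (Z.succ z)) (pw w z ++ w).
Proof.
  unfold pw. destruct (Z.leb_spec 0 z) as [Hz|Hz].
  - rewrite (proj2 (Z.leb_le 0 (Z.succ z))) by lia.
    replace (Z.to_nat (Z.succ z)) with (S (Z.to_nat z)) by lia.
    rewrite concat_repeat_comm. reflexivity.
  - destruct (Z.eq_dec z (-1)) as [->|N].
    + simpl. rewrite app_nil_r, peq_winv_l. reflexivity.
    + rewrite (proj2 (Z.leb_gt 0 (Z.succ z))) by lia.
      replace (Z.to_nat (- z)) with (S (Z.to_nat (- Z.succ z))) by lia.
      simpl. rewrite <- concat_repeat_comm, <- app_assoc, peq_winv_l, app_nil_r. reflexivity.
Qed.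

Lemma pw_pred {X} (R : list (word X)) w z : peq R (pw w (Z.pred z)) (pw w z ++ winv w).
Proof.
  rewrite <- (Z.succ_pred z) at 2. rewrite pw_succ, <- app_assoc, peq_winv_r, app_nil_r.
  reflexivity.
Qed.

Lemma pw_add {X} (R : list (word X)) w y z : peq R (pw w (y + z)) (pw w y ++ pw w z).
Proof.
  revert z. apply Z.peano_ind.
  - rewrite Z.add_0_r, pw_0, app_nil_r. reflexivity.
  - intros z IH. rewrite Z.add_succ_r, !pw_succ, IH, <- app_assoc. reflexivity.
  - intros z IH. rewrite Z.add_pred_r, !pw_pred, IH, <- app_assoc. reflexivity.
Qed.

Lemma pw_opp {X} (R : list (word X)) w z : peq R (pw w (- z)) (winv (pw w z)).
Proof.
  rewrite <- (app_nil_l (pw w (- z))), <- (peq_winv_l R (pw w z)), <- app_assoc, <- pw_add.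
  rewrite Z.add_opp_diag_r, pw_0, app_nil_r. reflexivity.
Qed.

Lemma pw_mul {X} (R : list (word X)) w y z : peq R (pw w (y * z)) (pw (pw w y) z).
Proof.
  revert z. apply Z.peano_ind.
  - rewrite Z.mul_0_r. reflexivity.
  - intros z IH. now rewrite Z.mul_succ_r, pw_succ, pw_add, IH.
  - intros z IH. now rewrite Z.mul_pred_r, pw_pred, <- IH, <- Z.add_opp_r, pw_add, pw_opp.
Qed.

Lemma pw_conj {X} (R : list (word X)) s w z :
  peq R (pw (s ++ w ++ winv s) z) (s ++ pw w z ++ winv s).
Proof.
  revert z. apply Z.peano_ind.
  - rewrite !pw_0. simpl. now rewrite peq_winv_r.
  - intros z IH. rewrite !pw_succ, IH, <- !app_assoc.
    rewrite (app_assoc (winv s) s), peq_winv_l. reflexivity.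
  - intros z IH. rewrite !pw_pred, IH, !winv_app, winv_involutive, <- !app_assoc.
    rewrite (app_assoc (winv s) s), peq_winv_l. reflexivity.
Qed.

Lemma pw_peq {X} (R : list (word X)) u v z : peq R u v -> peq R (pw u z) (pw v z).
Proof.
  intro H. revert z. apply Z.peano_ind.
  - reflexivity.
  - intros z IH. now rewrite !pw_succ, IH, H.
  - intros z IH. now rewrite !pw_pred, IH, H.
Qed.

(** * Groups all of whose finite quotients are metabelian *)

Definition comm {X} (u v : word X) : word X := u ++ v ++ winv u ++ winv v.

Record is_subgroup {X} (R : list (word X)) (L : word X -> Prop) : Prop := {
  subgroup_peq : forall u v, peq R u v -> L u -> L v;
  subgroup_nil : L [];
  subgroup_app : forall u v, L u -> L v -> L (u ++ v);
  subgroup_winv : forall u, L u -> L (winv u) }.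

Record is_normal {X} (R : list (word X)) (N : word X -> Prop) : Prop := {
  normal_subgroup : is_subgroup R N;
  normal_conj : forall x u, N u -> N (winv x ++ u ++ x) }.

(** This is what the arguments below retain of the finiteness of the quotient by [N]: all elements
    have finite order there. *)
Definition has_exponent {X} (N : word X -> Prop) (e : Z) : Prop := forall g, N (pw g e).

Lemma pigeonhole {A} (f : nat -> A) (l : list A) : (forall i, In (f i) l) ->
  exists i j, (i < j <= length l)%nat /\ f i = f j.
Proof.
  intro Hf. apply NNPP. intro H.
  assert (ND : forall n k, (k + n <= S (length l))%nat -> NoDup (map f (seq k n))).
  { induction n as [|n IH]; intros k Hk; simpl; constructor; [|apply IH; lia].
    rewrite in_map_iff. intros [j [E Hj]]. apply in_seq in Hj.
    apply H. exists k, j. split; [lia|congruence]. }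
  specialize (ND (S (length l)) 0%nat (le_n _)).
  apply NoDup_incl_length with (l' := l) in ND.
  - rewrite length_map, length_seq in ND. lia.
  - intros x Hx. apply in_map_iff in Hx as [i [<- _]]. apply Hf.
Qed.

Lemma fact_divide i n : (0 < i <= n)%nat -> (Z.of_nat i | Z.of_nat (fact n)).
Proof.
  intros [H0 H]. induction H as [|n H IH].
  - destruct i; [lia|]. exists (Z.of_nat (fact i)). simpl fact. lia.
  - destruct IH as [k IH]. exists (Z.of_nat (S n) * k). simpl fact. lia.
Qed.

(* N is the core of L; its exponent is the factorial of the index. *)
Lemma normal_core_of_finite_index {X K} (R : list (word X)) (L : word X -> Prop)
    (key : word X -> K) (l : list K) :
  is_subgroup R L -> (forall g, In (key g) l) ->
  (forall g h, key g = key h -> L (winv g ++ h)) ->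
  exists N e, is_normal R N /\ 0 < e /\ has_exponent N e /\ forall g, N g -> L g.
Proof.
  intros HL Hl Hk.
  assert (E : forall g, L (pw g (Z.of_nat (fact (length l))))).
  (* Two of the powers of [g] with exponents from 0 to [length l] lie in one coset, so [L] contains
     a power of [g] whose exponent divides the factorial. *)
  { intro g. destruct (pigeonhole (fun i => key (pw g (Z.of_nat i))) l) as (i & j & Hij & E).
    { intro; apply Hl. }
    apply Hk in E.
    destruct (fact_divide (j - i) (length l)) as [k Hd]; [lia|].
    rewrite Hd, Z.mul_comm. eapply (subgroup_peq _ _ HL); [symmetry; apply pw_mul|].
    assert (Lg : L (pw g (Z.of_nat (j - i)))).
    { eapply (subgroup_peq _ _ HL); [|exact E].
      rewrite <- pw_opp, <- pw_add.
      replace (- Z.of_nat i + Z.of_nat j) with (Z.of_nat (j - i)) by lia.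
      reflexivity. }
    clear -Lg HL. revert k. apply Z.peano_ind.
    - apply (subgroup_nil _ _ HL).
    - intros k IH. eapply (subgroup_peq _ _ HL); [symmetry; apply pw_succ|].
      now apply (subgroup_app _ _ HL).
    - intros k IH. eapply (subgroup_peq _ _ HL); [symmetry; apply pw_pred|].
      apply (subgroup_app _ _ HL); [exact IH | now apply (subgroup_winv _ _ HL)]. }
  exists (fun g => forall x, L (x ++ g ++ winv x)), (Z.of_nat (fact (length l))).
  repeat split.
  - intros u v H Hu x. eapply (subgroup_peq _ _ HL); [|apply (Hu x)]. now rewrite H.
  - intro x. eapply (subgroup_peq _ _ HL); [symmetry; apply peq_winv_r|].
    apply (subgroup_nil _ _ HL).
  - intros u v Hu Hv x.
    eapply (subgroup_peq _ _ HL); [|apply (subgroup_app _ _ HL _ _ (Hu x) (Hv x))].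
    rewrite <- !app_assoc, (app_assoc (winv x) x), peq_winv_l. reflexivity.
  - intros u Hu x. specialize (Hu x). apply (subgroup_winv _ _ HL) in Hu.
    rewrite !winv_app, winv_involutive, <- app_assoc in Hu. exact Hu.
  - intros x u Hu y. specialize (Hu (y ++ winv x)).
    rewrite winv_app, winv_involutive, <- !app_assoc in Hu. rewrite <- !app_assoc. exact Hu.
  - pose proof (lt_O_fact (length l)). lia.
  - intros g x. eapply (subgroup_peq _ _ HL); [apply pw_conj | apply E].
  - intros g Hg. specialize (Hg []). simpl in Hg. now rewrite app_nil_r in Hg.
Qed.

(* Two generators of the symmetric group of degree four, which is not metabelian. *)
Definition sym4 (b : bool) (e : bool) (i : nat) : nat :=
  match b, e, i with
  | true, true, 0 => 1 | true, true, 1 => 2 | true, true, 2 => 3 | true, true, 3 => 0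
  | true, false, 0 => 3 | true, false, 1 => 0 | true, false, 2 => 1 | true, false, 3 => 2
  | false, _, 0 => 1 | false, _, 1 => 0 | _, _, i => i
  end%nat.

Definition sym4_act (l : letter bool) : nat -> nat := sym4 (fst l) (snd l).

Definition mA : word bool := comm [(true, true)] [(false, true)].
Definition mB : word bool := comm [(true, true); (true, true)] [(false, true)].

(** The second derived subgroup of the symmetric group of degree 4 is the Klein four-group, which
    acts freely on the points; a non-trivial double commutator therefore moves 0, and a point
    stabilizer is enough to detect it. *)
Lemma sym4_not_metabelian : run bool nat sym4_act (comm mA mB) 0%nat <> 0%nat.
Proof. discriminate. Qed.

Lemma run_peq_nil {Y} (act : letter Y -> nat -> nat) (n : nat) :
  (forall l i, (i < n)%nat -> (act l i < n)%nat /\ act (inv_letter l) (act l i) = i) ->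
  forall u v, peq [] u v -> forall i, (i < n)%nat -> run Y nat act u i = run Y nat act v i.
Proof.
  intros H u v P i Hi.
  refine (proj1 (peq_same_labelled_action Y nat [] act (fun _ _ => []) (seq 0 n)
    _ _ _ _ _ u v P i _)).
  - intros l s Hs. apply in_seq in Hs. apply in_seq. destruct (H l s); lia.
  - intros l s Hs. apply in_seq in Hs. apply H. lia.
  - reflexivity.
  - intros ? ? [].
  - intros ? ? [].
  - apply in_seq. lia.
Qed.

(** Composing [phi] with an action on four points, let [L] be the preimage in [H] of the stabilizer
    of 0. It has finite index in the whole group, and its core [N] lies in [L]; if all double
    commutators were in [N], they would fix 0, against [sym4_not_metabelian]. *)
Lemma not_large_of_metabelian {X} (R : list (word X)) :
  (forall N e, is_normal R N -> 0 < e -> has_exponent N e ->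
     forall g1 g2 g3 g4, N (comm (comm g1 g2) (comm g3 g4))) ->
  ~ large R.
Proof.
  intros M (H & Hpeq & Hnil & Happ & Hinv & [cs Hcs] & Y & y1 & y2 & Hy & phi & P1 & P2 & P3).
  (* [Y] is an arbitrary type, so its generators are compared classically; those other than [y1],
     [y2] act trivially. *)
  pose (eq_dec := fun y z : Y => excluded_middle_informative (y = z)).
  pose (act := fun (l : letter Y) (i : nat) =>
    if eq_dec (fst l) y1 then sym4 true (snd l) i
    else if eq_dec (fst l) y2 then sym4 false (snd l) i else i).
  assert (Hact : forall l i, (i < 4)%nat ->
    (act l i < 4)%nat /\ act (inv_letter l) (act l i) = i).
  { intros [y b] i Hi. unfold act; simpl.
    assert (i = 0 \/ i = 1 \/ i = 2 \/ i = 3)%nat as Ei by lia.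
    destruct (eq_dec y y1); [|destruct (eq_dec y y2)];
      destruct b, Ei as [->|[->|[->| ->]]]; simpl; split; lia. }
  pose proof (run_peq_nil act 4 Hact) as Hrun.
  set (rn := run Y nat act) in *.
  assert (rn_lt : forall w i, (i < 4)%nat -> (rn w i < 4)%nat).
  { induction w as [|l w IH]; intros i Hi; [exact Hi|]. apply IH. now apply Hact. }
  assert (rn_app : forall u v i, rn (u ++ v) i = rn v (rn u i)) by apply run_app.
  assert (phi_nil : peq [] (phi []) []).
  { pose proof (P2 [] [] Hnil Hnil) as E. simpl in E.
    rewrite <- (app_nil_l (phi [])), <- (peq_winv_l [] (phi [])) at 1.
    rewrite <- app_assoc, <- E, peq_winv_l. reflexivity. }
  assert (phi_winv : forall u, H u -> peq [] (phi (winv u)) (winv (phi u))).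
  { intros u Hu. pose proof (P2 u (winv u) Hu (Hinv u Hu)) as E.
    rewrite (P1 (u ++ winv u) []), phi_nil in E;
      [|now apply Happ; auto | exact Hnil | apply peq_winv_r].
    rewrite <- (app_nil_l (phi (winv u))), <- (peq_winv_l [] (phi u)).
    rewrite <- app_assoc, <- E, app_nil_r. reflexivity. }
  pose (L := fun u => H u /\ rn (phi u) 0%nat = 0%nat).
  assert (HL : is_subgroup R L).
  { split.
    - intros u v E [Hu Lu]. assert (Hv : H v) by eauto. split; [exact Hv|].
      rewrite <- (Hrun _ _ (P1 u v Hu Hv E)); [exact Lu | lia].
    - split; [exact Hnil|]. rewrite (Hrun _ _ phi_nil); [reflexivity | lia].
    - intros u v [Hu Lu] [Hv Lv]. split; [now apply Happ|].
      rewrite (Hrun _ _ (P2 u v Hu Hv)), rn_app, Lu by lia. exact Lv.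
    - intros u [Hu Lu]. split; [now apply Hinv|].
      rewrite (Hrun _ _ (phi_winv u Hu)) by lia.
      rewrite <- Lu at 1. rewrite <- rn_app, (Hrun _ _ (peq_winv_r [] (phi u))) by lia.
      reflexivity. }
  pose (rep := fun g => proj1_sig (constructive_indefinite_description _ (Hcs g))).
  assert (Hrep : forall g, In (rep g) cs /\ H (winv (rep g) ++ g)).
  { intro g. exact (proj2_sig (constructive_indefinite_description _ (Hcs g))). }
  (* the left coset of g modulo L is determined by its coset modulo H and a point *)
  destruct (normal_core_of_finite_index R L
    (fun g => (rep g, rn (winv (phi (winv (rep g) ++ g))) 0%nat))
    (list_prod cs (seq 0 4)) HL) as (N & e & HN & He & HNe & NL).
  { intro g. apply in_prod; [apply Hrep|]. apply in_seq. split; [lia|]. simpl.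
    apply rn_lt. lia. }
  { intros g h E. injection E as Ec Ep.
    destruct (Hrep g) as [_ Hg], (Hrep h) as [_ Hh]. rewrite <- Ec in Hh, Ep.
    set (c := rep g) in *. set (u := winv c ++ g) in *. set (v := winv c ++ h) in *.
    apply (subgroup_peq _ _ HL (winv u ++ v)).
    { unfold u, v. rewrite winv_app, winv_involutive, <- !app_assoc.
      rewrite (app_assoc c), peq_winv_r. reflexivity. }
    assert (Hu' : H (winv u)) by now apply Hinv.
    split; [now apply Happ|].
    rewrite (Hrun _ _ (P2 _ _ Hu' Hh)), rn_app, (Hrun _ _ (phi_winv u Hg)) by lia.
    rewrite Ep, <- rn_app, (Hrun _ _ (peq_winv_l [] (phi v))) by lia. reflexivity. }
  pose (emb := fun w : word bool =>
    map (fun l : letter bool => (if fst l then y1 else y2, snd l)) w : word Y).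
  assert (rn_emb : forall w i, rn (emb w) i = run bool nat sym4_act w i).
  { induction w as [|[b s] w IH]; intro i; [reflexivity|].
    unfold rn, emb in *. simpl. rewrite IH. f_equal. unfold act, sym4_act; simpl.
    destruct b.
    - destruct (eq_dec y1 y1); [reflexivity | congruence].
    - destruct (eq_dec y2 y1); [congruence|].
      destruct (eq_dec y2 y2); [reflexivity | congruence]. }
  assert (phi_comm : forall u v, H u -> H v ->
    H (comm u v) /\ peq [] (phi (comm u v)) (comm (phi u) (phi v))).
  { intros u v Hu Hv. unfold comm.
    assert (Hu' := Hinv u Hu). assert (Hv' := Hinv v Hv).
    rewrite !P2, !phi_winv by auto. split; [auto 6 | reflexivity]. }
  destruct (P3 (emb [(true, true)])) as [a [Ha Ea]].
  destruct (P3 (emb [(false, true)])) as [b [Hb Eb]].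
  destruct (P3 (emb [(true, true); (true, true)])) as [c [Hc Ec]].
  pose proof (M N e HN He HNe a b c b) as Z. apply NL in Z. destruct Z as [_ Z].
  destruct (phi_comm a b Ha Hb) as [H1 E1], (phi_comm c b Hc Hb) as [H2 E2].
  destruct (phi_comm _ _ H1 H2) as [_ E3].
  assert (E4 : peq [] (phi (comm (comm a b) (comm c b))) (emb (comm mA mB))).
  { rewrite E3. unfold comm in E1, E2 |- *. rewrite E1, E2, Ea, Eb, Ec. reflexivity. }
  rewrite (Hrun _ _ E4), rn_emb in Z by lia. now apply sym4_not_metabelian.
Qed.

(** * Finite quotients of Baumslag-Solitar type *)

Lemma divide_gcd_one a b g : Z.gcd a b = 1 -> (g | a) -> (g | b) -> (g | 1).
Proof. intros E Ha Hb. rewrite <- E. now apply Z.gcd_greatest. Qed.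

Lemma least_positive (P : Z -> Prop) e : 0 < e -> P e ->
  exists n, 0 < n /\ P n /\ forall k, 0 < k < n -> ~ P k.
Proof.
  intro He. assert (He' : 0 <= e) by lia. revert He. pattern e.
  apply Zlt_0_ind; [|exact He']. clear e He'. intros e IH _ He Pe.
  destruct (classic (exists k, 0 < k < e /\ P k)) as [(k & Hk & Pk)|N].
  - apply (IH k); auto; lia.
  - exists e. repeat split; auto. intros k Hk Pk. apply N. eauto.
Qed.

(** Powers of a unit avoid the residue 0, so the [n] exponents from 0 to [n - 1] share [n - 1]
    residues. This gives the strict bound [o < n] on which the descent below rests. *)
Lemma unit_power_one n u : 1 < n -> Z.gcd u n = 1 ->
  exists o, 0 < o < n /\ (n | u ^ o - 1).
Proof.
  intros Hn Hu.
  assert (G : forall i, Z.gcd (u ^ Z.of_nat i) n = 1).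
  { induction i as [|i IH]; [apply Z.gcd_1_l|].
    rewrite Nat2Z.inj_succ, Z.pow_succ_r by lia.
    apply Zgcd_1_rel_prime. apply Zgcd_1_rel_prime in Hu, IH.
    apply rel_prime_sym, rel_prime_mult; now apply rel_prime_sym. }
  destruct (pigeonhole (fun i => Z.to_nat (u ^ Z.of_nat i mod n)) (seq 1 (Z.to_nat n - 1)))
    as (i & j & Hij & E).
  { intro i. pose proof (Z.mod_pos_bound (u ^ Z.of_nat i) n ltac:(lia)) as B.
    assert (u ^ Z.of_nat i mod n <> 0).
    { intro E. apply Z.mod_divide in E; [|lia].
      pose proof (divide_gcd_one _ _ n (G i) E (Z.divide_refl n)) as D.
      apply Z.divide_pos_le in D; lia. }
    apply in_seq. lia. }
  rewrite length_seq in Hij.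
  apply Z2Nat.inj in E; try (apply Z.mod_pos_bound; lia).
  exists (Z.of_nat (j - i)). split; [lia|].
  apply Gauss with (u ^ Z.of_nat i).
  - replace (u ^ Z.of_nat i * (u ^ Z.of_nat (j - i) - 1)) with (u ^ Z.of_nat j - u ^ Z.of_nat i).
    + apply Z.mod_divide; [lia|]. rewrite Zminus_mod, E, Z.sub_diag. apply Zmod_0_l.
    + rewrite Z.mul_sub_distr_l, <- Z.pow_add_r by lia. f_equal; [f_equal; lia | lia].
  - apply rel_prime_sym, Zgcd_1_rel_prime, G.
Qed.

(* For u = 2 this says that n does not divide 2^n - 1 unless n = 1; the proof descends
   from n to the multiplicative order of u modulo n. *)
Lemma divide_power_minus_one n u :
  0 < n -> (n | u ^ n - 1) -> Z.gcd (u - 1) n = 1 -> n = 1.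
Proof.
  intro Hn. assert (Hn' : 0 <= n) by lia. revert Hn. pattern n.
  apply Zlt_0_ind; [|exact Hn']. clear n Hn'. intros n IH _ Hn D G.
  destruct (Z.eq_dec n 1) as [|N]; [assumption|]. exfalso.
  assert (Gu : Z.gcd u n = 1).
  { apply Zgcd_1_rel_prime, bezout_rel_prime. destruct D as [k D].
    apply Bezout_intro with (u ^ (n - 1)) (- k).
    rewrite Z.mul_comm, <- Z.pow_succ_r by lia. replace (Z.succ (n - 1)) with n by lia. lia. }
  destruct (unit_power_one n u ltac:(lia) Gu) as (o' & Ho' & Do').
  destruct (least_positive (fun o => (n | u ^ o - 1)) o' ltac:(lia) Do') as (o & Ho & Do & Lo).
  assert (o < n).
  { destruct (Z.lt_ge_cases o' o); [|lia]. exfalso. apply (Lo o'); [lia|assumption]. }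
  assert (on : (o | n)).
  { apply Z.mod_divide; [lia|].
    pose proof (Z.mod_pos_bound n o Ho) as B.
    destruct (Z.eq_dec (n mod o) 0) as [|E]; [assumption|]. exfalso.
    apply (Lo (n mod o)); [lia|].
    pose proof (Z.div_mod n o ltac:(lia)) as En.
    assert (0 <= n / o) by (apply Z.div_pos; lia).
    assert (Dq : (n | (u ^ o) ^ (n / o) - 1)).
    { apply Z.mod_divide; [lia|]. apply Z.mod_divide in Do; [|lia].
      assert (Eo : u ^ o mod n = 1 mod n).
      { replace (u ^ o) with (u ^ o - 1 + 1) by lia.
        rewrite Zplus_mod, Do, Z.add_0_l. apply Zmod_mod. }
      rewrite Zminus_mod, Zpower_mod, Eo, <- Zpower_mod, Z.pow_1_l by lia.
      rewrite Z.sub_diag. apply Zmod_0_l. }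
    assert (Eu : u ^ n = (u ^ o) ^ (n / o) * u ^ (n mod o))
      by now rewrite <- Z.pow_mul_r, <- Z.pow_add_r, <- En by lia.
    rewrite Eu in D.
    replace (u ^ (n mod o) - 1) with
      ((u ^ o) ^ (n / o) * u ^ (n mod o) - 1 - ((u ^ o) ^ (n / o) - 1) * u ^ (n mod o)) by ring.
    apply Z.divide_sub_r; [exact D | now apply Z.divide_mul_l]. }
  (* [o] divides [n] and [n] divides [u ^ o - 1], so the induction hypothesis applies to [o]. Then
     [n] divides [u - 1], to which it is coprime. *)
  assert (o = 1).
  { apply IH; [lia|lia| |].
    - now apply Z.divide_trans with n.
    - apply Zgcd_1_rel_prime. apply Zgcd_1_rel_prime in G.
      apply rel_prime_sym. apply rel_prime_div with n; [now apply rel_prime_sym | assumption]. }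
  subst o. rewrite Z.pow_1_r in Do.
  pose proof (divide_gcd_one _ _ n G Do (Z.divide_refl n)) as D1.
  apply Z.divide_pos_le in D1; lia.
Qed.

(** * Calculation modulo a normal subgroup of finite exponent *)

Section Quotient.

Variables (X : Type) (R : list (word X)) (N : word X -> Prop) (e : Z).
Hypothesis HN : is_normal R N.
Hypothesis e_pos : 0 < e.
Hypothesis HNe : has_exponent N e.

Definition eqn (u v : word X) : Prop := N (winv u ++ v).

Let HS := normal_subgroup R N HN.

Lemma eqn_peq u v : peq R u v -> eqn u v.
Proof.
  intro H. apply (subgroup_peq _ _ HS []); [|apply (subgroup_nil _ _ HS)].
  rewrite H. symmetry. apply peq_winv_l.
Qed.

Local Instance eqn_equivalence : Equivalence eqn.
Proof.
  split.
  - intro u. now apply eqn_peq.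
  - intros u v H. apply (subgroup_winv _ _ HS) in H.
    rewrite winv_app, winv_involutive in H. exact H.
  - intros u v w H1 H2. apply (subgroup_peq _ _ HS ((winv u ++ v) ++ winv v ++ w)).
    + rewrite <- app_assoc, (app_assoc v), peq_winv_r. reflexivity.
    + now apply (subgroup_app _ _ HS).
Qed.

Local Instance eqn_app : Proper (eqn ==> eqn ==> eqn) (@app (letter X)).
Proof.
  intros u u' Hu v v' Hv.
  apply (subgroup_peq _ _ HS ((winv v ++ (winv u ++ u') ++ v) ++ winv v ++ v')).
  - rewrite winv_app, <- !app_assoc, (app_assoc v), peq_winv_r. reflexivity.
  - apply (subgroup_app _ _ HS); [now apply (normal_conj _ _ HN) | exact Hv].
Qed.

Local Instance eqn_winv : Proper (eqn ==> eqn) (@winv X).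
Proof.
  intros u v H. symmetry in H. unfold eqn in *.
  apply (normal_conj _ _ HN (winv v)) in H. rewrite winv_involutive in *.
  eapply (subgroup_peq _ _ HS); [|exact H].
  rewrite <- app_assoc, (app_assoc v), peq_winv_r. reflexivity.
Qed.

Local Instance peq_subrelation_eqn : subrelation (peq R) eqn.
Proof. intros u v. apply eqn_peq. Qed.

Lemma eqn_nil_iff u : N u <-> eqn u [].
Proof.
  unfold eqn. rewrite app_nil_r. split; intro H; apply (subgroup_winv _ _ HS) in H.
  - exact H.
  - now rewrite winv_involutive in H.
Qed.

Local Instance eqn_pw : Proper (eqn ==> eq ==> eqn) (@pw X).
Proof.
  intros u v H z _ <-. revert z. apply Z.peano_ind.
  - reflexivity.
  - intros z IH. now rewrite !(pw_succ R), IH, H.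
  - intros z IH. now rewrite !(pw_pred R), IH, H.
Qed.

Lemma pw_nil z : eqn (pw [] z) [].
Proof.
  revert z. apply Z.peano_ind; [reflexivity| |];
    intros z IH; [rewrite (pw_succ R) | rewrite (pw_pred R)]; now rewrite IH.
Qed.

Lemma order_exists (c : word X) :
  exists n, 0 < n /\ forall k, eqn (pw c k) [] <-> (n | k).
Proof.
  destruct (least_positive (fun k => eqn (pw c k) []) e e_pos) as (n & Hn & Pn & Ln).
  { apply (proj1 (eqn_nil_iff _)), HNe. }
  exists n. split; [exact Hn|].
  assert (M : forall q, eqn (pw c (n * q)) []).
  { intro q. rewrite (pw_mul R), Pn. apply pw_nil. }
  intro k. split.
  - intro Pk. apply Z.mod_divide; [lia|].
    pose proof (Z.mod_pos_bound k n Hn) as B.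
    destruct (Z.eq_dec (k mod n) 0) as [|E]; [assumption|]. exfalso.
    apply (Ln (k mod n)); [lia|].
    rewrite (Z.div_mod k n), (pw_add R), M in Pk by lia. exact Pk.
  - intros [q ->]. now rewrite Z.mul_comm.
Qed.

Lemma eqn_conj_pw s c p q : eqn (s ++ pw c p ++ winv s) (pw c q) ->
  forall k, eqn (s ++ pw c (p * k) ++ winv s) (pw c (q * k)).
Proof. intros H k. now rewrite !(pw_mul R), <- (pw_conj R), H. Qed.

Lemma eqn_move s u v : eqn (s ++ u ++ winv s) v <-> eqn u (winv s ++ v ++ s).
Proof.
  split; intro H.
  - rewrite <- H, <- !app_assoc, (app_assoc (winv s) s), !(peq_winv_l R), app_nil_r. reflexivity.
  - rewrite H, <- !app_assoc, (app_assoc s (winv s)), !(peq_winv_r R), app_nil_r. reflexivity.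
Qed.

(** Write [n = m g]. The power [m] kills [c^p], as [g] divides [p], hence it kills the conjugate
    [c^q]; so [m g] divides [q m]. *)
Lemma order_divisor_transfer s c p q n g :
  0 < n -> (forall k, eqn (pw c k) [] <-> (n | k)) ->
  eqn (s ++ pw c p ++ winv s) (pw c q) -> (g | n) -> (g | p) -> (g | q).
Proof.
  intros Hn On H [m ->] [p' ->].
  assert (g <> 0) by (intros ->; lia). assert (m <> 0) by (intros ->; lia).
  assert (D : (m * g | q * m)).
  { apply On. rewrite <- (eqn_conj_pw _ _ _ _ H m).
    assert (E : eqn (pw c (p' * g * m)) []) by (apply On; exists p'; lia).
    rewrite E. simpl. apply eqn_peq, peq_winv_r. }
  destruct D as [k D]. exists k. apply (Z.mul_reg_r _ _ m); lia.
Qed.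

Lemma coprime_to_order s c p q n :
  0 < n -> (forall k, eqn (pw c k) [] <-> (n | k)) -> Z.gcd p q = 1 ->
  eqn (s ++ pw c p ++ winv s) (pw c q) -> Z.gcd p n = 1.
Proof.
  intros Hn On G H.
  pose proof (Z.gcd_divide_l p n) as D1. pose proof (Z.gcd_divide_r p n) as D2.
  pose proof (order_divisor_transfer s c p q n _ Hn On H D2 D1) as D3.
  pose proof (divide_gcd_one _ _ _ G D1 D3) as D.
  apply Z.divide_1_r_nonneg in D; [exact D | apply Z.gcd_nonneg].
Qed.

(** Since [p] is invertible modulo the order of [c], the element [c] is itself a power of [c^p],
    whose conjugate is known. *)
Lemma conj_generator s c p q : Z.gcd p q = 1 ->
  eqn (s ++ pw c p ++ winv s) (pw c q) -> exists k, eqn (s ++ c ++ winv s) (pw c k).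
Proof.
  intros G H. destruct (order_exists c) as (n & Hn & On).
  pose proof (coprime_to_order s c p q n Hn On G H) as Gp.
  destruct (Z.gcd_bezout p n 1 Gp) as (u & v & B).
  exists (q * u). rewrite <- (eqn_conj_pw _ _ _ _ H u).
  assert (E : eqn (pw c (p * u)) c).
  { rewrite <- (pw_1 c) at 2. rewrite <- B, (pw_add R), (Z.mul_comm u).
    assert (E : eqn (pw c (v * n)) []) by (apply On; now exists v).
    now rewrite E, app_nil_r. }
  now rewrite E.
Qed.

Lemma conj_generator_inv s c p q : Z.gcd p q = 1 ->
  eqn (s ++ pw c p ++ winv s) (pw c q) -> exists k, eqn (winv s ++ c ++ s) (pw c k).
Proof.
  intros G H. pose proof (conj_generator (winv s) c q p) as C.
  rewrite winv_involutive in C. apply C; [now rewrite Z.gcd_comm|].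
  symmetry. now apply eqn_move.
Qed.

(** Powers of [c] are moved past [s^k] one letter at a time; conjugation in one direction serves
    positive [k], the other negative [k]. *)
Lemma conj_power s c : (exists k, eqn (s ++ c ++ winv s) (pw c k)) ->
  (exists k, eqn (winv s ++ c ++ s) (pw c k)) ->
  forall k y, exists z, eqn (pw c y ++ pw s k) (pw s k ++ pw c z).
Proof.
  intros [k1 H1] [k2 H2] k. revert k. refine (Z.peano_ind _ _ _ _).
  - intro y. exists y. now rewrite !pw_0, app_nil_r.
  - intros k IH y. destruct (IH y) as [z E].
    exists (k2 * z). rewrite !(pw_succ R), app_assoc, E, <- !app_assoc.
    assert (E2 : eqn (pw c (k2 * z)) (winv s ++ pw c z ++ s)).
    { rewrite (pw_mul R), <- H2.
      pose proof (pw_conj R (winv s) c z) as C. rewrite winv_involutive in C.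
      now apply eqn_peq. }
    now rewrite E2, (app_assoc s), (peq_winv_r R).
  - intros k IH y. destruct (IH y) as [z E].
    exists (k1 * z). rewrite !(pw_pred R), app_assoc, E, <- !app_assoc.
    assert (E1 : eqn (pw c (k1 * z)) (s ++ pw c z ++ winv s)).
    { rewrite (pw_mul R), <- H1. apply eqn_peq, pw_conj. }
    now rewrite E1, (app_assoc (winv s)), (peq_winv_l R).
Qed.

(** Every element has the form [s^k c^z], and the exponents of [s] add up under multiplication.
    Hence [g h] and [h g] have forms with the same exponent of [s], commutators are powers of [c],
    and these commute. *)
Lemma metabelian_of_cyclic_by_cyclic s c :
  (exists k, eqn (s ++ c ++ winv s) (pw c k)) ->
  (exists k, eqn (winv s ++ c ++ s) (pw c k)) ->
  (forall l, exists k z, eqn [l] (pw s k ++ pw c z)) ->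
  forall g1 g2 g3 g4, N (comm (comm g1 g2) (comm g3 g4)).
Proof.
  intros H1 H2 Hl. pose proof (conj_power s c H1 H2) as C.
  assert (M : forall k1 z1 k2 z2, exists z,
    eqn ((pw s k1 ++ pw c z1) ++ pw s k2 ++ pw c z2) (pw s (k1 + k2) ++ pw c z)).
  { intros k1 z1 k2 z2. destruct (C k2 z1) as [z E]. exists (z + z2).
    rewrite <- app_assoc, (app_assoc (pw c z1)), E, !(pw_add R), <- !app_assoc. reflexivity. }
  assert (W : forall g, exists k z, eqn g (pw s k ++ pw c z)).
  { induction g as [|l g (k2 & z2 & E2)]; [exists 0, 0; reflexivity|].
    destruct (Hl l) as (k1 & z1 & E1). destruct (M k1 z1 k2 z2) as [z E].
    exists (k1 + k2), z. change (l :: g) with ([l] ++ g). now rewrite E1, E2. }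
  assert (D : forall g h, exists z, eqn (comm g h) (pw c z)).
  { intros g h. destruct (W g) as (k1 & z1 & E1), (W h) as (k2 & z2 & E2).
    destruct (M k1 z1 k2 z2) as [x Ex], (M k2 z2 k1 z1) as [y Ey].
    rewrite <- E1, <- E2 in Ex, Ey. rewrite (Z.add_comm k2) in Ey.
    (* From [g h = s^K c^x] and [h g = s^K c^y] the commutator is [s^K c^(x-y) s^-K]. *)
    set (K := k1 + k2) in *. destruct (C (- K) (x - y)) as [z E]. exists z.
    assert (E3 : eqn (comm g h) ((g ++ h) ++ winv (h ++ g)))
      by (unfold comm; now rewrite winv_app, <- app_assoc).
    rewrite E3, Ex, Ey, winv_app, <- !app_assoc, <- !(pw_opp R).
    rewrite (app_assoc (pw c x)), <- (pw_add R), Z.add_opp_r, E, app_assoc, <- (pw_add R).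
    now rewrite Z.add_opp_diag_r. }
  intros g1 g2 g3 g4. apply eqn_nil_iff.
  destruct (D g1 g2) as [x Ex], (D g3 g4) as [y Ey]. unfold comm at 1. rewrite Ex, Ey.
  rewrite <- !(pw_opp R), <- !(pw_add R).
  now replace (x + (y + (- x + - y))) with 0 by lia.
Qed.

(** Let [n] be the order of [y]. Conjugation by [x^k] raises [y] to the power [w = j / i] modulo
    [n]. Since [x^n] is trivial too, [n] rounds of it yield that [n] divides [w^n - 1]. As
    [i (w - 1)] is [j - i = 1] or [-1] modulo [n], the number [w - 1] is a unit, and
    [divide_power_minus_one] gives [n = 1]. *)
Lemma trivial_of_conj_power x y k i j :
  (j - i = 1 \/ j - i = -1) ->
  (forall z, eqn (pw y z) [] -> eqn (pw x z) []) ->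
  eqn (pw x k ++ pw y i ++ winv (pw x k)) (pw y j) -> eqn y [].
Proof.
  intros Hij Hxy H. destruct (order_exists y) as (n & Hn & On).
  assert (G : Z.gcd i j = 1).
  { apply Zgcd_1_rel_prime, bezout_rel_prime.
    destruct Hij; [apply Bezout_intro with (-1) 1 | apply Bezout_intro with 1 (-1)]; lia. }
  pose proof (coprime_to_order _ _ _ _ n Hn On G H) as Gi.
  destruct (Z.gcd_bezout i n 1 Gi) as (u & v & B).
  set (w := j * u).
  assert (E : forall z, eqn (pw x k ++ pw y z ++ winv (pw x k)) (pw y (w * z))).
  { intro z. replace (w * z) with (j * (u * z)) by (unfold w; lia).
    rewrite <- (eqn_conj_pw _ _ _ _ H (u * z)).
    replace (i * (u * z)) with ((u * i + v * n) * z + n * (- v * z)) by ring.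
    rewrite B, Z.mul_1_l.
    rewrite (pw_add R).
    assert (E : eqn (pw y (n * (- v * z))) []) by (apply On; exists (- v * z); lia).
    now rewrite E, app_nil_r. }
  assert (En : forall m, eqn (pw x (k * Z.of_nat m) ++ y ++ winv (pw x (k * Z.of_nat m)))
    (pw y (w ^ Z.of_nat m))).
  { induction m as [|m IH].
    - rewrite Z.mul_0_r, pw_0, Z.pow_0_r, pw_1. simpl. now rewrite app_nil_r.
    - rewrite Nat2Z.inj_succ, Z.pow_succ_r, Z.mul_succ_r, Z.add_comm by lia.
      rewrite (pw_add R), winv_app, <- E, <- IH, <- !app_assoc. reflexivity. }
  specialize (En (Z.to_nat n)). rewrite Z2Nat.id in En by lia.
  assert (Xn : eqn (pw x (k * n)) []) by (apply Hxy, On; now exists k).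
  rewrite Xn in En. simpl in En. rewrite app_nil_r in En.
  assert (n = 1) as ->.
  { apply divide_power_minus_one with w; [exact Hn| |].
    - apply On. rewrite <- Z.add_opp_r, (pw_add R), <- En, <- (pw_1 y) at 1.
      rewrite <- (pw_add R). reflexivity.
    - apply Zgcd_1_rel_prime, bezout_rel_prime. unfold w.
      assert (Ev : v * n = 1 - u * i) by lia.
      (* Modulo [n] the inverse of [w - 1] is [i] or [- i], according to the sign of [j - i]; the
         other coefficient follows from [v n = 1 - u i]. *)
      destruct Hij.
      + apply Bezout_intro with i (v + i * v).
        replace ((v + i * v) * n) with ((1 + i) * (v * n)) by ring.
        rewrite Ev. replace j with (i + 1) by lia. ring.
      + apply Bezout_intro with (- i) (v - i * v).
        replace ((v - i * v) * n) with ((1 - i) * (v * n)) by ring.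
        rewrite Ev. replace j with (i - 1) by lia. ring. }
  rewrite <- (pw_1 y). now apply On.
Qed.

Lemma eqn_conj_nil s x y : peq R x (s ++ y ++ winv s) -> eqn y [] -> eqn x [].
Proof. intros H E. rewrite H, E. apply eqn_peq, peq_winv_r. Qed.

Lemma eqn_pw_conj_nil s x y z :
  peq R x (s ++ y ++ winv s) -> eqn (pw y z) [] -> eqn (pw x z) [].
Proof.
  intros H E. rewrite (eqn_peq _ _ H : eqn _ _), (pw_conj R), E. apply eqn_peq, peq_winv_r.
Qed.

Lemma conj_trivial s c : eqn c [] -> eqn (s ++ c ++ winv s) (pw c 0).
Proof. intro E. rewrite E. apply eqn_peq, peq_winv_r. Qed.

End Quotient.

(** * Criteria for non-largeness of one-relator groups *)

Local Notation wa := [(ga, true)].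
Local Notation wt := [(gt, true)].

Lemma not_large_solitar (R : list (word gen)) (c : word gen) (p q z : Z) :
  Z.gcd p q = 1 -> peq R wa (pw c z) -> peq R (wt ++ pw c p ++ winv wt) (pw c q) -> ~ large R.
Proof.
  intros G Ha Ht. apply not_large_of_metabelian. intros N e HN He HNe.
  pose proof (eqn_peq _ R N HN _ _ Ht) as E.
  apply (metabelian_of_cyclic_by_cyclic _ R N HN wt c).
  - exact (conj_generator _ R N e HN He HNe wt c p q G E).
  - exact (conj_generator_inv _ R N e HN He HNe wt c p q G E).
  - intros [[] b].
    + exists 0, (if b then z else - z). apply (eqn_peq _ R N HN). rewrite pw_0. simpl.
      destruct b; [exact Ha|]. rewrite pw_opp, <- Ha. reflexivity.
    + exists (if b then 1 else -1), 0. apply (eqn_peq _ R N HN). destruct b; reflexivity.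
Qed.

(** The relator yields the conjugate of a power of [a], not of [c]; as [a^e = c^(z e)], this is a
    Baumslag-Solitar relation for [c]. The next lemma treats a power of [a] on the other side. *)
Lemma not_large_solitar_l (R : list (word gen)) (c : word gen) (e q z : Z) :
  Z.gcd (z * e) q = 1 -> peq R wa (pw c z) ->
  peq R (wt ++ pw wa e ++ winv wt) (pw c q) -> ~ large R.
Proof.
  intros G Ha Ht. apply (not_large_solitar R c (z * e) q z G Ha).
  rewrite <- Ht, pw_mul. now rewrite <- (pw_peq R _ _ e Ha).
Qed.

Lemma not_large_solitar_r (R : list (word gen)) (c : word gen) (p f z : Z) :
  Z.gcd p (z * f) = 1 -> peq R wa (pw c z) ->
  peq R (wt ++ pw c p ++ winv wt) (pw wa f) -> ~ large R.
Proof.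
  intros G Ha Ht. apply (not_large_solitar R c p (z * f) z G Ha).
  now rewrite Ht, pw_mul, (pw_peq R _ _ f Ha).
Qed.

(** Being conjugate, [x] and [y] both become trivial in the quotient, and one of them is [a]. What
    remains is cyclic, generated by [t], which is the cyclic-by-cyclic case with trivial normal
    part. *)
Lemma not_large_of_conj_power (R : list (word gen)) (x y s : word gen) (k i j : Z) :
  x = wa \/ y = wa -> j - i = 1 \/ j - i = -1 -> peq R x (s ++ y ++ winv s) ->
  peq R (pw x k ++ pw y i ++ winv (pw x k)) (pw y j) -> ~ large R.
Proof.
  intros Hxy Hij Hs H. apply not_large_of_metabelian. intros N e HN He HNe.
  assert (Ey : eqn _ N y []).
  { apply (trivial_of_conj_power _ R N e HN He HNe x y k i j Hij).
    - intro z. now apply (eqn_pw_conj_nil _ R N HN s).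
    - now apply (eqn_peq _ R N HN). }
  assert (Ea : eqn _ N wa []).
  { destruct Hxy as [<-|<-]; [|exact Ey]. now apply (eqn_conj_nil _ R N HN s x y). }
  apply (metabelian_of_cyclic_by_cyclic _ R N HN wt wa).
  - exists 0. now apply (conj_trivial _ R N HN).
  - exists 0. now apply (conj_trivial _ R N HN (winv wt)).
  - intros [[] b].
    + exists 0, (if b then 1 else -1). apply (eqn_peq _ R N HN). destruct b; reflexivity.
    + exists (if b then 1 else -1), 0. apply (eqn_peq _ R N HN). destruct b; reflexivity.
Qed.

(** * The thirteen exceptional words *)

Fixpoint freduce (w : word gen) : word gen :=
  match w with
  | [] => []
  | l :: w =>
    match freduce w with
    | [] => [l]
    | k :: v => if letter_eqb gen gen_eqb k (inv_letter l) then v else l :: k :: v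
    end
  end.

Lemma peq_freduce R w : peq R w (freduce w).
Proof.
  induction w as [|l w IH]; simpl; [reflexivity|].
  change (l :: w) with ([l] ++ w). rewrite IH at 1.
  destruct (freduce w) as [|k v]; [reflexivity|].
  destruct (letter_eqb gen gen_eqb k (inv_letter l)) eqn:E; [|reflexivity].
  apply (letter_eqb_eq gen gen_eqb gen_eqb_eq) in E. subst k.
  change ([l] ++ inv_letter l :: v) with ([l; inv_letter l] ++ v).
  now rewrite peq_cancel.
Qed.

Lemma peq_of_freduce R u v : freduce u = freduce v -> peq R u v.
Proof. intro E. rewrite (peq_freduce R u), E. symmetry. apply peq_freduce. Qed.

(** An equation obtained by deleting one copy of the relator is certified by the context [u1], [u2]
    of that copy; free reduction does the rest by computation. *)
Lemma peq_remove_relator (r u1 u2 u v : word gen) :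
  freduce u = freduce (u1 ++ r ++ u2) -> freduce v = freduce (u1 ++ u2) -> peq [r] u v.
Proof.
  intros Hu Hv. rewrite (peq_freduce _ u), Hu, <- peq_freduce.
  rewrite (peq_freduce _ v), Hv, <- peq_freduce.
  exact (peq_context [r] u1 u2 r [] (peq_relator [r] r (or_introl eq_refl))).
Qed.

Local Notation wb := (wt ++ wa ++ winv wt).

Tactic Notation "remove_relator" constr(u1) constr(u2) :=
  apply (peq_remove_relator _ u1 u2); vm_compute; reflexivity.

Ltac free := now apply peq_of_freduce.

(** With [b = t a t^-1] each relator is a word in [a] and [b]. Six of them conjugate a power of one
    of these letters to a power of it. In the other seven, a subword occurring twice is named [c] or
    [d]; the relator then makes one of [a], [b] a power of it, and the remaining letters follow. *)
Lemma w13_not_large w : In w w13 -> ~ large [w].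
Proof.
  pose (o := @nil (letter gen)).
  unfold w13. intro H. repeat destruct H as [<-|H]; [..|destruct H].
  (* The relator [b^2 a b a] is [b c^2], so [b = c^-2] and [a = b^-1 c = c^3]. *)
  - pose (c := wb ++ wa). apply (not_large_solitar_l _ c 1 (-2) 3); [reflexivity| |].
    + symmetry. remove_relator (wa ++ winv c) c.
    + remove_relator o (pw c (-2)).
  - apply (not_large_of_conj_power _ wa wb (winv wt) 1 1 2); [now left|now left|free|].
    symmetry. remove_relator o (wa ++ wb ++ winv wa).
  (* Up to rotation [b^2 a^-1 b a^-1] is [c^2 b], so [b = c^-2] and [a = b c^-1 = c^-3]. *)
  - pose (c := winv wa ++ wb). apply (not_large_solitar_l _ c 1 (-2) (-3)); [reflexivity| |].
    + remove_relator (winv c ++ winv wa) (wa ++ pw c (-2)).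
    + remove_relator (winv c ++ winv wa) (wa ++ winv c).
  (* The relator [b^2 a^2 b^2 a] is [c a c], so [a = c^-2] and [b^2 = c a^-1 = c^3]. *)
  - pose (c := pw wb 2 ++ wa). apply (not_large_solitar_l _ c 2 3 (-2)); [reflexivity| |].
    + remove_relator (winv c) (winv c).
    + symmetry. remove_relator (pw wb 2 ++ winv c) c.
  (* Here [d = b a^2] and the relator is [b d^2], so [b = d^-2] and [a^2 = d^3]. Conjugating by [t]
     turns the first into [a = c^-2], while the second says [t c^3 t^-1 = a^2]. *)
  - pose (c := wa ++ winv wt ++ pw wa 2 ++ wt). pose (d := wt ++ c ++ winv wt).
    apply (not_large_solitar_r _ c 3 2 (-2)); [reflexivity| |].
    + remove_relator (winv wt) (pw d (-2) ++ wt).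
    + remove_relator (pw wa 2 ++ winv d) d.
  - apply (not_large_of_conj_power _ wa wb (winv wt) 2 1 2); [now left|now left|free|].
    symmetry. remove_relator o (pw wa 2 ++ wb ++ pw wa (-2)).
  - apply (not_large_of_conj_power _ wb wa wt 2 2 1); [now right|now right|free|].
    remove_relator o wa.
  - apply (not_large_of_conj_power _ wb wa wt 2 1 2); [now right|now left|free|].
    remove_relator o (pw wa 2).
  (* The relator is [c^2 a^-1], so [a = c^2] and [b^2 = c a = c^3]. *)
  - pose (c := pw wb 2 ++ winv wa). apply (not_large_solitar_l _ c 2 3 2); [reflexivity| |].
    + symmetry. remove_relator o wa.
    + symmetry. remove_relator c wa.
  (* As for the fifth word, with [d = b a^-2]: the relator is [b d^2], whence [a = c^-2] and
     [t c^3 t^-1 = a^-2]. *)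
  - pose (c := wa ++ winv wt ++ pw wa (-2) ++ wt). pose (d := wt ++ c ++ winv wt).
    apply (not_large_solitar_r _ c 3 (-2) (-2)); [reflexivity| |].
    + remove_relator (winv wt) (pw d (-2) ++ wt).
    + remove_relator (pw wa (-2) ++ winv d) d.
  - pose (c := pw wb 2 ++ wa). apply (not_large_solitar_l _ c 1 (-2) 5); [reflexivity| |].
    (* The relator [b c^2] is needed twice: [a = b^-2 c = b^-1 c^3], and then [b^-1 = c^2]. *)
    + symmetry. transitivity (winv wb ++ pw c 3).
      * remove_relator (wa ++ winv c ++ wb) (pw c 3).
      * remove_relator (wa ++ winv c) c.
    + remove_relator o (pw c (-2)).
  - apply (not_large_of_conj_power _ wa wb (winv wt) 1 2 3); [now left|now left|free|].
    symmetry. remove_relator o (wa ++ pw wb 2 ++ winv wa).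
  - pose (c := pw wb 2 ++ winv wa). apply (not_large_solitar_l _ c 1 (-2) (-5)); [reflexivity| |].
    (* Again two uses of [b = c^-2], one for each letter of [b^2] in [a = c^-1 b^2]. *)
    + transitivity (winv c ++ wb ++ pw c (-2)).
      * remove_relator (winv c ++ wb) (pw c (-2)).
      * remove_relator (winv c) (pw c (-4)).
    + remove_relator o (pw c (-2)).
Qed.

Lemma gpow_pw x n : gpow x n = pw [(x, true)] n.
Proof.
  unfold gpow, pw. assert (E : forall (l : letter gen) k, repeat l k = concat (repeat [l] k)).
  { intros l k. induction k; simpl; congruence. }
  destruct (0 <=? n); apply E.
Qed.

Lemma bs_not_large p q : Z.gcd p q = 1 -> ~ large [bs_rel p q].
Proof.
  intro G. apply (not_large_solitar_l _ wa p q 1); [now rewrite Z.mul_1_l|reflexivity|].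
  pose proof (peq_relator [bs_rel p q] (bs_rel p q) (or_introl eq_refl)) as H.
  set (R := [bs_rel p q]) in *.
  assert (E : bs_rel p q = wt ++ pw wa p ++ winv wt ++ pw wa (- q)).
  { unfold bs_rel, syl. simpl. now rewrite app_nil_r, !gpow_pw. }
  rewrite E in H.
  rewrite <- (app_nil_l (pw wa q)), <- H, <- !app_assoc, <- pw_add.
  rewrite Z.add_opp_diag_l. reflexivity.
Qed.

(** * Relators up to equivalence *)

(** A cut into two pieces instead of a rotation number: composition, inversion and substitution then
    require no arithmetic modulo the length. *)
Definition cyc {X} (u v : word X) : Prop := exists x y, u = x ++ y /\ v = y ++ x.

Lemma cyc_rot {X} (u v : word X) : cyc u v <-> exists k, rot k u = v.
Proof.
  split.
  - intros (x & y & -> & ->). exists (length x). unfold rot.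
    now rewrite skipn_app, firstn_app, Nat.sub_diag, skipn_all, firstn_all, app_nil_r.
  - intros [k <-]. exists (firstn k u), (skipn k u). split; [|reflexivity].
    symmetry. apply firstn_skipn.
Qed.

Lemma cyc_trans {X} (u v w : word X) : cyc u v -> cyc v w -> cyc u w.
Proof.
  intros (x & y & -> & ->) (z & t & E & ->).
  apply app_eq_app in E as [l [[-> ->]|[-> ->]]].
  - exists (x ++ z), l. now rewrite <- !app_assoc.
  - exists l, (t ++ y). now rewrite <- !app_assoc.
Qed.

Lemma cyc_winv {X} (u v : word X) : cyc u v -> cyc (winv u) (winv v).
Proof. intros (x & y & -> & ->). exists (winv y), (winv x). now rewrite !winv_app. Qed.

Lemma cyc_sym {X} (u v : word X) : cyc u v -> cyc v u.
Proof. intros (x & y & -> & ->). now exists y, x. Qed.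

Lemma cyc_peq_nil {X} (R : list (word X)) u v : cyc u v -> peq R u [] -> peq R v [].
Proof.
  intros (x & y & -> & ->) H.
  transitivity (y ++ (x ++ y) ++ winv y).
  - now rewrite <- !app_assoc, peq_winv_r, app_nil_r.
  - rewrite H. apply peq_winv_r.
Qed.

Lemma subst_inv_app ea et u v : subst_inv ea et (u ++ v) = subst_inv ea et u ++ subst_inv ea et v.
Proof. apply map_app. Qed.

Lemma subst_inv_involutive ea et w : subst_inv ea et (subst_inv ea et w) = w.
Proof.
  induction w as [|[[] b] w IH]; [reflexivity| |]; simpl; rewrite IH;
    destruct b, ea, et; reflexivity.
Qed.

Lemma subst_inv_winv ea et w : subst_inv ea et (winv w) = winv (subst_inv ea et w).
Proof.
  induction w as [|l w IH]; [reflexivity|].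
  rewrite winv_cons, subst_inv_app, IH. change (l :: w) with ([l] ++ w).
  rewrite subst_inv_app, winv_app. f_equal.
  destruct l as [[] []], ea, et; reflexivity.
Qed.

Lemma subst_inv_compose a b a' b' w :
  subst_inv a b (subst_inv a' b' w) = subst_inv (xorb a a') (xorb b b') w.
Proof.
  unfold subst_inv. rewrite map_map. apply map_ext. intros [[] c]; now rewrite xorb_assoc.
Qed.

Lemma cyc_subst_inv ea et u v : cyc u v -> cyc (subst_inv ea et u) (subst_inv ea et v).
Proof.
  intros (x & y & -> & ->). exists (subst_inv ea et x), (subst_inv ea et y).
  now rewrite !subst_inv_app.
Qed.

Lemma equiv_rel_cyc r w : equiv_rel r w <->
  exists s ea et, (s = r \/ s = winv r) /\ cyc s (subst_inv ea et w).
Proof.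
  split.
  - intros (s & k & ea & et & Hs & E). exists s, ea, et. split; [exact Hs|].
    apply cyc_rot. now exists k.
  - intros (s & ea & et & Hs & E). apply cyc_rot in E as [k E]. now exists s, k, ea, et.
Qed.

Lemma equiv_rel_trans r v w : equiv_rel r v -> equiv_rel v w -> equiv_rel r w.
Proof.
  rewrite !equiv_rel_cyc. intros (s & a & b & Hs & C) (s' & a' & b' & Hs' & C').
  apply (cyc_subst_inv a b) in C'. rewrite subst_inv_compose in C'.
  destruct Hs' as [->| ->].
  - exists s, (xorb a a'), (xorb b b'). split; [exact Hs|]. eapply cyc_trans; eassumption.
  - exists (winv s), (xorb a a'), (xorb b b'). split.
    + destruct Hs as [->| ->]; [now right | left; apply winv_involutive].
    + apply cyc_winv in C. rewrite <- subst_inv_winv in C. eapply cyc_trans; eassumption.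
Qed.

Lemma subst_inv_peq ea et R R' : (forall r, In r R -> peq R' (subst_inv ea et r) []) ->
  forall u v, peq R u v -> peq R' (subst_inv ea et u) (subst_inv ea et v).
Proof.
  intros H. apply (peq_ind_group R (fun u v => peq R' (subst_inv ea et u) (subst_inv ea et v))).
  - split; repeat intro; [reflexivity | now symmetry | etransitivity; eassumption].
  - intros u u' Hu v v' Hv. rewrite !subst_inv_app, Hu, Hv. reflexivity.
  - intros l. change [l; inv_letter l] with ([l] ++ winv [l]).
    rewrite subst_inv_app, subst_inv_winv. apply peq_winv_r.
  - exact H.
Qed.

(** [subst_inv] is an involutive automorphism of the free group and induces a surjection of the
    presented groups; largeness is pulled back along it. *)
Lemma large_subst_inv ea et R R' : (forall r, In r R -> peq R' (subst_inv ea et r) []) ->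
  large R' -> large R.
Proof.
  intros HR (H & Hpeq & Hnil & Happ & Hinv & [cs Hcs] & Y & y1 & y2 & Hy & phi & P1 & P2 & P3).
  set (f := subst_inv ea et).
  assert (F : forall u v, peq R u v -> peq R' (f u) (f v)) by now apply subst_inv_peq.
  exists (fun u => H (f u)). repeat split.
  - intros u v E. apply Hpeq. now apply F.
  - exact Hnil.
  - intros u v Hu Hv. unfold f. rewrite subst_inv_app. now apply Happ.
  - intros u Hu. unfold f. rewrite subst_inv_winv. now apply Hinv.
  - exists (map f cs). intro g. destruct (Hcs (f g)) as [c [Hc Hg]].
    exists (f c). split; [now apply in_map|].
    unfold f in *. now rewrite subst_inv_app, subst_inv_winv, subst_inv_involutive.
  - exists Y, y1, y2. split; [exact Hy|]. exists (fun u => phi (f u)). repeat split.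
    + intros u v Hu Hv E. apply P1; auto.
    + intros u v Hu Hv. unfold f in *. rewrite subst_inv_app. now apply P2.
    + intro z. destruct (P3 z) as [u [Hu E]]. exists (f u).
      unfold f. now rewrite subst_inv_involutive.
Qed.

Lemma large_equiv_rel r w : equiv_rel r w -> large [r] <-> large [w].
Proof.
  rewrite equiv_rel_cyc. intros (s & ea & et & Hs & C).
  assert (S : forall R, peq R s [] <-> peq R r []).
  { intro R. destruct Hs as [->| ->]; [reflexivity|]. split; intro E.
    - rewrite <- (winv_involutive r), E. reflexivity.
    - now rewrite E. }
  split; apply (large_subst_inv ea et); intros r' [<-|[]].
  - apply (cyc_peq_nil _ _ _ C), S, peq_relator. now left.
  - apply (cyc_subst_inv ea et) in C. rewrite subst_inv_involutive in C.
    assert (E : peq [w] (subst_inv ea et s) []).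
    { apply (cyc_peq_nil _ w); [now apply cyc_sym | apply peq_relator; now left]. }
    destruct Hs as [->| ->]; [exact E|].
    rewrite subst_inv_winv in E.
    rewrite <- (winv_involutive (subst_inv ea et r)), E. reflexivity.
Qed.

(** * The classification of short relators *)

(** The enumeration looks up very many rotated words; a trie answers in time proportional to the
    length of the word, not of the list. *)
Inductive trie : Type := Empty | Node (here : bool) (child : trie * trie * trie * trie).

Definition child (l : letter gen) (c : trie * trie * trie * trie) : trie :=
  let '(a, a', t, t') := c in
  match l with (ga, true) => a | (ga, false) => a' | (gt, true) => t | (gt, false) => t' end.

Definition set_child (l : letter gen) (x : trie) (c : trie * trie * trie * trie) :=
  let '(a, a', t, t') := c in
  match l with
  | (ga, true) => (x, a', t, t') | (ga, false) => (a, x, t, t')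
  | (gt, true) => (a, a', x, t') | (gt, false) => (a, a', t, x)
  end.

Definition no_child : trie * trie * trie * trie := (Empty, Empty, Empty, Empty).

Fixpoint trie_mem (w : word gen) (x : trie) : bool :=
  match x, w with
  | Empty, _ => false
  | Node b _, [] => b
  | Node _ c, l :: w => trie_mem w (child l c)
  end.

Fixpoint trie_insert (w : word gen) (x : trie) : trie :=
  let (b, c) := match x with Empty => (false, no_child) | Node b c => (b, c) end in
  match w with
  | [] => Node true c
  | l :: w => Node b (set_child l (trie_insert w (child l c)) c)
  end.

Lemma trie_mem_child_empty v k : trie_mem v (child k no_child) = false.
Proof. destruct v, k as [[] []]; reflexivity. Qed.

Lemma child_set_child k l x c :
  (k = l /\ child k (set_child l x c) = x) \/ child k (set_child l x c) = child k c.
Proof. destruct c as [[[? ?] ?] ?], k as [[] []], l as [[] []]; simpl; auto. Qed.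

Lemma trie_mem_insert v w x : trie_mem v (trie_insert w x) = true -> v = w \/ trie_mem v x = true.
Proof.
  revert v x. induction w as [|l w IH]; intros [|k v] x.
  - now left.
  - destruct x as [|b c]; simpl; [|now right]. destruct v, k as [[] []]; discriminate.
  - destruct x as [|b c]; simpl; [discriminate | now right].
  - assert (G : forall b c,
      trie_mem (k :: v) (Node b (set_child l (trie_insert w (child l c)) c)) = true ->
      k :: v = l :: w \/ trie_mem v (child k c) = true).
    { intros b c H. simpl in H.
      destruct (child_set_child k l (trie_insert w (child l c)) c) as [[-> E]|E]; rewrite E in H.
      - destruct (IH v _ H) as [->|M]; [now left | now right].
      - now right. }
    destruct x as [|b c]; intro H.
    + destruct (G false no_child H) as [|E]; [now left|].
      now rewrite trie_mem_child_empty in E.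
    + exact (G b c H).
Qed.

Definition trie_of (l : list (word gen)) : trie := fold_right trie_insert Empty l.

(** Soundness of the lookup: a positive answer names a listed word, whereas a missed word could only
    make the enumeration fail. *)
Lemma trie_mem_of l w : trie_mem w (trie_of l) = true -> In w l.
Proof.
  induction l as [|v l IH]; simpl; [destruct w; discriminate|].
  intro H. apply trie_mem_insert in H as [->|H]; auto.
Qed.

(** The bound 10 comes from the length [|p| + |q| + 2] of [bs_rel p q], which must not exceed 12. *)
Definition small_solitar : list (Z * Z) :=
  let l := map (fun n => Z.of_nat n - 11) (seq 0 23) in
  filter (fun x => (Z.gcd (fst x) (snd x) =? 1) && (Z.abs (fst x) + Z.abs (snd x) <=? 10))
    (list_prod l l).

Definition known_words : list (word gen) :=
  flat_map snd large_table ++ w13 ++ map (fun x => bs_rel (fst x) (snd x)) small_solitar.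

Lemma in_known_words w : In w known_words ->
  large [w] \/ In w w13 \/ exists p q, Z.gcd p q = 1 /\ w = bs_rel p q.
Proof.
  unfold known_words. intro H.
  apply in_app_or in H as [H|H]; [left|right; apply in_app_or in H as [H|H]; [now left|right]].
  - apply in_flat_map in H as (x & Hx & Hw).
    pose proof (proj1 (forallb_forall _ _) large_table_ok x Hx) as K.
    apply andb_true_iff in K as [K1 K2].
    exact (large_of_cert (fst x) w K1 (proj1 (forallb_forall _ _) K2 w Hw)).
  - apply in_map_iff in H as ([p q] & <- & Hx).
    apply filter_In in Hx as [_ Hx]. apply andb_true_iff in Hx as [Hx _].
    exists p, q. split; [now apply Z.eqb_eq | reflexivity].
Qed.

Definition bools : list bool := [true; false].

(* Unlike existsb, stops at the first success under call by value. *)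
Definition search {X} (f : X -> bool) (l : list X) : bool :=
  match find f l with Some _ => true | None => false end.

Lemma search_exists {X} (f : X -> bool) l : search f l = true -> exists x, In x l /\ f x = true.
Proof.
  unfold search. destruct (find f l) as [x|] eqn:E; [|discriminate].
  intros _. exists x. now apply find_some.
Qed.

(** Twelve values of [k] cover all rotations of a word of length at most 12. *)
Definition matches (known : trie) (w : word gen) : bool :=
  search (fun s => search (fun ea => search (fun et =>
    let v := subst_inv ea et s in
    search (fun k => trie_mem (rot k v) known) (seq 0 12)) bools) bools) [w; winv w].

Lemma matches_spec l w : matches (trie_of l) w = true -> exists v, In v l /\ equiv_rel w v.
Proof.
  unfold matches. intro H.
  apply search_exists in H as (s & Hs & H). apply search_exists in H as (ea & _ & H).
  apply search_exists in H as (et & _ & H). apply search_exists in H as (k & _ & H).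
  apply trie_mem_of in H. eexists. split; [exact H|].
  apply equiv_rel_cyc. exists s, ea, et. split; [destruct Hs as [<-|[<-|[]]]; auto|].
  assert (C : cyc (subst_inv ea et s) (rot k (subst_inv ea et s))) by (apply cyc_rot; eauto).
  apply (cyc_subst_inv ea et) in C. now rewrite subst_inv_involutive in C.
Qed.

Definition t_sign (l : letter gen) : Z := match l with (gt, b) => sgn b | (ga, _) => 0 end.

(* Explores the reduced words t a ... of exponent sum 0 in t with n letters left to
   choose; rw is the word read so far, reversed, and its last letter is l. *)
Fixpoint explore (known : trie) (n : nat) (rw : word gen) (l : letter gen) (s : Z) : bool :=
  match n with
  | O => if (s =? 0) && negb (letter_eqb gen gen_eqb l (gt, false))
         then matches known (rev (l :: rw)) else true
  | S n => forallb (fun k => if letter_eqb gen gen_eqb k (inv_letter l) then true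
             else explore known n (l :: rw) k (s + t_sign k)) letters
  end.

(** Two of at most twelve letters are fixed as t a, which leaves [n <= 10]. The [let] makes the trie
    be built once for all lengths. *)
Lemma explore_known_words n : (n <= 10)%nat ->
  explore (trie_of known_words) n [(gt, true)] (ga, true) 1 = true.
Proof.
  assert (H : (let known := trie_of known_words in
    forallb (fun n => explore known n [(gt, true)] (ga, true) 1) (seq 0 11)) = true)
    by vm_cast_no_check (eq_refl true).
  cbv zeta in H. intro Hn. exact (proj1 (forallb_forall _ _) H n ltac:(apply in_seq; lia)).
Qed.

Opaque known_words.

(** * Bringing a relator to the enumerated form *)

Lemma t_expsum_cons l w : t_expsum (l :: w) = t_sign l + t_expsum w.
Proof. destruct l as [[] []]; unfold t_expsum, t_sign, sgn; cbn [fold_right]; lia. Qed.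

Lemma t_expsum_app u v : t_expsum (u ++ v) = t_expsum u + t_expsum v.
Proof.
  induction u as [|l u IH]; [reflexivity|].
  simpl app. rewrite !t_expsum_cons, IH. lia.
Qed.

Lemma t_expsum_subst_inv ea et w :
  t_expsum (subst_inv ea et w) = if et then - t_expsum w else t_expsum w.
Proof.
  induction w as [|l w IH]; [now destruct et|].
  change (subst_inv ea et (l :: w)) with (subst_inv ea et [l] ++ subst_inv ea et w).
  rewrite t_expsum_app, IH, t_expsum_cons.
  assert (t_expsum (subst_inv ea et [l]) = if et then - t_sign l else t_sign l) as ->
    by (destruct l as [[] []], ea, et; reflexivity).
  destruct et; lia.
Qed.

Lemma reduced_tail {X} (l : letter X) w : reduced (l :: w) -> reduced w.
Proof. intros H u v k E. apply (H (l :: u) v k). now rewrite E. Qed.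

(** The exclusion of a final inverse of [t] reflects cyclic reduction, since the enumerated words
    begin with [t]. *)
Lemma explore_sound known n rw l s v :
  explore known n rw l s = true -> length v = n -> reduced (l :: v) ->
  s + t_expsum v = 0 -> last (l :: v) (ga, true) <> (gt, false) ->
  matches known (rev rw ++ l :: v) = true.
Proof.
  revert rw l s v. induction n as [|n IH]; intros rw l s v H Hv Hr Hs Hl.
  - destruct v; [|discriminate]. simpl in H, Hl, Hs.
    replace (s =? 0) with true in H by (unfold t_expsum in Hs; simpl in Hs; lia).
    destruct (letter_eqb gen gen_eqb l (gt, false)) eqn:E; [|exact H].
    now apply (letter_eqb_eq gen gen_eqb gen_eqb_eq) in E.
  - destruct v as [|k v]; [discriminate|]. cbn [explore] in H.
    rewrite forallb_forall in H.
    specialize (H k (in_letters k)).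
    destruct (letter_eqb gen gen_eqb k (inv_letter l)) eqn:E.
    + apply (letter_eqb_eq gen gen_eqb gen_eqb_eq) in E. subst k.
      now destruct (Hr [] v l).
    + rewrite t_expsum_cons in Hs.
      specialize (IH (l :: rw) k (s + t_sign k) v H ltac:(now injection Hv)
        (reduced_tail _ _ Hr) ltac:(lia) Hl).
      simpl rev in IH. now rewrite <- app_assoc in IH.
Qed.

(** A cancelling pair in the rotated word lies inside one of the two pieces or straddles the seam;
    in the latter case it consists of the last and the first letter of [u]. *)
Lemma reduced_cyc {X} (u v : word X) : cyclically_reduced u -> cyc u v -> reduced v.
Proof.
  intros [Hr Hc] (x & y & -> & ->) p q l E.
  apply app_eq_app in E as [k [[-> E]|[-> ->]]].
  - destruct k as [|k1 [|k2 k]]; simpl in E.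
    + subst x. apply (Hr [] (q ++ p ++ []) l). reflexivity.
    + injection E as E1 E2. subst k1 x. apply (Hc (inv_letter l) l (q ++ p)).
      * simpl. now rewrite app_assoc.
      * now rewrite inv_letter_involutive.
    + injection E as E1 E2 E3. subst k1 k2 q. apply (Hr (x ++ p) k l).
      now rewrite <- app_assoc.
  - apply (Hr k (q ++ y) l). now rewrite <- app_assoc.
Qed.

Lemma reduced_subst_inv ea et w : reduced w -> reduced (subst_inv ea et w).
Proof.
  intros H u v l E. apply (f_equal (subst_inv ea et)) in E.
  rewrite subst_inv_involutive in E.
  apply (H (subst_inv ea et u) (subst_inv ea et v) (hd l (subst_inv ea et [l]))).
  rewrite E. change (l :: inv_letter l :: v) with ([l] ++ [inv_letter l] ++ v).
  rewrite !subst_inv_app. destruct l as [[] []], ea, et; reflexivity.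
Qed.

Lemma split_at_first (x : gen) (w : word gen) :
  (forall l, In l w -> fst l <> x) \/
  exists p b q, w = p ++ (x, b) :: q /\ forall l, In l p -> fst l <> x.
Proof.
  induction w as [|[y b] w IH]; [now left|].
  destruct (gen_eqb y x) eqn:E.
  - apply gen_eqb_eq in E. subst y. right. now exists [], b, w.
  - assert (N : y <> x) by (intros ->; destruct x; discriminate).
    destruct IH as [IH|(p & c & q & -> & Hp)].
    + left. intros l [<-|H]; auto.
    + right. exists ((y, b) :: p), c, q. split; [reflexivity|]. intros l [<-|H]; auto.
Qed.

Lemma one_letter_power (x : gen) (w : word gen) : (forall l, In l w -> fst l = x) ->
  exists n, peq [] w (pw [(x, true)] n) /\ (x = gt -> n = t_expsum w).
Proof.
  induction w as [|[y b] w IH]; intro H; [exists 0; split; reflexivity|].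
  assert (y = x) as -> by exact (H (y, b) (or_introl eq_refl)).
  destruct IH as (n & E & S); [intros l Hl; apply H; now right|].
  exists (sgn b + n). split.
  - change ((x, b) :: w) with ([(x, b)] ++ w). rewrite E, pw_add. destruct b; reflexivity.
  - intros ->. rewrite t_expsum_cons, (S eq_refl). reflexivity.
Qed.

(** A word in [t] alone with exponent sum 0 is trivial, and so it too is a power of [a], with
    exponent 0. *)
Lemma contains_both_generators r : t_expsum r = 0 -> ~ is_power_of_a r ->
  (exists l, In l r /\ fst l <> ga) /\ (exists l, In l r /\ fst l <> gt).
Proof.
  intros Hs Hp. split; apply NNPP; intro N; apply Hp.
  - destruct (one_letter_power ga r) as (n & E & _).
    { intros l Hl. apply NNPP. intro D. apply N. eauto. }
    exists n. now rewrite gpow_pw.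
  - destruct (one_letter_power gt r) as (n & E & S).
    { intros l Hl. apply NNPP. intro D. apply N. eauto. }
    exists 0. rewrite (S eq_refl), Hs in E. exact E.
Qed.

(** Rotate so that a letter [t] or its inverse comes first. The letter before the first occurrence
    of [a] or its inverse is again of this kind, and the word is cut there. *)
Lemma cyc_to_t_a r : t_expsum r = 0 -> ~ is_power_of_a r ->
  exists b c v, cyc r ((gt, b) :: (ga, c) :: v).
Proof.
  intros Hs Hp. destruct (contains_both_generators r Hs Hp) as [(k & Hk & Nk) (l & Hl & Nl)].
  destruct k as [[] b]; [now destruct Nk|]. destruct l as [[] c]; [|now destruct Nl].
  apply in_split in Hk as (x & y & ->).
  assert (C : cyc (x ++ (gt, b) :: y) (((gt, b) :: y) ++ x)) by now exists x, ((gt, b) :: y).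
  destruct (split_at_first ga (((gt, b) :: y) ++ x)) as [N|(p & d & q & E & Hq)].
  - exfalso. apply (N (ga, c)); [|reflexivity].
    apply in_app_iff. apply in_app_iff in Hl. tauto.
  - rewrite E in C. destruct p as [|k0 p0] using rev_ind; [discriminate|]. clear IHp0.
    destruct k0 as [[] b']; [now destruct (Hq (ga, b')); [apply in_app_iff; right; left|]|].
    exists b', d, (q ++ p0). apply (cyc_trans _ _ _ C).
    exists p0, ((gt, b') :: (ga, d) :: q). now rewrite <- app_assoc.
Qed.

Lemma equiv_rel_known_word r : cyclically_reduced r -> (length r <= 12)%nat ->
  t_expsum r = 0 -> ~ is_power_of_a r -> exists w, In w known_words /\ equiv_rel r w.
Proof.
  intros Hr Hlen Hs Hp. destruct (cyc_to_t_a r Hs Hp) as (b & c & v & C).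
  pose (ea := negb c). pose (et := negb b). pose (u := subst_inv ea et v).
  set (w := (gt, true) :: (ga, true) :: u).
  assert (Ew : subst_inv ea et ((gt, b) :: (ga, c) :: v) = w).
  { unfold w, u, ea, et. simpl. destruct b, c; reflexivity. }
  assert (Red : forall z, cyc r z -> reduced (subst_inv ea et z)).
  { intros z Hz. apply reduced_subst_inv. now apply (reduced_cyc r). }
  assert (Rw : reduced w) by (rewrite <- Ew; now apply Red).
  assert (Lw : (length u <= 10)%nat).
  { destruct C as (x & y & -> & E). apply (f_equal (@length (letter gen))) in E.
    rewrite length_app in Hlen, E. unfold u, subst_inv. rewrite length_map.
    simpl in E. change (@length (gen * bool)) with (@length (letter gen)) in *. lia. }
  assert (Sw : t_expsum w = 0).
  { rewrite <- Ew, t_expsum_subst_inv. destruct C as (x & y & -> & ->).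
    rewrite t_expsum_app in *. destruct et; lia. }
  (* Were the last letter the inverse of [t], rotating it to the front would produce a cancelling
     pair in a rotation of [r], up to signs. *)
  assert (Last : last ((ga, true) :: u) (ga, true) <> (gt, false)).
  { intro L. destruct u as [|k u'] eqn:Eu using rev_ind; [discriminate L|]. clear IHu'.
    change ((ga, true) :: u' ++ [k]) with (((ga, true) :: u') ++ [k]) in L.
    rewrite last_last in L. subst k.
    assert (C' : cyc r (subst_inv ea et ((gt, false) :: (gt, true) :: (ga, true) :: u'))).
    { apply (cyc_trans _ _ _ C). rewrite <- (subst_inv_involutive ea et ((gt, b) :: _)), Ew.
      apply cyc_subst_inv. exists ((gt, true) :: (ga, true) :: u'), [(gt, false)].
      split; [|reflexivity]. unfold w. reflexivity. }
    apply Red in C'. rewrite subst_inv_involutive in C'.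
    now apply (C' [] ((ga, true) :: u') (gt, false)). }
  assert (M : matches (trie_of known_words) w = true).
  { pose proof (explore_known_words (length u) Lw) as K.
    exact (explore_sound _ _ [(gt, true)] (ga, true) 1 u K eq_refl (reduced_tail _ _ Rw)
      ltac:(unfold w in Sw; rewrite !t_expsum_cons in Sw; exact Sw) Last). }
  apply matches_spec in M as (z & Hz & Ez). exists z. split; [exact Hz|].
  apply (equiv_rel_trans _ w); [|exact Ez].
  apply equiv_rel_cyc. exists r, ea, et. split; [now left|].
  rewrite <- Ew, subst_inv_involutive. exact C.
Qed.

Theorem theorem3p3 (r : word gen) :
  cyclically_reduced r ->
  (length r <= 12)%nat ->
  t_expsum r = 0 ->
  ~ is_power_of_a r ->
  (~ large [r] <->
   ((exists w, In w w13 /\ equiv_rel r w) \/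
    (exists p q : Z, Z.gcd p q = 1 /\ equiv_rel r (bs_rel p q)))).
Proof.
  intros Hr Hlen Hs Hp. split.
  - intro NL. destruct (equiv_rel_known_word r Hr Hlen Hs Hp) as (w & Hw & E).
    destruct (in_known_words w Hw) as [L|[Hw'|(p & q & G & ->)]].
    + destruct NL. now apply (large_equiv_rel r w E).
    + left. eauto.
    + right. eauto.
  - intros [(w & Hw & E)|(p & q & G & E)] L; apply (large_equiv_rel r _ E) in L.
    + exact (w13_not_large w Hw L).
    + exact (bs_not_large p q G L).
Qed.
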